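(* Let $a\ge 0$ and $\lambda\ge 1$, let $w=w_\lambda(\cdot;a)$ be the symmetric Pollaczek weight on $[-1,1]$, and let $p_n$ be the corresponding orthonormal polynomials. Put $$F_n(w)=-\int_{-1}^1\log\left(p_n^2(x)w(x)\right)p_n^2(x)w(x)\,dx .$$ Then $$F_n(w)=\log(\pi)-1+o(1),\qquad n\to\infty .$$
   Context: For real parameters $\lambda>0$, $a\ge 0$, the symmetric Pollaczek weight is the (unit mass) weight on $[-1,1]$ $$w_\lambda(x;a)=\frac{2^{2\lambda}(\lambda+a)}{2\pi\,\Gamma(2\lambda)}(1-x^2)^{\lambda-1/2}\,e^{(2\arccos x-\pi)\frac{ax}{\sqrt{1-x^2}}}\left|\Gamma\left(\lambda+i\frac{ax}{\sqrt{1-x^2}}\right)\right|^2 .$$ The corresponding orthonormal polynomials $p_n=p_n^\lambda(\cdot;a)$ ($\deg p_n=n$, positive leading coefficient, $\int_{-1}^1 p_np_mw\,dx=\delta_{nm}$) satisfy $xp_n(x)=a_{n+1}p_{n+1}(x)+a_np_{n-1}(x)$, $p_{-1}=0$, $p_0=1$, with $a_n=\frac12\sqrt{\frac{n(n+2\lambda-1)}{(n+\lambda+a)(n+\lambda+a-1)}}$. The convention $0\log 0=0$ is used in the integrand. *)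

(* Defs.v *)
From HB Require Import structures.
From mathcomp Require Import all_boot all_order all_algebra.
From mathcomp Require Import complex.
From mathcomp Require Import all_classical all_reals all_analysis.

Set Implicit Arguments.
Unset Strict Implicit.
Unset Printing Implicit Defensive.

Import Order.TTheory GRing.Theory Num.Theory.
Import numFieldNormedType.Exports.

Local Open Scope classical_set_scope.
Local Open Scope ring_scope.

(* Euler's integral of t^(z-1) e^(-t) over t > 0, meaningful for Re z > 0; here
   t^(z-1) = t^(complex.Re z - 1) (cos (Im z ln t) + i sin (Im z ln t)), and the real
   and imaginary parts are integrated separately. *)
Definition cGamma (R : realType) (z : R[i]) : R[i] :=
  Complex
    (\int[@lebesgue_measure R]_(t in `]0, +oo[)
        (t `^ (complex.Re z - 1) * expR (- t) * cos (complex.Im z * ln t)))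
    (\int[@lebesgue_measure R]_(t in `]0, +oo[)
        (t `^ (complex.Re z - 1) * expR (- t) * sin (complex.Im z * ln t))).

(* At x = 1 and x = -1 the quotient a x / sqrt (1 - x^2) is a division by zero;
   the value taken there affects no integral. *)
Definition pollaczek_weight (R : realType) (lambda a x : R) : R :=
  let phi := a * x / Num.sqrt (1 - x ^+ 2) in
  2 `^ (2 * lambda) * (lambda + a)
    / (2 * pi * complex.Re (cGamma (Complex (2 * lambda) 0)))
  * (1 - x ^+ 2) `^ (lambda - 2^-1)
  * expR ((2 * acos x - pi) * phi)
  * ComplexField.Normc.normc (cGamma (Complex lambda phi)) ^+ 2.

Definition orthonormal_polys (R : realType) (w : R -> R)
    (p : nat -> {poly R}) : Prop :=
  [/\ forall n, size (p n) = n.+1,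
      forall n, 0 < lead_coef (p n)
    & forall n m,
        (\int[@lebesgue_measure R]_(x in `[(-1)%R, 1%R])
            ((p n).[x] * (p m).[x] * w x)%:E = ((n == m)%:R)%:E)%E].

(* The library's ln is 0 at 0, so the convention 0 log 0 = 0 holds. *)
Definition entropy (R : realType) (w : R -> R) (q : {poly R}) : \bar R :=
  (- \int[@lebesgue_measure R]_(x in `[(-1)%R, 1%R])
       (ln (q.[x] ^+ 2 * w x) * (q.[x] ^+ 2 * w x))%:E)%E.

(* Main.v *)
(* Let A_n increase to 1/2 and q_n satisfy x q_n = A_n q_(n+1) + A_(n-1) q_(n-1). The
   quantity turan_n = A_n^2 (q_n^2 + q_(n+1)^2) - A_n x q_n q_(n+1) is nondecreasing in n on
   [-1, 1]; when it has a finite limit S on ]-1, 1[, approximating by sequences that are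
   eventually 1/2 (Bernstein-Szego weights) shows that the q_n are orthonormal for
   sqrt (1 - x^2) / (2 pi S(x)). Darboux's method applied to the generating function
   (1 - t e^(i theta))^(- lambda + i phi) (1 - t e^(- i theta))^(- lambda - i phi), together
   with Euler's product for |Gamma (lambda + i phi)|^2, identifies this weight with a
   multiple of the Pollaczek weight and gives
   pi sin theta q_n^2 w = 2 sin^2 (Psi_n theta) + o(1) for an explicit phase Psi_n.
   On the bulk, where 4 A_n^2 - cos^2 theta >= (sin^2 theta) / 2, the left-hand side is at
   most 4 and the phase equidistributes modulo pi, so the entropy integral converges to its
   average over the phase, computed from log-sine integrals. Near the endpoints monotonicity
   of turan_n yields q_n^2 w <= C sqrt (1 - x^2) / (|4 A_n^2 - x^2| + 4 A_n^2 - 4 A_(n-1)^2),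
   which makes their contribution negligible. *)
Require Import Defs.
From HB Require Import structures.
From mathcomp Require Import all_boot all_order all_algebra.
From mathcomp Require Import complex ring lra zify.
From mathcomp Require Import all_classical all_reals all_analysis measurable_realfun.
Set Implicit Arguments.
Unset Strict Implicit.
Unset Printing Implicit Defensive.
Import Order.TTheory GRing.Theory Num.Theory.
Import numFieldNormedType.Exports.
Local Open Scope classical_set_scope.
Local Open Scope ring_scope.

(** * Integration *)

(** For [0 < a] the weight decays like the exponential of [- c / sqrt (1 - x^2)] at the endpoints,
    violates Szego's condition, and escapes the classical uniform asymptotics. Hence only pointwise
    asymptotics inside []-1, 1[] are established; dominated convergence does the rest, and near the
    endpoints the bounds come from the recurrence coefficients alone. The condition [1 <= lambda]
    makes these coefficients increase ([pDelta_ge0]) and the moduli of the binomial coefficients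
    nondecreasing ([c_nd]). No normalising constant is computed: the asymptotics fix the weight up
    to a factor, and orthonormality fixes the factor. In the variable [theta], with
    [F = pi sin theta q_n^2 w], the integrand [q_n^2 w ln (q_n^2 w)] becomes
    [(F ln F - F ln (pi sin theta)) / pi]; for [F = 2 sin^2] of an equidistributed phase the two
    terms in parentheses have means [1 - ln 2] and [ln pi - ln 2], whence [1 - ln pi]. Near the
    endpoints an angular width of order [sqrt (pD n)] has to beat [ln (2 / gap n) ^ 2]; it does,
    since [pD n] is [O(1/n)] and [gap n], when not identically zero, is only polynomially small. *)

Lemma scale_oE (K : pzRingType) (a b : K) : a *: (b : K^o) = a * b. Proof. by []. Qed.

Section IntegrationTools.
Context {R : realType}.
Local Notation mu := (@lebesgue_measure R).
Implicit Types (f F g : R -> R) (a b x : R) (D : set R).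

Lemma integrable_cc f a b : (forall x, a <= x <= b -> {for x, continuous f}) ->
  mu.-integrable `[a, b] (EFin \o f).
Proof.
move=> cf; apply: continuous_compact_integrable; first exact: segment_compact.
by apply: continuous_in_subspaceT => x; rewrite inE/= in_itv/= => /cf.
Qed.

Lemma Rintegral_FTC F f a b : a <= b ->
  (forall x, a <= x <= b -> is_derive x 1 F (f x)) ->
  (forall x, a <= x <= b -> {for x, continuous f}) ->
  \int[mu]_(x in `[a, b]) f x = F b - F a.
Proof.
rewrite le_eqVlt => /predU1P[<- _ _|ab dF cf].
  by rewrite set_itv1 Rintegral_set1 subrr.
have dFx x : a <= x <= b -> derivable F x 1 by move=> /dF [].
have cF x : a <= x <= b -> {for x, continuous F}.
  by move=> /dFx /derivable1_diffP /differentiable_continuous.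
rewrite /Rintegral (@continuous_FTC2 _ f F)//.
- by apply: continuous_in_subspaceT => x; rewrite inE/= in_itv/= => /cf.
- split.
  + by move=> x; rewrite in_itv/= => /andP[/ltW ax /ltW xb]; apply: dFx; rewrite ax.
  + by apply/cvg_at_right_filter/cF; rewrite lexx ltW.
  + by apply/cvg_at_left_filter/cF; rewrite lexx ltW.
- move=> x; rewrite in_itv/= => /andP[/ltW ax /ltW xb].
  by rewrite derive1E; apply: derive_val; apply: dF; rewrite ax.
Qed.

Lemma Rdominated_cvg D (f_ : nat -> R -> R) f g : measurable D ->
  (forall n, measurable_fun D (f_ n)) ->
  (forall x, D x -> f_ n x @[n --> \oo] --> f x) ->
  mu.-integrable D (EFin \o g) ->
  (forall n x, D x -> `|f_ n x| <= g x) ->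
  mu.-integrable D (EFin \o f) /\
  (\int[mu]_(x in D) f_ n x) @[n --> \oo] --> \int[mu]_(x in D) f x.
Proof.
move=> mD mf ff ig fg.
have mf' : measurable_fun D f by apply: (measurable_fun_cvg mf) => x Dx; exact: ff.
have [|||||i _ c] := @dominated_convergence _ _ _ mu D mD
  (fun n => EFin \o f_ n) (EFin \o f) (EFin \o g).
- by move=> n; apply/measurable_EFinP; exact: mf.
- exact/measurable_EFinP.
- by apply: aeW => x Dx; apply: cvg_EFin; [exact: nearW|exact: ff].
- exact: ig.
- by apply: aeW => x n Dx; rewrite lee_fin fg.
split => //; apply: fine_cvg; rewrite fineK//.
by have /integrable_fin_num := i; apply.
Qed.


Lemma continuous_on_measurable D f : measurable D -> open D ->
  (forall x, D x -> {for x, continuous f}) -> measurable_fun D f.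
Proof.
move=> mD oD cf; apply: open_continuous_measurable_fun => // x /set_mem Dx; exact: cf.
Qed.

Lemma integrable_scale D f (c : R) : measurable D -> mu.-integrable D (EFin \o f) ->
  mu.-integrable D (EFin \o (fun x => c * f x)).
Proof.
move=> mD fi; have := @integrableZl _ _ R mu D mD c _ fi.
by apply: eq_integrable => // x _ /=.
Qed.

Lemma integrable_add D f g : measurable D -> mu.-integrable D (EFin \o f) ->
  mu.-integrable D (EFin \o g) -> mu.-integrable D (EFin \o (fun x => f x + g x)).
Proof.
move=> mD fi gi; have := @integrableD _ _ R mu D mD _ _ fi gi.
by apply: eq_integrable => // x _ /=.
Qed.

Lemma integrable_sub D f g : measurable D -> mu.-integrable D (EFin \o f) ->
  mu.-integrable D (EFin \o g) -> mu.-integrable D (EFin \o (fun x => f x - g x)).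
Proof.
move=> mD fi gi; have := @integrableB _ _ R mu D mD _ _ fi gi.
by apply: eq_integrable => // x _ /=.
Qed.

Lemma integrable_dom D f g : measurable D -> measurable_fun D f ->
  (forall x, D x -> `|f x| <= g x) -> mu.-integrable D (EFin \o g) ->
  mu.-integrable D (EFin \o f).
Proof.
move=> mD mf fg gi; apply: (@le_integrable _ _ R mu D mD _ (EFin \o g)) => //.
  exact/measurable_EFinP.
by move=> x Dx /=; rewrite lee_fin (le_trans (fg x Dx))// ler_norm.
Qed.

Section Improper.
Variables (D : set R) (f F : R -> R) (u v : nat -> R).
Hypotheses (mD : measurable D) (uv : forall n, u n <= v n).
Hypothesis uvD : forall n x, u n <= x <= v n -> D x.
Hypothesis Duv : forall x, D x -> \forall n \near \oo, u n <= x <= v n.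
Hypothesis dF : forall x, D x -> is_derive x 1 F (f x).
Hypothesis cf : forall x, D x -> {for x, continuous f}.

Let Iuv n : \int[mu]_(x in `[u n, v n]) f x = F (v n) - F (u n).
Proof. by apply: Rintegral_FTC => // x /uvD; [exact: dF|exact: cf]. Qed.

Let iuv n : mu.-integrable `[u n, v n] (EFin \o f).
Proof. by apply: integrable_cc => x /uvD; exact: cf. Qed.

(** The truncations of [f] to [[u n, v n]] are dominated by [|f|], so their integrals
    [F (v n) - F (u n)] tend to that of [f]. *)
Lemma Rintegral_FTC_improper l : mu.-integrable D (EFin \o f) ->
  (F (v n) - F (u n)) @[n --> \oo] --> l -> \int[mu]_(x in D) f x = l.
Proof.
move=> fi Fl.
have [||||_] := @Rdominated_cvg D (fun n => f \_ `[u n, v n]) f (fun x => `|f x|) mD.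
- move=> n; apply: measurable_funTS; apply/(measurable_restrictT _ _).1 => //.
  by have /integrableP[/measurable_EFinP] := iuv n.
- move=> x Dx; apply: cvg_near_cst; apply: filterS (Duv Dx) => n h.
  by rewrite patchE mem_set//= in_itv.
- exact: integrable_norm fi.
- by move=> n x Dx; rewrite patchE; case: ifPn => // _; rewrite normr0.
have -> : (fun n => \int[mu]_(x in D) (f \_ `[u n, v n]) x) = fun n => F (v n) - F (u n).
  apply/funext => n; rewrite -Iuv -Rintegral_mkcondr; congr Rintegral.
  by apply/seteqP; split => [x []//|x h]; split => //; apply: (@uvD n); move: h; rewrite /= in_itv.
by move=> h; apply: (@cvg_unique _ _ _ _ _ _ h) => //; exact: Rhausdorff.
Qed.

(** For nonnegative [f] and growing segments, monotone convergence turns a bound on the increments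
    of a primitive into integrability. *)
Lemma integrable_FTC_improper C : {homo u : n m / (n <= m)%N >-> m <= n} ->
  {homo v : n m / (n <= m)%N >-> n <= m} ->
  (forall x, D x -> 0 <= f x) -> (forall n, F (v n) - F (u n) <= C) ->
  mu.-integrable D (EFin \o f).
Proof.
move=> nu nv f0 FC.
have UD : \bigcup_n `[u n, v n]%classic = D.
  apply/seteqP; split => [x [n _] /=|x Dx]; first by rewrite in_itv; exact: uvD.
  by have [n _ /(_ n (leqnn n)) h] := Duv Dx; exists n => //=; rewrite in_itv.
have mn n : measurable_fun `[u n, v n] (EFin \o f).
  by have /integrableP[] := iuv n.
have mf : measurable_fun D (EFin \o f) by rewrite -UD measurable_fun_bigcup.
apply/integrableP; split => //.
under eq_integral => x /set_mem Dx do rewrite /= ger0_norm ?f0//.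
rewrite -UD; apply: (@le_lt_trans _ _ C%:E); last exact: ltry.
have nd : nondecreasing_seq (fun n => `[u n, v n]%classic).
  move=> n m nm; apply/subsetPset => x /=; rewrite !in_itv/= => /andP[h1 h2].
  by rewrite (le_trans (nu _ _ nm) h1) (le_trans h2 (nv _ _ nm)).
have h : (\int[mu]_(x in `[u n, v n]) (f x)%:E @[n --> \oo] --> \int[mu]_(x in \bigcup_n `[u n, v n]%classic) (f x)%:E)%E.
  apply: ge0_nondecreasing_set_cvg_integral => // n x /=.
  by rewrite in_itv lee_fin => /uvD; exact: f0.
rewrite -(cvg_lim _ h)//; apply: lime_le; first by apply/cvg_ex; eexists; exact: h.
apply: nearW => n; have /integrable_fin_num h1 := iuv n.
rewrite -[leLHS]fineK ?h1// lee_fin; apply: le_trans (FC n); rewrite -Iuv; exact: lexx.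
Qed.

End Improper.
Lemma is_derive_continuous f df x : is_derive x 1 f df -> {for x, continuous f}.
Proof. by case=> /derivable1_diffP /differentiable_continuous. Qed.

Lemma is_derive0_eq F a b : a <= b -> (forall x, a <= x <= b -> is_derive x 1 F 0) ->
  F b = F a.
Proof.
move=> ab dF; apply/eqP; rewrite -subr_eq0; apply/eqP.
rewrite -(Rintegral_FTC ab dF) ?Rintegral_cst ?mul0r// => x _; exact: cvg_cst.
Qed.

Lemma normr_sin_le x : `|sin x| <= `|x|.
Proof.
have key (y : R) : 0 <= y -> `|sin y| <= `|y|.
  move=> y0; have [|z _ c] := @MVT_segment _ (@sin R) cos _ _ y0.
    by apply: continuous_subspaceT; exact: continuous_sin.
  by rewrite -[sin y]subr0 -[X in _ - X]sin0 c subr0 normrM ler_piMl// cos_max.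
have [x0|/ltW x0] := leP 0 x; first exact: key.
by have := key (- x); rewrite oppr_ge0 sinN !normrN; exact.
Qed.

Lemma one_minus_cos_le x : 1 - cos x <= x ^+ 2.
Proof.
have e : cos x = 1 - 2 * sin (x / 2) ^+ 2.
  by rewrite [in LHS](_ : x = (x / 2) *+ 2) ?cos_mulr2n ?cos2sin2; [ring|rewrite -mulr_natr; field].
have : sin (x / 2) ^+ 2 <= (x / 2) ^+ 2.
  by rewrite -[leLHS]real_normK ?num_real// -[leRHS]real_normK ?num_real// lerXn2r ?nnegrE// normr_sin_le.
rewrite e; nra.
Qed.

(** With [u] the square root of [y] the right-hand side is [4 * (u - u^-1) ^+ 2], and
    [1 + t <= expR t] at both signs compares [ln y / 2] with [u - u^-1]. The bound is a combination
    of [y], [1] and [y^-1], so integrated against the Gamma kernel it only produces neighbouring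
    Gamma values ([gnorm2_ge]). *)
Lemma sqr_ln_le (y : R) : 0 < y -> ln y ^+ 2 <= 4 * (y - 2 + y^-1).
Proof.
move=> y0; pose u := expR (ln y / 2).
have u0 : 0 < u by exact: expR_gt0.
have uy : y = u ^+ 2 by rewrite /u expr2 -expRD -splitr lnK ?posrE.
have h1 : 1 + ln y / 2 <= u by exact: expR_ge1Dx.
have h2 : 1 - ln y / 2 <= u^-1 by rewrite /u -expRN; apply: expR_ge1Dx.
have -> : y - 2 + y^-1 = (u - u^-1) ^+ 2 by rewrite uy; field; rewrite gt_eqF.
have uu : u * u^-1 = 1 by rewrite divff// gt_eqF.
have ui0 : 0 < u^-1 by rewrite invr_gt0.
have [l0|l0] := leP 0 (ln y).
  have : u^-1 <= 1 by rewrite invf_le1// (le_trans _ h1)//; lra.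
  by nra.
have : u <= 1 by rewrite -expR0 /u ler_expR; lra.
by nra.
Qed.

End IntegrationTools.

(** * Three-term recurrences *)

Section PolyBasis.
Variable K : fieldType.

Lemma poly_basis (b : nat -> {poly K}) : (forall n, size (b n) = n.+1) ->
  forall N (g : {poly K}), (size g <= N)%N ->
  exists c : nat -> K, g = \sum_(k < N) c k *: b k.
Proof.
move=> sb; elim=> [|N IH] g sg.
  by exists (fun=> 0); rewrite big_ord0; apply/eqP; rewrite -size_poly_leq0.
have lb : lead_coef (b N) != 0 by rewrite lead_coef_eq0 -size_poly_eq0 sb.
pose d := g`_N / lead_coef (b N).
have [|c hc] := IH (g - d *: b N).
  apply/leq_sizeP => j; rewrite leq_eqVlt => /predU1P[<-|Nj].
    have eN : (b N)`_N = lead_coef (b N) by rewrite lead_coefE sb.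
    by rewrite coefB coefZ /d eN mulfVK ?subrr.
  by rewrite coefB coefZ !nth_default ?mulr0 ?subr0// ?sb// (leq_trans sg).
exists (fun k => if k == N then d else c k).
rewrite big_ord_recr/= eqxx -[LHS](subrK (d *: b N)) hc; congr (_ + _).
by apply: eq_bigr => i _; rewrite (ltn_eqF (ltn_ord i)).
Qed.

End PolyBasis.

Section ThreeTerm.
Variables (R : realType) (A : nat -> R).

(** Carrying two consecutive polynomials makes the two-step recursion structural. The index is
    shifted with respect to the usual one: [A n] couples [q n] and [q n.+1]. *)
Fixpoint tt_pair n : {poly R} * {poly R} :=
  if n is m.+1 then
    ((tt_pair m).2,
     (A m.+1)^-1 *: ('X * (tt_pair m).2 - A m *: (tt_pair m).1))
  else (1, (A 0)^-1 *: 'X).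
Definition tt_poly n := (tt_pair n).1.
Local Notation q := tt_poly.

Lemma tt_poly0 : q 0 = 1. Proof. by []. Qed.

Hypothesis A0 : forall n, 0 < A n.
Let An0 n : A n != 0. Proof. by rewrite gt_eqF. Qed.

Lemma tt_poly1 : A 0 *: q 1 = 'X.
Proof. by rewrite /q/= scalerA divff ?scale1r. Qed.

Lemma tt_polySS n : A n.+1 *: q n.+2 = 'X * q n.+1 - A n *: q n.
Proof. by rewrite /q/= scalerA divff ?scale1r. Qed.

Lemma size_lead_tt_poly n : size (q n) = n.+1 /\ 0 < lead_coef (q n).
Proof.
suff: (size (q n) = n.+1 /\ 0 < lead_coef (q n)) /\
      (size (q n.+1) = n.+2 /\ 0 < lead_coef (q n.+1)) by case.
elim: n => [|n [IH1 [s1 l1]]].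
  split; first by rewrite tt_poly0 size_poly1 lead_coef1.
  by rewrite /q/= size_scale ?invr_eq0 ?An0// size_polyX lead_coefZ lead_coefX mulr1 invr_gt0.
split => //.
have -> : q n.+2 = (A n.+1)^-1 *: ('X * q n.+1 - A n *: q n) by [].
have sX : size ('X * q n.+1) = n.+3.
  by rewrite mulrC size_mulX ?s1// -size_poly_eq0 s1.
have lt : (size (- (A n *: q n))%R < size ('X * q n.+1)%R)%N.
  by rewrite size_polyN sX (leq_ltn_trans (size_scale_leq _ _))// IH1.1.
rewrite size_scale ?invr_eq0// size_polyDl// sX; split => //.
by rewrite lead_coefZ lead_coefDl// lead_coefM lead_coefX mul1r mulr_gt0 ?invr_gt0.
Qed.

Lemma size_tt_poly n : size (q n) = n.+1.
Proof. by case: (size_lead_tt_poly n). Qed.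

(* The Jacobi matrix acting on sequences; [vec g] is [g(J) e_0] and its zeroth
   entry is the moment functional for which the [q n] are orthonormal. *)
Definition jac (s : nat -> R) k :=
  A k * s k.+1 + (if k is k'.+1 then A k' * s k' else 0).
Definition vec (g : {poly R}) k :=
  \sum_(i < size g) g`_i * iter i jac (fun k => (k == 0)%:R) k.
Definition mom g := vec g 0.

Lemma vecE N (g : {poly R}) k : (size g <= N)%N ->
  vec g k = \sum_(i < N) g`_i * iter i jac (fun k => (k == 0)%:R) k.
Proof.
move=> sN; rewrite /vec (big_ord_widen N (fun i => g`_i * iter i jac (fun k => (k == 0)%:R) k))//.
rewrite big_mkcond/=; apply: eq_bigr => i _; case: ltnP => // h.
by rewrite nth_default ?mul0r.
Qed.

Lemma vecZD c g h k : vec (c *: g + h) k = c * vec g k + vec h k.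
Proof.
pose N := maxn (size g) (size h).
have sg : (size g <= N)%N by rewrite leq_maxl.
have sh : (size h <= N)%N by rewrite leq_maxr.
rewrite (@vecE N g k)// (@vecE N h k)// (@vecE N).
  rewrite mulr_sumr -big_split; apply: eq_bigr => i _/=.
  by rewrite coefD coefZ; ring.
by rewrite (leq_trans (size_polyD _ _))// geq_max sh (leq_trans (size_scale_leq _ _)).
Qed.

Lemma vec0 k : vec 0 k = 0. Proof. by rewrite /vec size_poly0 big_ord0. Qed.
Lemma vecZ c g k : vec (c *: g) k = c * vec g k.
Proof. by rewrite -[c *: g]addr0 vecZD vec0 addr0. Qed.
Lemma vecD g h k : vec (g + h) k = vec g k + vec h k.
Proof. by rewrite -[g in LHS]scale1r vecZD mul1r. Qed.
Lemma vecB g h k : vec (g - h) k = vec g k - vec h k.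
Proof. by rewrite -scaleN1r addrC vecZD mulN1r addrC. Qed.
Lemma vec_sum N (g : nat -> {poly R}) k :
  vec (\sum_(i < N) g i) k = \sum_(i < N) vec (g i) k.
Proof.
by elim: N => [|N IH]; rewrite ?big_ord0 ?vec0// !big_ord_recr/= vecD IH.
Qed.

Lemma vec1 k : vec 1 k = (k == 0)%:R.
Proof. by rewrite /vec size_poly1 big_ord1 coef1/= mul1r. Qed.

Lemma vecX g k : vec ('X * g) k = jac (vec g) k.
Proof.
rewrite (@vecE (size g).+1); last first.
  by rewrite mulrC (leq_trans (size_polyMleq _ _))// size_polyX addn2.
rewrite big_ord_recl coefXM/= mul0r add0r /jac.
under eq_bigr => i _ do rewrite coefXM/= /jac.
case: k => [|k]; rewrite /vec mulr_sumr ?addr0.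
  by apply: eq_bigr => i _; rewrite addr0; ring.
by rewrite mulr_sumr -big_split; apply: eq_bigr => i _ /=; ring.
Qed.

(** The recurrence for [q] is the row identity of the Jacobi matrix,
    [J e_(n+1) = A_(n+1) e_(n+2) + A_n e_n]; by induction [q_n(J)] sends the first basis vector to
    the [n]-th one. *)
Lemma vec_tt n k : vec (q n) k = (k == n)%:R.
Proof.
suff: (forall k, vec (q n) k = (k == n)%:R) /\ (forall k, vec (q n.+1) k = (k == n.+1)%:R) by case.
elim: n {k} => [|n [IH IH1]]; split => //; [exact: vec1| |]; move=> k.
  apply: (mulfI (An0 0)); rewrite -vecZ tt_poly1 -['X]mulr1 vecX /jac vec1 /=.
  by case: k => [|[|k]] /=; rewrite ?vec1 ?mulr0 ?addr0 ?add0r ?mulr1 ?mulr0.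
apply: (mulfI (An0 n.+1)); rewrite -vecZ tt_polySS vecB vecX vecZ IH /jac !IH1.
case: k => [|k]; rewrite ?IH1 ?eqSS.
  by case: n {IH IH1} => [|n] /=; ring.
have [->|kn1] := eqVneq k n.+1.
  by rewrite (_ : (n.+2 == n) = false) /=; [ring|lia].
have [->|kn] := eqVneq k.+1 n; first by rewrite /=; ring.
by case: (eqVneq k n) => [->|_] /=; ring.
Qed.

(** This is the symmetry of [J]: the zeroth entry of [q_k(J) g(J) e_0] pairs [q_k(J) e_0 = e_k] with
    [g(J) e_0]. *)
Lemma mom_tt k g : mom (q k * g) = vec g k.
Proof.
suff: (forall g, mom (q k * g) = vec g k) /\ (forall g, mom (q k.+1 * g) = vec g k.+1) by case.
elim: k {g} => [|k [IH IH1]]; split => // g.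
- by rewrite tt_poly0 mul1r.
- apply: (mulfI (An0 0)).
  by rewrite /mom -vecZ scalerAl tt_poly1 vecX /jac addr0.
- apply: (mulfI (An0 k.+1)).
  rewrite /mom -vecZ scalerAl tt_polySS mulrBl vecB mulrAC -mulrA [g * _]mulrC mulrCA -scalerAl vecZ.
  by rewrite -/(mom _) -/(mom _) IH1 IH vecX /jac addrK.
Qed.

Lemma mom_orth j k : mom (q j * q k) = (j == k)%:R.
Proof. by rewrite mom_tt vec_tt. Qed.

Lemma vec_expand N (g : {poly R}) : (size g <= N)%N -> g = \sum_(k < N) vec g k *: q k.
Proof.
move=> sN; have [c hc] := poly_basis size_tt_poly sN.
rewrite [LHS]hc; apply: eq_bigr => k _; congr (_ *: _).
rewrite hc (vec_sum _ (fun i => c i *: q i)) (bigD1 k)//= vecZ vec_tt eqxx mulr1 big1 ?addr0// => i ik.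
by rewrite vecZ vec_tt (inj_eq val_inj) eq_sym (negPf ik) mulr0.
Qed.

Lemma vec_eq0 (g : {poly R}) k : (size g <= k)%N -> vec g k = 0.
Proof.
move=> sk; rewrite (vec_expand sk) (vec_sum _ (fun i => vec g i *: q i)) big1// => i _.
by rewrite vecZ vec_tt gtn_eqF ?mulr0.
Qed.

Lemma mom_sqr N (g : {poly R}) : (size g <= N)%N -> mom (g * g) = \sum_(k < N) vec g k ^+ 2.
Proof.
move=> sN; rewrite [X in X * _](vec_expand sN) mulr_suml /mom (vec_sum _ (fun i => (vec g i *: q i) * g)).
by apply: eq_bigr => k _; rewrite -scalerAl vecZ -/(mom _) mom_tt expr2.
Qed.

Lemma mom_sqr_ge0 g : 0 <= mom (g * g).
Proof. by rewrite (mom_sqr (leqnn _)); apply: sumr_ge0 => i _; exact: sqr_ge0. Qed.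

Definition turan n : {poly R} :=
  A n ^+ 2 *: (q n ^+ 2 + q n.+1 ^+ 2) - A n *: ('X * (q n * q n.+1)).

Lemma turan0 : turan 0 = (A 0 ^+ 2)%:P.
Proof.
rewrite /turan tt_poly0 -tt_poly1 -!mul_polyC polyCM; ring.
Qed.

(** The recurrence replaces [A n.+1 *: q n.+2 - 'X * q n.+1] by [- A n *: q n], after which only the
    coefficient of [q n.+1 ^+ 2] differs. Increasing [A] therefore gives increasing [turan]. *)
Lemma turanS n : turan n.+1 = turan n + (A n.+1 ^+ 2 - A n ^+ 2) *: q n.+1 ^+ 2.
Proof.
have -> : turan n.+1 = A n.+1 ^+ 2 *: q n.+1 ^+ 2
    + (A n.+1 *: q n.+2) * (A n.+1 *: q n.+2 - 'X * q n.+1).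
  by rewrite /turan -!mul_polyC; ring.
by rewrite tt_polySS /turan -!mul_polyC; ring.
Qed.

(** Completing the square: where [x ^+ 2 < 4 * A n ^+ 2] both terms are nonnegative, so [turan]
    controls [q n ^+ 2] there. *)
Lemma horner_turan n x : (turan n).[x] =
  (A n * (q n.+1).[x] - x / 2 * (q n).[x]) ^+ 2 + (A n ^+ 2 - x ^+ 2 / 4) * (q n).[x] ^+ 2.
Proof. rewrite /turan !(hornerD, hornerN, hornerZ, hornerM, hornerXn, hornerX, horner_exp); by field. Qed.

Hypothesis A_half : forall n, A n <= 2^-1.

(* The spectrum of the Jacobi matrix lies in [-1, 1]. *)
Lemma mom_oneBX2_ge0 (g : {poly R}) : 0 <= mom ((1 - 'X ^+ 2) * (g * g)).
Proof.
have -> : (1 - 'X ^+ 2) * (g * g) = g * g - ('X * g) * ('X * g) by ring.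
rewrite /mom vecB -!/(mom _) subr_ge0.
pose N := (size g).+1.
have sX : (size ('X * g)%R <= N)%N.
  by rewrite mulrC (leq_trans (size_polyMleq _ _))// size_polyX addn2.
rewrite (mom_sqr sX) (mom_sqr (leqW (leqnn (size g)))) -/N.
(* From [A n <= 1/2] and [(x + y)^2 <= 2 x^2 + 2 y^2], each entry of [J v] squared is at most half
   the sum of the squares of its two neighbours. Summation shows that [J] is a contraction. *)
have jb k : vec ('X * g) k ^+ 2 <=
    2^-1 * vec g k.+1 ^+ 2 + (if k is k'.+1 then 2^-1 * vec g k' ^+ 2 else 0).
  have hA n (u : R) : (A n * u) ^+ 2 <= 4^-1 * u ^+ 2.
    rewrite exprMn ler_wpM2r ?sqr_ge0//.
    have /andP[h1 h2] : 0 <= A n <= 2^-1 by rewrite A_half ltW.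
    by rewrite (_ : 4^-1 = 2^-1 ^+ 2); [rewrite lerXn2r ?nnegrE// invr_ge0|field].
  rewrite vecX /jac; case: k => [|k].
    rewrite !addr0 (le_trans (hA _ _))// ler_wpM2r ?sqr_ge0//; lra.
  have := hA k.+1 (vec g k.+2); have := hA k (vec g k).
  by set x := A k.+1 * _; set y := A k * _; have := sqr_ge0 (x - y); nra.
apply: le_trans; first by apply: ler_sum => k _; exact: jb.
rewrite big_split/=.
have -> : \sum_(k < N) (if nat_of_ord k is k'.+1 then 2^-1 * vec g k' ^+ 2 else 0)
    = \sum_(k < N.-1) 2^-1 * vec g k ^+ 2.
  by rewrite [in LHS]/N big_ord_recl/= add0r.
have -> : \sum_(k < N) vec g k ^+ 2 = 2^-1 * (\sum_(k < N) vec g k ^+ 2) + 2^-1 * (\sum_(k < N) vec g k ^+ 2).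
  by field.
rewrite lerD//; last first.
  rewrite /N /= big_ord_recr/= mulrDr -mulr_sumr lerDl.
  by rewrite mulr_ge0 ?invr_ge0 ?sqr_ge0.
rewrite -mulr_sumr ler_wpM2l ?invr_ge0//.
rewrite /N big_ord_recr/= [vec g (size g).+1]vec_eq0// expr0n addr0.
by rewrite [leRHS]big_ord_recl/= lerDr sqr_ge0.
Qed.

End ThreeTerm.

Lemma eq_tt_poly (R : realType) (A B : nat -> R) n :
  (forall k, (k < n)%N -> A k = B k) -> tt_poly A n = tt_poly B n.
Proof.
suff: (forall k, (k < n)%N -> A k = B k) -> tt_poly A n = tt_poly B n /\
   ((forall k, (k < n.+1)%N -> A k = B k) -> tt_poly A n.+1 = tt_poly B n.+1).
  by move=> h /h[].
elim: n => [_|n IH hn].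
  by split => // h; rewrite /tt_poly/= h.
have [IH1 IH2] := IH (fun k kn => hn k (leqW kn)).
split; first exact: IH2.
move=> h; have e (C : nat -> R) : tt_poly C n.+2 =
  (C n.+1)^-1 *: ('X * tt_poly C n.+1 - C n *: tt_poly C n) by [].
by rewrite !e IH1 IH2// !h.
Qed.

(** * Chebyshev polynomials of both kinds *)

Section Chebyshev.
Variable R : realType.

(** The recursion is the pair of addition formulas for the cosine and the sine of [(n + 1) t], with
    ['X] standing for [cos t] and one factor [sin t] taken out of the second component. *)
Fixpoint cheb n : {poly R} * {poly R} :=
  if n is m.+1 then
    ('X * (cheb m).1 - (1 - 'X ^+ 2) * (cheb m).2, (cheb m).1 + 'X * (cheb m).2)
  else (1, 0).
(* [chebU n] is the Chebyshev polynomial of the second kind of degree [n - 1] *)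
Definition chebT n := (cheb n).1.
Definition chebU n := (cheb n).2.

Lemma chebTS n : chebT n.+1 = 'X * chebT n - (1 - 'X ^+ 2) * chebU n.
Proof. by []. Qed.
Lemma chebUS n : chebU n.+1 = chebT n + 'X * chebU n. Proof. by []. Qed.

Lemma chebTSS n : chebT n.+2 = ('X + 'X) * chebT n.+1 - chebT n.
Proof. by rewrite !chebTS chebUS; ring. Qed.
Lemma chebUSS n : chebU n.+2 = ('X + 'X) * chebU n.+1 - chebU n.
Proof. by rewrite !chebUS chebTS; ring. Qed.

Lemma cheb_pell n : chebT n ^+ 2 + (1 - 'X ^+ 2) * chebU n ^+ 2 = 1.
Proof.
elim: n => [|n IH]; first by rewrite /chebT /chebU /= ; ring.
by rewrite chebTS chebUS -[RHS]IH; ring.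
Qed.

Lemma horner_cheb n t :
  (chebT n).[cos t] = cos (n%:R * t) /\ (chebU n).[cos t] * sin t = sin (n%:R * t).
Proof.
elim: n => [|n [IH1 IH2]]; first by rewrite /chebT /chebU/= !hornerE ?mul0r cos0 sin0.
rewrite chebTS chebUS !hornerE.
have -> : n.+1%:R * t = n%:R * t + t by rewrite -natr1; ring.
rewrite cosD sinD -IH1 -IH2; split.
  by rewrite -sin2cos2; ring.
ring.
Qed.

Lemma size_cheb n : (size (chebT n) = n.+1) * (size (chebU n.+1) = n.+1).
Proof.
have two0 : (2 : R) != 0 by rewrite pnatr_eq0.
have XX : 'X + 'X = (2%:P : {poly R}) * 'X by rewrite mul_polyC scaler_nat mulr2n.
suff h (b : nat -> {poly R}) : size (b 0) = 1 -> size (b 1) = 2 ->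
    (forall n, b n.+2 = ('X + 'X) * b n.+1 - b n) -> forall n, size (b n) = n.+1.
  split; [apply: h => {n}|apply: (h (fun n => chebU n.+1)) => {n}].
  - by rewrite size_poly1.
  - by rewrite chebTS /chebT /chebU/= mulr0 subr0 mulr1 size_polyX.
  - exact: chebTSS.
  - by rewrite chebUS /chebT /chebU/= mulr0 addr0 size_poly1.
  - by rewrite !chebUS chebTS /chebT /chebU/= !mulr0 addr0 !mulr1 subr0 XX mul_polyC size_scale// size_polyX.
  - by move=> n; rewrite chebUSS.
move=> b0 b1 bSS {}n; suff: size (b n) = n.+1 /\ size (b n.+1) = n.+2 by case.
elim: n => [//|n [IH IH1]]; split => //.
have s : size (('X + 'X) * b n.+1) = n.+3.
  by rewrite XX -mulrA mul_polyC size_scale// mulrC size_mulX ?IH1// -size_poly_eq0 IH1.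
by rewrite bSS size_polyDl ?s// size_polyN IH.
Qed.

End Chebyshev.

(** * Orthonormality of three-term sequences *)

Section TrigIntegrals.
Variable R : realType.
Local Notation mu := (@lebesgue_measure R).

Lemma sin_natpi n : sin (n%:R * pi) = 0 :> R.
Proof.
elim: n => [|n IH]; first by rewrite mul0r sin0.
by rewrite -natr1 mulrDl mul1r sinDpi IH oppr0.
Qed.

Lemma Rintegral_cos_scaled (c : R) : c != 0 -> sin (c * pi) = 0 ->
  \int[mu]_(t in `[0, pi]) cos (c * t) = 0.
Proof.
move=> c0 sc.
have dF x : 0 <= x <= pi -> is_derive x 1 (fun t => c^-1 * sin (c * t)) (cos (c * x)).
  move=> _; apply: is_derive_eq.
  rewrite !scale_oE; by field.
rewrite (Rintegral_FTC (pi_ge0 R) dF); first by rewrite sc !mulr0 sin0 mulr0 subrr.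
move=> x _; apply: continuous_comp; last exact: continuous_cos.
by apply: cvgM; [exact: cvg_cst|exact: cvg_id].
Qed.

Lemma integrable_pi (f : R -> R) : continuous f -> mu.-integrable `[0, pi] (EFin \o f).
Proof. by move=> cf; apply: integrable_cc => x _; exact: cf. Qed.

Lemma continuous_cosM (c : R) : continuous (fun t : R => cos (c * t)).
Proof.
move=> x; apply: continuous_comp; last exact: continuous_cos.
by apply: cvgM; [exact: cvg_cst|exact: cvg_id].
Qed.

Lemma Rintegral_cos_diff (j k : nat) :
  \int[mu]_(t in `[0, pi]) cos ((j%:R - k%:R) * t) = (j == k)%:R * pi :> R.
Proof.
have [->|jk] := eqVneq j k.
  under eq_Rintegral do rewrite subrr mul0r cos0.
  rewrite Rintegral_cst//= lebesgue_measure_itv/= lte_fin pi_gt0/= subr0; ring.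
rewrite Rintegral_cos_scaled ?mul0r//; first by rewrite subr_eq0 eqr_nat.
by rewrite mulrBl sinB !sin_natpi; ring.
Qed.

Lemma Rintegral_half_cos (f : R -> R) (a b : R) (A B : nat) :
  (forall t, f t = 2^-1 * cos ((A%:R - B%:R) * t) + 2^-1 * a * cos (b * t)) ->
  \int[mu]_(t in `[0, pi]) f t =
  2^-1 * ((A == B)%:R * pi) + 2^-1 * a * \int[mu]_(t in `[0, pi]) cos (b * t).
Proof.
move=> fE; under eq_Rintegral do rewrite fE.
have ci c d : mu.-integrable `[0, pi] (EFin \o (fun t => c * cos (d * t))).
  apply: integrable_pi => x; apply: cvgM; [exact: cvg_cst|exact: continuous_cosM].
rewrite RintegralD// !RintegralZl ?Rintegral_cos_diff//; apply: integrable_pi; exact: continuous_cosM.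
Qed.

Lemma Rintegral_cos_cos j k : \int[mu]_(t in `[0, pi]) (cos (j%:R * t) * cos (k%:R * t)) =
  2^-1 * (j == k)%:R * pi + 2^-1 * ((j == 0%N) && (k == 0%N))%:R * pi :> R.
Proof.
rewrite (@Rintegral_half_cos _ 1 (j%:R + k%:R) j k); last first.
  by move=> t; rewrite mulrBl mulrDl cosB cosD; field.
have e t : cos ((j%:R + k%:R) * t) = cos ((0%:R - (j + k)%:R) * t) :> R.
  by rewrite -cosN -mulNr natrD sub0r.
under [in X in _ + X]eq_Rintegral do rewrite e.
by rewrite Rintegral_cos_diff [0%N == _]eq_sym addn_eq0; ring.
Qed.

Lemma Rintegral_sin_sin n : \int[mu]_(t in `[0, pi]) (sin (n.+1%:R * t) * sin t) =
  2^-1 * (n == 0%N)%:R * pi :> R.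
Proof.
rewrite (@Rintegral_half_cos _ (-1) (0%:R - n.+2%:R) n 0); last first.
  move=> t; rewrite !sub0r mulNr cosN subr0 -[n.+2%:R]natr1 -natr1 !mulrDl !mul1r.
  rewrite !cosD !sinD; apply/eqP; rewrite -subr_eq0.
  rewrite (_ : _ - _ = 2^-1 * cos (n%:R * t) * (cos t ^+ 2 + sin t ^+ 2 - 1)); last by field.
  by rewrite cos2Dsin2 subrr mulr0.
by rewrite Rintegral_cos_diff /=; ring.
Qed.

Lemma Rintegral_subst_cos (G : R -> R) a b : 0 <= a -> a <= b -> b <= pi ->
  {within `[cos b, cos a], continuous G} ->
  \int[mu]_(x in `[cos b, cos a]) G x = \int[mu]_(t in `[a, b]) (G (cos t) * sin t).
Proof.
move=> a0 ab bpi cG.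
have dcos : cos^`()%classic = (fun x : R => - sin x).
  by apply/funext => x; rewrite derive1E derive_val.
have csin : continuous (fun x : R => - sin x).
  by move=> x; apply: cvgN; exact: continuous_sin.
rewrite /Rintegral integration_by_substitution_decreasing//.
- congr fine; apply: eq_integral => x _; congr EFin.
  by transitivity (G (cos x) * - (cos^`()%classic x)); rewrite // dcos opprK.
- move=> x y; rewrite !in_itv/= => /andP[ax xb] /andP[ay yb] xy.
  by rewrite ltr_cos// in_itv/= ?(le_trans a0 ax) ?(le_trans a0 ay) ?(le_trans xb bpi) ?(le_trans yb bpi).
- by move=> x _; rewrite dcos; exact: csin.
- by rewrite dcos; apply: cvgP; apply: cvg_at_right_filter; exact: csin.
- by rewrite dcos; apply: cvgP; apply: cvg_at_left_filter; exact: csin.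
- split => //.
  + by apply: cvg_at_right_filter; exact: continuous_cos.
  + by apply: cvg_at_left_filter; exact: continuous_cos.
Qed.
End TrigIntegrals.

(** * The moment functional as an integral when the coefficients are eventually 1/2 *)

Section BernsteinSzego.
Variables (R : realType) (A : nat -> R).
Local Notation mu := (@lebesgue_measure R).
Local Notation q := (tt_poly A).
Hypothesis A0 : forall n, 0 < A n.
Hypothesis A_half : forall n, A n <= 2^-1.

Lemma momD g h : mom A (g + h) = mom A g + mom A h.
Proof. exact: vecD. Qed.
Lemma momZ c g : mom A (c *: g) = c * mom A g.
Proof. exact: vecZ. Qed.

(** No measure is available yet, only positivity of the functional on [g * g] and on
    [(1 - 'X ^+ 2) * (g * g)]. The Pell identity gives moment at most 1 to [chebT n ^+ 2], and
    positivity on the squares of [chebT n + 1] and [chebT n - 1] then bounds the moment of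
    [chebT n]. *)
Lemma mom_chebT n : `|mom A (chebT R n)| <= 1.
Proof.
have m1 : mom A 1 = 1 by rewrite /mom vec1 eqxx.
have le1 : mom A (chebT R n * chebT R n) <= 1.
  have e : mom A (chebT R n * chebT R n) + mom A ((1 - 'X ^+ 2) * (chebU R n * chebU R n)) = 1.
    by rewrite -momD -!expr2 cheb_pell.
  by rewrite -[leRHS]e lerDl; exact: mom_oneBX2_ge0.
have hp := mom_sqr_ge0 A0 (chebT R n + 1); have hm := mom_sqr_ge0 A0 (chebT R n - 1).
have e (e : R) : (chebT R n + e%:P) * (chebT R n + e%:P) =
  chebT R n * chebT R n + (2 * e) *: chebT R n + (e * e) *: 1.
  by rewrite -!mul_polyC !polyCM; ring.
move: hp hm; rewrite -[1]/(1%:P) -polyCN !e !(momD, momZ) m1 ler_norml => hp hm.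
by apply/andP; split; lra.
Qed.

Lemma continuous_horner_cos (h : {poly R}) : continuous (fun t => h.[cos t]).
Proof.
move=> x; apply: continuous_comp; [exact: continuous_cos|exact: continuous_horner].
Qed.

Let I j (h : {poly R}) := \int[mu]_(t in `[0, pi]) (h.[cos t] * cos (j%:R * t)).

Let cI j (h : {poly R}) : continuous (fun t => h.[cos t] * cos (j%:R * t)).
Proof. by move=> x; apply: cvgM; [exact: continuous_horner_cos|exact: continuous_cosM]. Qed.

Let I_sum j N (c : nat -> R) :
  I j (\sum_(k < N) c k *: chebT R k) =
  \sum_(k < N) c k * \int[mu]_(t in `[0, pi]) (cos (j%:R * t) * cos (k%:R * t)).
Proof.
elim: N => [|N IH].
  rewrite !big_ord0 /I; under eq_Rintegral do rewrite horner0 mul0r.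
  by rewrite Rintegral_cst// mul0r.
rewrite !big_ord_recr/= -IH /I.
under eq_Rintegral do rewrite hornerD hornerZ (horner_cheb N _).1 mulrDl -mulrA [cos (N%:R * _) * _]mulrC.
have ci : mu.-integrable `[0, pi] (EFin \o (fun t => cos (j%:R * t) * cos (N%:R * t))).
  by apply: integrable_pi => x; apply: cvgM; exact: continuous_cosM.
rewrite RintegralD//; [|exact/integrable_pi/cI|].
  by rewrite RintegralZl.
apply: integrable_pi => x; apply: cvgM; first exact: cvg_cst.
by apply: cvgM; exact: continuous_cosM.
Qed.

(** The coefficients are cosine Fourier coefficients: pairing with [cos (k t)] gives [c k] times
    [pi / 2], or times [pi] for [k = 0], against a bound [M * pi]. *)
Lemma cheb_coef_bound N (c : nat -> R) M :
  (forall t, `|(\sum_(k < N) c k *: chebT R k).[cos t]| <= M) ->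
  forall k, (k < N)%N -> `|c k| <= 2 * M.
Proof.
move=> hM k kN; set h := \sum_(k < N) _ in hM.
have M0 : 0 <= M by apply: le_trans (hM 0).
have Ik : `|I k h| <= M * pi.
  apply: (le_trans (le_normr_Rintegral _ (integrable_pi (@cI k h)))) => //.
  have -> : M * pi = \int[mu]_(t in `[0, pi]) M.
    by rewrite Rintegral_cst//= lebesgue_measure_itv/= lte_fin pi_gt0/= subr0.
  apply: le_Rintegral => //.
  - by apply: integrable_norm; exact/integrable_pi/cI.
  - by apply: integrable_pi => x; exact: cvg_cst.
  - by move=> x _; rewrite normrM -[M]mulr1 ler_pM// cos_max.
move: Ik; rewrite /h I_sum (bigD1 (Ordinal kN))//= big1 ?addr0; last first.
  move=> i ik; rewrite Rintegral_cos_cos.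
  have ki : (k == i) = false by apply/eqP => e; move/eqP: ik; apply; apply: val_inj.
  rewrite ki mulr0 mul0r add0r; case: eqP => [k0|]; last by rewrite mulr0 mul0r mulr0.
  by rewrite -[in _ && _]k0 eq_sym ki /= mulr0 mul0r mulr0.
rewrite Rintegral_cos_cos eqxx andbb normrM => Ik.
have pg := @pi_gt0 R.
have : `|c k| * (2^-1 * pi) <= M * pi.
  apply: le_trans Ik; rewrite ler_wpM2l// ger0_norm; case: (k == _) => /=; nra.
by nra.
Qed.

(** A sup-norm bound obtained from the Chebyshev expansion. The loss of a factor [size h] is
    harmless, since it is applied to products whose sup norm decays geometrically while the size
    grows linearly. *)
Lemma mom_bound (h : {poly R}) M : (forall t, `|h.[cos t]| <= M) ->
  `|mom A h| <= 2 * (size h)%:R * M.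
Proof.
move=> hM; have M0 : 0 <= M by apply: le_trans (hM 0).
have [c hc] := poly_basis (fun n => (size_cheb R n).1) (leqnn (size h)).
have cb := @cheb_coef_bound (size h) c M.
rewrite -hc in cb; have {}cb := cb hM.
rewrite {1}hc /mom (vec_sum _ _ (fun k => c k *: chebT R k)).
apply: (le_trans (ler_norm_sum _ _ _)).
apply: (@le_trans _ _ (\sum_(i < size h) 2 * M)).
  apply: ler_sum => i _; rewrite -/(mom _ _) momZ normrM -[leRHS]mulr1.
  by rewrite ler_pM// ?mom_chebT// cb.
by rewrite sumr_const card_ord -mulr_natr; lra.
Qed.

Lemma chebU_tt N (AN : forall k, (N <= k)%N -> A k = 2^-1) n :
  q (N + n).+1 = chebU R n.+1 * q N.+1 - chebU R n * q N.
Proof.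
have qSS k : (N <= k)%N -> q k.+2 = ('X + 'X) * q k.+1 - q k.
  move=> Nk; have := tt_polySS A0 k; rewrite !AN ?leqW// => h.
  apply: (@scalerI _ _ (2^-1)); first by rewrite /= invr_eq0 pnatr_eq0.
  rewrite /= h scalerBr; congr (_ - _); rewrite mulrDl scalerDr -scalerDl.
  by rewrite (_ : 2^-1 + 2^-1 = 1) ?scale1r//; field.
suff: q (N + n).+1 = chebU R n.+1 * q N.+1 - chebU R n * q N /\
  q (N + n).+2 = chebU R n.+2 * q N.+1 - chebU R n.+1 * q N by case.
elim: n => [|n [IH IH1]].
  by rewrite addn0 chebUSS !chebUS /chebT /chebU /= qSS//; split; ring.
rewrite addnS; split => //; rewrite qSS; last by lia.
by rewrite IH IH1 [chebU R n.+3]chebUSS [chebU R n.+2]chebUSS; ring.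
Qed.

(** Once the coefficients equal 1/2 the later [q] are combinations of [q N] and [q N.+1] with
    Chebyshev coefficients. The product on the left is thereby a difference of products of two [q],
    whose moments are known by orthogonality. *)
Lemma chebU_turan N (AN : forall k, (N <= k)%N -> A k = 2^-1) n :
  chebU R n.+1 * turan A N =
  4^-1 *: (q N.+1 * q (N + n).+1 - q N * q (N + n.+1).+1).
Proof.
rewrite !chebU_tt// /turan AN// chebUSS -!mul_polyC.
have e : (2^-1 ^+ 2)%:P = (4^-1)%:P :> {poly R} by congr polyC; field.
have e2 : (2^-1)%:P = (4^-1)%:P + (4^-1)%:P :> {poly R}.
  by rewrite -polyCD; congr polyC; field.
by rewrite e e2; ring.
Qed.

Hypothesis A_nd : forall n, A n <= A n.+1.

Lemma turan_nd x m n : (m <= n)%N -> (turan A m).[x] <= (turan A n).[x].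
Proof.
elim: n => [|n IH]; first by rewrite leqn0 => /eqP ->.
rewrite leq_eqVlt => /predU1P[->//|/IH h]; apply: le_trans h _.
rewrite turanS// hornerD hornerZ lerDl horner_exp mulr_ge0 ?sqr_ge0// subr_ge0.
by rewrite lerXn2r ?nnegrE ?A_nd ?ltW// .
Qed.

Lemma turan_ge x n : A 0 ^+ 2 <= (turan A n).[x].
Proof. by have := turan_nd x (leq0n n); rewrite turan0// hornerC. Qed.

Lemma turan_gt0 x n : 0 < (turan A n).[x].
Proof. by apply: lt_le_trans (turan_ge x n); rewrite exprn_gt0. Qed.

Definition bsw n x := Num.sqrt (1 - x ^+ 2) / (2 * pi * (turan A n).[x]).

Lemma continuous_sqrt1B : continuous (fun x : R => Num.sqrt (1 - x ^+ 2)).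
Proof.
move=> x; apply: continuous_comp; last exact: sqrt_continuous.
by apply: cvgB; [exact: cvg_cst|exact: exprn_continuous].
Qed.

Lemma continuous_bsw n : continuous (bsw n).
Proof.
move=> x; apply: cvgM; first exact: continuous_sqrt1B.
apply: cvgV; first by rewrite !mulf_neq0 ?gt_eqF ?turan_gt0 ?pi_gt0.
by apply: cvgM; [exact: cvg_cst|exact: continuous_horner].
Qed.

Lemma bsw_ge0 n x : 0 <= bsw n x.
Proof.
by rewrite mulr_ge0 ?sqrtr_ge0// invr_ge0 !mulr_ge0 ?pi_ge0// ltW ?turan_gt0.
Qed.

(** Each of the [m.+1] terms of the geometric sum is at least [r ^+ m]. *)
Lemma geometric_lin_bound (r : R) m : 0 <= r -> r < 1 ->
  m.+1%:R * r ^+ m <= (1 - r)^-1.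
Proof.
move=> r0 r1; have r1' : 0 < 1 - r by rewrite subr_gt0.
rewrite -[leRHS]mul1r ler_pdivlMr// (@le_trans _ _ ((\sum_(i < m.+1) r ^+ i) * (1 - r)))//.
  rewrite ler_wpM2r ?(ltW r1')// (_ : m.+1%:R * r ^+ m = \sum_(i < m.+1) r ^+ m); last first.
    by rewrite sumr_const card_ord mulr_natl.
  apply: ler_sum => i _.
  have im : (i <= m)%N by rewrite -ltnS.
  by rewrite -{1}(subnKC im) exprD ler_piMr ?exprn_ge0// exprn_ile1// ltW.
by rewrite mulrC -[1 - r]opprB mulNr -subrX1 opprB gerBl exprn_ge0.
Qed.

Section Truncated.
Variable N : nat.
Hypothesis AN : forall k, (N <= k)%N -> A k = 2^-1.
Local Notation rho := (turan A N).
Let B (g : {poly R}) := \int[mu]_(x in `[(-1), 1]) (g.[x] * bsw N x).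

Let iB (g : {poly R}) : mu.-integrable `[(-1), 1] (EFin \o (fun x => g.[x] * bsw N x)).
Proof.
apply: integrable_cc => x _; apply: cvgM; [exact: continuous_horner|exact: continuous_bsw].
Qed.

Let BZD c g h : B (c *: g + h) = c * B g + B h.
Proof.
rewrite /B -RintegralZl// -RintegralD//.
  by apply: eq_Rintegral => x _; rewrite hornerD hornerZ; ring.
apply: integrable_cc => x _; apply: cvgM; first exact: cvg_cst.
apply: cvgM; [exact: continuous_horner|exact: continuous_bsw].
Qed.

(** The discrepancy to be shown zero. It is first killed on multiples of [rho], where the weight
    loses its denominator and the integrals become elementary. *)
Let D g := B g - mom A g.

Let DZD c g h : D (c *: g + h) = c * D g + D h.
Proof. by rewrite /D BZD momD momZ; ring. Qed.

Let D0 : D 0 = 0.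
Proof. by apply: (addrI (D 0)); rewrite addr0 -{2}[D 0]mul1r addrC -DZD scale1r addr0. Qed.

Let D_sum n (c : nat -> R) (b : nat -> {poly R}) :
  (forall k, D (b k) = 0) -> D (\sum_(k < n) c k *: b k) = 0.
Proof.
move=> h; elim: n => [|n IH]; first by rewrite big_ord0 D0.
by rewrite big_ord_recr/= addrC DZD IH h mulr0 addr0.
Qed.

Let D_chebU n : D (chebU R n.+1 * rho) = 0.
Proof.
rewrite /D chebU_turan// momZ [mom _ _]vecB -!/(mom _ _) !mom_orth//.
rewrite -chebU_turan//; apply/eqP; rewrite subr_eq0; apply/eqP.
have p0 : (pi : R) != 0 by rewrite gt_eqF ?pi_gt0.
transitivity ((2 * pi)^-1 * \int[mu]_(x in `[cos pi, cos 0]) ((chebU R n.+1).[x] * Num.sqrt (1 - x ^+ 2))).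
  have ci : mu.-integrable `[cos pi, cos 0]
      (EFin \o (fun x => (chebU R n.+1).[x] * Num.sqrt (1 - x ^+ 2))).
    apply: integrable_cc => x _; apply: cvgM; [exact: continuous_horner|exact: continuous_sqrt1B].
  rewrite -RintegralZl// cospi cos0; apply: eq_Rintegral => x _.
  have := turan_gt0 x N; rewrite hornerM /bsw.
  move: (rho.[x]) (pi : R) p0 => T P P0 /lt0r_neq0 T0; by field; rewrite P0.
rewrite Rintegral_subst_cos ?pi_ge0//; last first.
  apply: continuous_subspaceT => x; apply: cvgM; [exact: continuous_horner|exact: continuous_sqrt1B].
under eq_Rintegral => t.
  rewrite inE/= in_itv/= => tpi.
  rewrite -sin2cos2 sqrtr_sqr ger0_norm ?sin_ge0_pi// (horner_cheb n.+1 t).2.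
  over.
rewrite Rintegral_sin_sin.
rewrite (_ : (N.+1 == (N + n).+1) = (n == 0%N)); last by lia.
rewrite (_ : (N == (N + n.+1).+1) = false); last by lia.
rewrite subr0; move: (pi : R) p0 => P P0; by field.
Qed.

Let D_rho h : D (h * rho) = 0.
Proof.
have [c ->] := poly_basis (fun n => (size_cheb R n).2) (leqnn (size h)).
rewrite mulr_suml; under eq_bigr do rewrite -scalerAl.
exact: (D_sum _ _ D_chebU).
Qed.

(** Multiples of [rho] have no discrepancy, so [g] may be multiplied by any power of
    [kap = 1 - rho / M] without changing [D g]. With [M] the maximum of [rho] on [[-1, 1]], [kap]
    takes values in [[0, e]] there with [e < 1], and both parts of the discrepancy of [g * kap ^+ m]
    tend to 0. *)
Theorem bernstein_szego g : \int[mu]_(x in `[(-1), 1]) (g.[x] * bsw N x) = mom A g.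
Proof.
apply/eqP; rewrite -subr_eq0 -/(B g) -/(D g); apply/eqP.
have N11 : (-1 : R) <= 1 by lra.
have [c cin hc] : exists2 c, c \in `[(-1), 1] & forall x, x \in `[(-1), 1] -> rho.[x] <= rho.[c].
  apply: EVT_max; first exact: N11.
  by apply: continuous_subspaceT; exact: continuous_horner.
pose M := rho.[c].
have M0 : 0 < M by exact: turan_gt0.
pose kap := 1%:P - M^-1 *: rho.
pose e := 1 - A 0 ^+ 2 / M.
have kapb x : x \in `[(-1), 1] -> 0 <= kap.[x] <= e.
  move=> hx; rewrite /kap hornerD hornerN hornerZ hornerC /e; apply/andP; split.
    by rewrite subr_ge0 mulrC ler_pdivrMr// mul1r hc.
  by rewrite lerD2l lerN2 mulrC ler_pM2l ?invr_gt0// turan_ge.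
have e0 : 0 <= e by have /andP[h1 h2]   := kapb c cin; apply: le_trans h1 h2.
have e1 : e < 1 by rewrite /e ltrBlDr ltrDl divr_gt0// exprn_gt0.
have DK m : D g = D (g * kap ^+ m).
  elim: m => [|m ->]; first by rewrite expr0 mulr1.
  have -> : g * kap ^+ m.+1 = (- M^-1) *: (g * kap ^+ m * rho) + g * kap ^+ m.
    by rewrite exprS /kap -!mul_polyC polyCN polyC1; ring.
  by rewrite DZD D_rho mulr0 add0r.
(* Splitting [e ^+ m] into two factors [r ^+ m] lets one of them absorb the linear growth of the
   size in [mom_bound]. *)
pose r := Num.sqrt e.
have r0 : 0 <= r by exact: sqrtr_ge0.
have r1 : r < 1 by rewrite -sqrtr1 ltr_sqrt.
have er m : e ^+ m = r ^+ m * r ^+ m by rewrite -exprMn -expr2 sqr_sqrtr.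
pose C1 := \int[mu]_(x in `[(-1), 1]) `|g.[x] * bsw N x|.
have C10 : 0 <= C1 by apply: Rintegral_ge0.
have itv_cos (t : R) : cos t \in `[(-1), 1] by rewrite in_itv/= cos_geN1 cos_le1.
have [G hG] : exists G : R, forall t, `|g.[cos t]| <= G.
  have [|d _ hd] := @EVT_max _ (fun x => `|g.[x]|) (-1) 1 N11.
    by apply: continuous_subspaceT => x; apply: cvg_norm; exact: continuous_horner.
  by exists `|g.[d]| => t; apply: hd; exact: itv_cos.
have G0 : 0 <= G by apply: le_trans (hG 0).
pose S := (size g + size kap).+1.
have bB m : `|B (g * kap ^+ m)| <= C1 * e ^+ m.
  apply: (le_trans (le_normr_Rintegral _ (iB _))) => //.
  rewrite /C1 -RintegralZr//; last exact: integrable_norm (iB g).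
  apply: le_Rintegral => //.
  - exact: integrable_norm (iB _).
  - apply: integrable_cc => x _; apply: cvgM; last exact: cvg_cst.
    by apply: cvg_norm; apply: cvgM; [exact: continuous_horner|exact: continuous_bsw].
  - move=> x hx; rewrite hornerM horner_exp mulrAC normrM ler_wpM2l// normrX.
    have /andP[k0 k1] := kapb x hx.
    by rewrite ger0_norm// lerXn2r.
have bm m : `|mom A (g * kap ^+ m)| <= 2 * (S * m.+1)%:R * G * e ^+ m.
  apply: (le_trans (@mom_bound _ (G * e ^+ m) _)).
    move=> t; rewrite hornerM horner_exp normrM ler_pM// normrX.
    have /andP[k0 k1] := kapb _ (itv_cos t).
    by rewrite ger0_norm// lerXn2r.
  rewrite mulrA ler_wpM2r ?exprn_ge0// ler_wpM2r// ler_wpM2l// ler_nat.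
  apply: (leq_trans (size_polyMleq _ _)).
  have := size_poly_exp_leq kap m; rewrite /S.
  by move: (size (kap ^+ m)) (size kap) (size g) => a b d; nia.
pose C := C1 + 2 * S%:R * G * (1 - r)^-1.
have bD m : `|D g| <= C * r ^+ m.
  rewrite (DK m) (le_trans (ler_normB _ _))// (le_trans (lerD (bB m) (bm m)))//.
  rewrite /C [leRHS]mulrDl lerD//.
    by rewrite er ler_wpM2l// ler_piMr ?exprn_ge0// exprn_ile1// ltW.
  rewrite natrM er (_ : 2 * _ * _ * _ = 2 * S%:R * G * (m.+1%:R * r ^+ m) * r ^+ m); last by ring.
  rewrite ler_wpM2r ?exprn_ge0// ler_wpM2l ?geometric_lin_bound//.
  by rewrite !mulr_ge0.
apply/eqP; rewrite -normr_le0.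
have h : C * r ^+ m @[m --> \oo] --> 0.
  rewrite -(mulr0 C); apply: cvgMr; apply: cvg_expr; rewrite ger0_norm//.
rewrite -(cvg_lim _ h)//; apply: limr_ge; first by apply/cvg_ex; exists 0.
exact: nearW.
Qed.

End Truncated.
End BernsteinSzego.

Section Orthonormality.
Variables (R : realType) (A : nat -> R).
Local Notation mu := (@lebesgue_measure R).
Local Notation q := (tt_poly A).
Hypothesis A0 : forall n, 0 < A n.
Hypothesis A_half : forall n, A n <= 2^-1.
Hypothesis A_nd : forall n, A n <= A n.+1.

Let B N k := if (k < N)%N then A k else 2^-1.

Let B0 N n : 0 < B N n. Proof. by rewrite /B; case: ifP; rewrite ?invr_gt0. Qed.
Let B_half N n : B N n <= 2^-1. Proof. by rewrite /B; case: ifP. Qed.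
Let B_nd N n : B N n <= B N n.+1.
Proof.
rewrite /B; case: ltnP => h1; case: ltnP => h2 //; last by lia.
Qed.
Let Bq N n : (n <= N)%N -> tt_poly (B N) n = q n.
Proof. by move=> nN; apply: eq_tt_poly => k kn; rewrite /B (leq_trans kn nN). Qed.

Let turanB N : turan (B N.+1) N.+1 = turan A N + (2^-1 ^+ 2 - A N ^+ 2) *: q N.+1 ^+ 2.
Proof. by rewrite turanS// /turan !Bq// /B ltnSn ltnn. Qed.

(* Cutting the coefficients off at 1/2 gives a Bernstein-Szego weight; as the
   cut-off tends to infinity these weights converge dominatedly. *)
Theorem tt_orthonormal (S : R -> R) j k :
  A n @[n --> \oo] --> (2^-1 : R) ->
  (forall x, -1 < x < 1 -> (turan A n).[x] @[n --> \oo] --> S x) ->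
  (forall x, -1 < x < 1 -> exists M, forall n, `|(q n).[x]| <= M) ->
  let f x := (q j).[x] * (q k).[x] * (Num.sqrt (1 - x ^+ 2) / (2 * pi * S x)) in
  mu.-integrable `[(-1), 1] (EFin \o f) /\
  \int[mu]_(x in `[(-1), 1]) f x = (j == k)%:R.
Proof.
move=> Acvg Scvg qb f.
pose g := q j * q k.
pose f_ n x := g.[x] * bsw (B n.+1) n.+1 x.
(* Every [turan] is at least the square of the coefficient of index 0, which is [A 0] for all the
   cut-off sequences [B n.+1]; hence one constant bounds all their weights. *)
pose K := (2 * pi * A 0 ^+ 2)^-1.
have A02 : 0 < 2 * pi * A 0 ^+ 2 by rewrite !mulr_gt0 ?pi_gt0.
have cf n : continuous (f_ n).
  by move=> x; apply: cvgM; [exact: continuous_horner|exact: continuous_bsw].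
have S0 x : -1 < x < 1 -> 0 < S x.
  move=> hx; apply: (@lt_le_trans _ _ (A 0 ^+ 2)); first by rewrite exprn_gt0.
  rewrite -(cvg_lim _ (Scvg x hx))//; apply: limr_ge; first by apply/cvg_ex; exists (S x); exact: Scvg.
  by apply: nearW => n; exact: turan_ge.
have [|||||fi fl] := @Rdominated_cvg R `[(-1), 1] f_ f (fun x => `|g.[x]| * K).
- exact: measurable_itv.
- by move=> n; apply: measurable_funTS; exact: continuous_measurable_fun.
- move=> x; rewrite /= in_itv/= => /andP[x1 x2].
  have [hx|hx] := boolP (-1 < x < 1); last first.
    have s0 : Num.sqrt (1 - x ^+ 2) = 0 :> R.
      have -> : 1 - x ^+ 2 = 0; last by rewrite sqrtr0.
      have e : x = 1 \/ x = -1.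
        by move: hx; rewrite negb_and -!leNgt => /orP[h|h]; [right|left]; lra.
      by case: e => ->; ring.
    by apply: cvg_near_cst; apply: nearW => n; rewrite /f_ /f /bsw s0 !mul0r !mulr0.
  rewrite /f_ /f /g hornerM /bsw; apply: cvgMr; apply: cvgMr.
  apply: cvgV; first by rewrite !mulf_neq0 ?gt_eqF ?S0 ?pi_gt0.
  apply: cvgMr; rewrite -[S x]addr0.
  (* The cut-off changes [turan] by a multiple of [q n.+1 ^+ 2] whose coefficient tends to 0;
     boundedness of the values of [q] at [x] makes this correction vanish. *)
  under eq_fun do rewrite turanB hornerD hornerZ horner_exp.
  apply: cvgD; first exact: Scvg.
  have [M hM] := qb x hx.
  have h0 : (2^-1 ^+ 2 - A n ^+ 2) * M ^+ 2 @[n --> \oo] --> 0.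
    rewrite -(mul0r (M ^+ 2)) -(subrr (2^-1 ^+ 2 : R)); apply: cvgMl.
    by apply: cvgB; [exact: cvg_cst|rewrite expr2; under eq_fun do rewrite expr2; exact: cvgM].
  apply: (@squeeze_cvgr _ _ _ _ (cst 0) (fun n => (2^-1 ^+ 2 - A n ^+ 2) * M ^+ 2)) => //; last exact: cvg_cst.
  apply: nearW => n; have d0 : 0 <= 2^-1 ^+ 2 - A n ^+ 2.
    by rewrite subr_ge0 lerXn2r ?nnegrE ?invr_ge0 ?(ltW (A0 n)).
  rewrite mulr_ge0 ?sqr_ge0//= ler_wpM2l// -(real_normK (num_real _)) lerXn2r ?nnegrE ?hM//.
  by apply: le_trans (hM 0).
- apply: integrable_cc => x _; apply: cvgM; last exact: cvg_cst.
  by apply: cvg_norm; exact: continuous_horner.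
- move=> n x; rewrite /= in_itv/= => /andP[x1 x2].
  rewrite /f_ normrM ler_wpM2l// ger0_norm ?bsw_ge0// /bsw /K -[leRHS]mul1r.
  have t0 := turan_ge (B0 n.+1) (B_nd n.+1) x n.+1.
  rewrite {1}/B /= in t0.
  rewrite ler_pM ?sqrtr_ge0 ?invr_ge0//.
  + by rewrite !mulr_ge0 ?pi_ge0// (le_trans _ t0)// sqr_ge0.
  + by rewrite -[leRHS]sqrtr1 ler_wsqrtr// lerBlDr lerDl sqr_ge0.
  + rewrite lef_pV2 ?posrE// ?ler_pM2l ?mulr_gt0 ?pi_gt0//.
    by rewrite (lt_le_trans _ t0)// exprn_gt0.
split => //; apply: (cvg_unique _ fl); first exact: Rhausdorff.
(* The approximating integrals are eventually constant: as soon as the cut-off lies beyond [j] and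
   [k], [q j] and [q k] belong to the cut-off sequence and are orthonormal for its weight. *)
apply: cvg_near_cst; exists (maxn j k) => // n /= hn.
rewrite /f_ bernstein_szego//; last by move=> i hi; rewrite /B ltnNge hi.
rewrite /g -(@Bq n.+1 j) -?(@Bq n.+1 k) ?mom_orth//; lia.
Qed.

End Orthonormality.

(** * Modulus of the Gamma function *)

Section GammaModulus.
Variable R : realType.
Local Notation mu := (@lebesgue_measure R).
Local Notation D := (`]0, +oo[%classic : set R).
Implicit Types (s tau t : R) (n : nat).

Definition gker s t : R := t `^ (s - 1) * expR (- t).
(** Real part of Gamma at [s + i tau]; [gsin] is the imaginary part and [gam] the value at the real
    point [s]. *)
Definition gcos s tau := \int[mu]_(t in D) (gker s t * cos (tau * ln t)).
Definition gsin s tau := \int[mu]_(t in D) (gker s t * sin (tau * ln t)).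
Definition gam s := \int[mu]_(t in D) gker s t.

Lemma gker_ge0 s t : 0 <= gker s t.
Proof. by rewrite mulr_ge0 ?powR_ge0 ?expR_ge0. Qed.

Let u n : R := n.+1%:R^-1.
Let v n : R := n.+1%:R.
Let uv n : u n <= v n.
Proof. by rewrite /u /v (@le_trans _ _ 1)// ?invf_le1 ?ler1n. Qed.
Let uvD n t : u n <= t <= v n -> D t.
Proof.
move=> /andP[h _]; rewrite /= in_itv/= andbT (lt_le_trans _ h)// invr_gt0//.
Qed.
Let Duv t : D t -> \forall n \near \oo, u n <= t <= v n.
Proof.
rewrite /= in_itv/= andbT => t0.
have h1 := truncnS_gt t; have h2 := truncnS_gt (t^-1).
exists (maxn (Num.Def.trunc t) (Num.Def.trunc t^-1)) => // n /=.
rewrite geq_max => /andP[n1 n2]; apply/andP; split.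
  rewrite /u -[leRHS]invrK lef_pV2 ?posrE ?invr_gt0//.
  by rewrite (le_trans (ltW h2))// ler_nat.
by rewrite (le_trans (ltW h1))// ler_nat.
Qed.
Let mD : measurable D. Proof. exact: measurable_itv. Qed.
Let D0 t : D t -> 0 < t. Proof. by rewrite /= in_itv/= andbT. Qed.

Lemma integrable_expN2 : mu.-integrable D (EFin \o (fun t => expR (- (t / 2)))).
Proof.
have d t : is_derive t 1 (fun t : R => - (2 * expR (- (t / 2)))) (expR (- (t / 2))).
  by apply: is_derive_eq; rewrite !scale_oE; field.
have hh := integrable_FTC_improper uv uvD Duv (fun t _ => d t).
apply: (hh _ 2) => //.
- move=> t _; apply: continuous_comp; last exact: continuous_expR.
  by apply: cvgN; apply: cvgM; [exact: cvg_id|exact: cvg_cst].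
- by move=> n m nm; rewrite /u lef_pV2 ?posrE// ler_nat.
- by move=> n m nm; rewrite /v ler_nat.
- move=> n; have h1 := expR_ge0 (- (v n / 2)).
  have h2 : expR (- (u n / 2)) <= 1 by rewrite expR_le1 oppr_le0 divr_ge0// /u invr_ge0.
  by lra.
Qed.

(** For [1 <= s] the kernel has no singularity at 0, and half of the exponential absorbs the power
    of [t] by one term [x^n / n!] of the exponential series. *)
Lemma gker_bound s : 1 <= s -> exists2 C, 0 <= C & forall t, 0 < t -> gker s t <= C * expR (- (t / 2)).
Proof.
move=> s1; pose n := (Num.Def.trunc (s - 1)).+1.
exists (1 + 2 ^+ n.+1 * n.+1`!%:R) => [|t t0].
  by rewrite addr_ge0// mulr_ge0// exprn_ge0.
have e : expR (- t) = expR (- (t / 2)) * expR (- (t / 2)).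
  by rewrite -expRD; congr expR; field.
rewrite /gker e mulrA ler_wpM2r ?expR_ge0//.
have ee : expR (- (t / 2)) <= 1 by rewrite expR_le1 oppr_le0 divr_ge0// ltW.
have [t1|t1] := leP t 1.
  rewrite (@le_trans _ _ 1)//; last by rewrite lerDl mulr_ge0// exprn_ge0.
  rewrite -[leRHS]mulr1 ler_pM ?powR_ge0 ?expR_ge0//.
  by rewrite -[leRHS](powRr0 t) ger_powR ?t0 ?t1// subr_ge0.
rewrite (@le_trans _ _ (2 ^+ n * n`!%:R))//; last first.
  rewrite (@le_trans _ _ (2 ^+ n.+1 * n.+1`!%:R))//; last by rewrite lerDr.
  by rewrite ler_pM// ?exprn_ge0// ?ler_nat ?factS ?leq_pmull// exprS ler_peMl ?exprn_ge0// ler1n.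
rewrite expRN ler_pdivrMr ?expR_gt0// (@le_trans _ _ (t ^+ n))//.
  rewrite -powR_mulrn ?(ltW t0)// ler_powR ?(ltW t1)//.
  by rewrite ltW// truncnS_gt.
have := @expR_ge1Dxn R (t / 2) n.-1; rewrite prednK// => /(_ (divr_ge0 (ltW t0) (ler0n _ 2))).
rewrite expr_div_n => h.
rewrite -mulrA -ler_pdivrMl ?exprn_gt0// -ler_pdivrMl ?ltr0n ?fact_gt0//.
apply: le_trans h; rewrite mulrC [_^-1 * _]mulrC -[leLHS]add0r lerD//.
Qed.

Section Functional.
Variables (h : R -> R) (H : R).
Hypothesis ch : forall t, 0 < t -> {for t, continuous h}.
Hypothesis hb : forall t, `|h t| <= H.

Lemma gker_continuous s t : 0 < t -> {for t, continuous (gker s)}.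
Proof.
move=> t0; apply: cvgM.
  exact: is_derive_continuous (is_derive1_powR (s - 1) t0).
by apply: continuous_comp; [apply: cvgN; exact: cvg_id|exact: continuous_expR].
Qed.

Lemma integrable_gkerM s : 1 <= s -> mu.-integrable D (EFin \o (fun t => gker s t * h t)).
Proof.
move=> s1; have [C C0 hC] := gker_bound s1.
have H0 : 0 <= H by apply: le_trans (hb 0).
have hi : mu.-integrable D (EFin \o (fun t => C * H * expR (- (t / 2)))).
  exact: integrable_scale integrable_expN2.
apply: integrable_dom hi => //.
  apply: continuous_on_measurable; [exact: mD|by apply: interval_open|].
  by move=> t /D0 t0; apply: cvgM; [exact: gker_continuous|exact: ch].
move=> t /D0 t0 /=; rewrite normrM ger0_norm ?gker_ge0// [leRHS]mulrAC.
by rewrite ler_pM ?gker_ge0// hC.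
Qed.

End Functional.

Lemma integrable_gker s : 1 <= s -> mu.-integrable D (EFin \o gker s).
Proof.
move=> s1; have := @integrable_gkerM (fun=> 1) 1.
have h1 t : 0 < t -> {for t, continuous (fun=> (1 : R))} by move=> _; exact: cvg_cst.
have h2 t : `|1 : R| <= 1 by rewrite normr1.
move=> /(_ h1 h2 s s1); apply: eq_integrable => // t _ /=.
by rewrite mulr1.
Qed.

Let ccos tau t : 0 < t -> {for t, continuous (fun t => cos (tau * ln t))}.
Proof.
move=> t0; apply: continuous_comp; last exact: continuous_cos.
by apply: cvgM; [exact: cvg_cst|exact: continuous_ln].
Qed.
Let csin tau t : 0 < t -> {for t, continuous (fun t => sin (tau * ln t))}.
Proof.
move=> t0; apply: continuous_comp; last exact: continuous_sin.
by apply: cvgM; [exact: cvg_cst|exact: continuous_ln].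
Qed.

Lemma integrable_gcos s tau : 1 <= s ->
  mu.-integrable D (EFin \o (fun t => gker s t * cos (tau * ln t))).
Proof.
by move=> s1; apply: (@integrable_gkerM _ 1) => // t; [exact: ccos|exact: cos_max].
Qed.
Lemma integrable_gsin s tau : 1 <= s ->
  mu.-integrable D (EFin \o (fun t => gker s t * sin (tau * ln t))).
Proof.
by move=> s1; apply: (@integrable_gkerM _ 1) => // t; [exact: csin|exact: sin_max].
Qed.

Section FunctionalEquation.
Variables (s a b tau : R).
Hypothesis s1 : 1 <= s.
Let F t : R := t `^ s * expR (- t) * (a * cos (tau * ln t) + b * sin (tau * ln t)).
Let f t : R := gker s t * ((s * a + tau * b) * cos (tau * ln t) + (s * b - tau * a) * sin (tau * ln t))
   - gker (s + 1) t * (a * cos (tau * ln t) + b * sin (tau * ln t)).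

Let cc al be t : 0 < t -> {for t, continuous (fun t => al * cos (tau * ln t) + be * sin (tau * ln t))}.
Proof.
move=> t0; apply: cvgD; apply: cvgM; try exact: cvg_cst; [exact: ccos|exact: csin].
Qed.

Let bb al be t : `|al * cos (tau * ln t) + be * sin (tau * ln t)| <= `|al| + `|be|.
Proof.
rewrite (le_trans (ler_normD _ _))// !normrM lerD//.
  by rewrite ler_piMr// cos_max.
by rewrite ler_piMr// sin_max.
Qed.

Let s11 : 1 <= s + 1. Proof. by rewrite (le_trans s1)// lerDl. Qed.

Let dF t : 0 < t -> is_derive t 1 F (f t).
Proof.
move=> t0.
have dl := is_derive1_ln t0.
have dp := is_derive1_powR s t0.
have pE : t `^ s = t * t `^ (s - 1) by rewrite mulr_powRB1// ?ltW// (lt_le_trans ltr01 s1).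
apply: is_derive_eq; rewrite !scale_oE /f /gker addrK pE; by field; rewrite gt_eqF.
Qed.

Let FE t : 0 < t -> F t = gker (s + 1) t * (a * cos (tau * ln t) + b * sin (tau * ln t)).
Proof. by move=> t0; rewrite /F /gker addrK. Qed.

Let Flim : F (v n) - F (u n) @[n --> \oo] --> 0.
Proof.
have [C C0 hC] := gker_bound s11.
pose K := (2 * C + 1) * (`|a| + `|b|).
have h : K * u n @[n --> \oo] --> 0 by rewrite -(mulr0 K); apply: cvgMr; exact: cvg_harmonic.
apply: norm_cvg0; apply: (@squeeze_cvgr _ _ _ _ (cst 0) (fun n => K * u n)) => //; last exact: cvg_cst.
apply: nearW => n; rewrite normr_ge0/= (le_trans (ler_normB _ _))//.
have v0 : 0 < v n by rewrite /v.
have u0 : 0 < u n by rewrite /u invr_gt0.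
have u1 : u n <= 1 by rewrite /u invf_le1// ler1n.
have hv : `|F (v n)| <= 2 * C * u n * (`|a| + `|b|).
  rewrite FE// normrM ler_pM ?bb// ger0_norm ?gker_ge0// (le_trans (hC _ v0))//.
  rewrite [2 * C]mulrC -mulrA ler_wpM2l// expRN.
  have : v n / 2 <= expR (v n / 2) by apply: le_trans (expR_ge1Dx _); rewrite lerDr.
  rewrite -(@lef_pV2 R) ?posrE ?expR_gt0 ?divr_gt0// => /le_trans; apply.
  by rewrite invf_div.
have hu : `|F (u n)| <= u n * (`|a| + `|b|).
  rewrite /F normrM ler_pM ?bb// normrM ger0_norm ?powR_ge0// ger0_norm ?expR_ge0//.
  rewrite -[leRHS]mulr1 ler_pM ?powR_ge0 ?expR_ge0//.
    by apply: ge1r_powR; rewrite ?u0.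
  by rewrite expR_le1 oppr_le0 ltW.
by rewrite (le_trans (lerD hv hu))// /K; lra.
Qed.

(** Integration by parts: [F] vanishes at 0 and at infinity and [f] is its derivative. Keeping [a]
    and [b] free treats the real and imaginary parts of the functional equation of Gamma at once. *)
Lemma gker_parts :
  \int[mu]_(t in D) (gker (s + 1) t * (a * cos (tau * ln t) + b * sin (tau * ln t))) =
  \int[mu]_(t in D) (gker s t *
    ((s * a + tau * b) * cos (tau * ln t) + (s * b - tau * a) * sin (tau * ln t))).
Proof.
have i1 := @integrable_gkerM _ _ (@cc (s * a + tau * b) (s * b - tau * a)) (bb _ _) s s1.
have i2 := @integrable_gkerM _ _ (@cc a b) (bb _ _) (s + 1) s11.
have h : \int[mu]_(t in D) f t = 0.
  apply: (Rintegral_FTC_improper mD uv uvD Duv (fun t Dt => dF (D0 Dt))) => //.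
  - move=> t /D0 t0; apply: cvgB; (apply: cvgM; [exact: gker_continuous|exact: cc]).
  - exact: integrable_sub.
by apply/eqP; rewrite eq_sym -subr_eq0 -(@RintegralB _ _ R mu D _ _ mD i1 i2); apply/eqP.
Qed.
End FunctionalEquation.

Let Dlin s tau al be : 1 <= s ->
  \int[mu]_(t in D) (gker s t * (al * cos (tau * ln t) + be * sin (tau * ln t)))
  = al * gcos s tau + be * gsin s tau.
Proof.
move=> s1; rewrite -!RintegralZl ?integrable_gcos ?integrable_gsin//.
rewrite -RintegralD//; try (by apply: integrable_scale => //; [exact: integrable_gcos|exact: integrable_gsin]).
- by apply: eq_Rintegral => t _; ring.
- by apply: integrable_scale => //; exact: integrable_gcos.
- by apply: integrable_scale => //; exact: integrable_gsin.
Qed.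

Lemma gker_step s tau a b : 1 <= s ->
  a * gcos (s + 1) tau + b * gsin (s + 1) tau =
  (s * a + tau * b) * gcos s tau + (s * b - tau * a) * gsin s tau.
Proof.
move=> s1; have s11 : 1 <= s + 1 by rewrite (le_trans s1)// lerDl.
by rewrite -(Dlin tau a b s11) -(Dlin tau _ _ s1); exact: gker_parts.
Qed.

Lemma gcosS s tau : 1 <= s -> gcos (s + 1) tau = s * gcos s tau - tau * gsin s tau.
Proof.
move=> s1; have := gker_step tau 1 0 s1.
by rewrite mul1r mul0r addr0 !mulr1 !mulr0 addr0 sub0r mulNr.
Qed.
Lemma gsinS s tau : 1 <= s -> gsin (s + 1) tau = s * gsin s tau + tau * gcos s tau.
Proof.
move=> s1; have := gker_step tau 0 1 s1.
by rewrite !(mul1r, mul0r, mulr1, mulr0, add0r, subr0) => ->; rewrite addrC.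
Qed.

Lemma gam_gcos s : gam s = gcos s 0.
Proof. by apply: eq_Rintegral => t _; rewrite mul0r cos0 mulr1. Qed.

Lemma gamS s : 1 <= s -> gam (s + 1) = s * gam s.
Proof. by move=> s1; rewrite !gam_gcos gcosS// mul0r subr0. Qed.

(* [|Gamma (s + i tau)| ^ 2], see [normc_cGamma]. *)
Definition gnorm2 s tau := gcos s tau ^+ 2 + gsin s tau ^+ 2.

Lemma gnorm2S s tau : 1 <= s -> gnorm2 (s + 1) tau = (s ^+ 2 + tau ^+ 2) * gnorm2 s tau.
Proof. by move=> s1; rewrite /gnorm2 gcosS// gsinS//; ring. Qed.

Lemma gam_ge0 s : 0 <= gam s.
Proof. by apply: Rintegral_ge0 => t _; exact: gker_ge0. Qed.

Let proj_le s tau al be H : 1 <= s ->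
  (forall t, `|al * cos (tau * ln t) + be * sin (tau * ln t)| <= H) ->
  al * gcos s tau + be * gsin s tau <= H * gam s.
Proof.
move=> s1 hH; rewrite -Dlin// -RintegralZl//; last exact: integrable_gker.
apply: le_Rintegral => //.
- apply: (@integrable_gkerM _ H) => // t t0.
  by apply: cvgD; apply: cvgM; try exact: cvg_cst; [exact: ccos|exact: csin].
- by apply: integrable_scale => //; exact: integrable_gker.
- move=> t _; rewrite mulrC ler_wpM2r ?gker_ge0// (le_trans (ler_norm _))//.
Qed.

(** The vector [(gcos, gsin)] is paired with itself: its scalar product with [(cos, sin)] is at most
    its own length [sqrt N] at every [t], so [N] is at most [sqrt N * gam s]. *)
Lemma gnorm2_le s tau : 1 <= s -> gnorm2 s tau <= gam s ^+ 2.
Proof.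
move=> s1; set N := gnorm2 s tau; have N0 : 0 <= N by rewrite addr_ge0 ?sqr_ge0.
have h t : `|gcos s tau * cos (tau * ln t) + gsin s tau * sin (tau * ln t)| <= Num.sqrt N.
  rewrite -sqrtr_sqr ler_wsqrtr// /N /gnorm2.
  set x := tau * ln t; have := cos2Dsin2 x; have := sqr_ge0 (gcos s tau * sin x - gsin s tau * cos x).
  by nra.
have := proj_le s1 h; rewrite -!expr2 -/(gnorm2 s tau) -/N => hN.
have sN : Num.sqrt N ^+ 2 = N by rewrite sqr_sqrtr.
have := sqrtr_ge0 N; have := gam_ge0 s; nra.
Qed.

Lemma gam_gt0 s : 1 <= s -> 0 < gam s.
Proof.
move=> s1; apply: (@lt_le_trans _ _ (expR (-2))); first exact: expR_gt0.
have sub : `[1, 2]%classic `<=` D.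
  by move=> t; rewrite /= !in_itv/= andbT => /andP[h _]; rewrite (lt_le_trans _ h).
have i12 : mu.-integrable `[1, 2] (EFin \o gker s).
  by apply: integrableS (integrable_gker s1).
have le12 : \int[mu]_(t in `[1, 2]) gker s t <= gam s.
  rewrite /gam /Rintegral fine_le//.
  - by have /integrable_fin_num := i12; apply.
  - by have /integrable_fin_num := integrable_gker s1; apply.
  - apply: ge0_subset_integral => //.
      by have /integrableP[] := integrable_gker s1.
    by move=> t _; rewrite lee_fin gker_ge0.
apply: le_trans le12.
have -> : expR (-2) = \int[mu]_(t in `[1, 2]) expR (-2).
  rewrite Rintegral_cst//= lebesgue_measure_itv/= lte_fin.
  by rewrite (_ : 1 < 2) ?ltr1n//= (_ : 2 - 1 = 1) ?mulr1//; ring.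
apply: le_Rintegral => //; first by apply: integrable_cc => x _; exact: cvg_cst.
move=> t; rewrite /= in_itv/= => /andP[t1 t2].
rewrite /gker -[leLHS]mul1r ler_pM ?expR_ge0//; last by rewrite ler_expR lerN2.
by rewrite -[leLHS](powRr0 t) ler_powR// subr_ge0.
Qed.

(** Projecting on the direction of angle [tau * ln s], near which the kernel concentrates, leaves
    the loss [1 - cos (tau * ln (t / s))]. It is at most [4 * tau ^+ 2 * (t / s - 2 + s / t)], and
    the integral of this against the kernel is exactly [4 * tau ^+ 2 * gam s / (s - 1)]. Together
    with [gnorm2_le] it shows that the modulus at [s + i tau] is equivalent to [gam s] for large
    [s]. *)
Lemma gnorm2_ge s tau : 2 <= s ->
  gam s * (1 - 4 * tau ^+ 2 / (s - 1)) <= Num.sqrt (gnorm2 s tau).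
Proof.
move=> s2; have s1 : 1 <= s by rewrite (le_trans _ s2)// ler1n.
have sm1 : 1 <= s - 1 by lra.
have s0 : 0 < s by lra.
pose c := tau * ln s.
apply: (@le_trans _ _ (cos c * gcos s tau + sin c * gsin s tau)); last first.
  rewrite (le_trans (ler_norm _))// -sqrtr_sqr ler_wsqrtr// /gnorm2.
  have := cos2Dsin2 c; have := sqr_ge0 (cos c * gsin s tau - sin c * gcos s tau).
  by nra.
have e1 : gam (s + 1) = s * gam s by exact: gamS.
have e2 : gam s = (s - 1) * gam (s - 1) by rewrite -gamS// subrK.
have -> : gam s * (1 - 4 * tau ^+ 2 / (s - 1)) =
  gam s - 4 * tau ^+ 2 * (s^-1 * gam (s + 1) - 2 * gam s + s * gam (s - 1)).
  rewrite e1 e2; field; apply/andP; split; lra.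
have ig := integrable_gker s1; have igm := integrable_gker sm1.
have igp : mu.-integrable D (EFin \o gker (s + 1)) by apply: integrable_gker; lra.
have iZ c0 s3 : 1 <= s3 -> mu.-integrable D (EFin \o (fun t => c0 * gker s3 t)).
  by move=> h; apply: integrable_scale => //; exact: integrable_gker.
pose g t := gker s t - 4 * tau ^+ 2 * (s^-1 * gker (s + 1) t - 2 * gker s t + s * gker (s - 1) t).
have iA : mu.-integrable D (EFin \o (fun t => s^-1 * gker (s + 1) t - 2 * gker s t)).
  by apply: integrable_sub => //; apply: iZ => //; lra.
have iB : mu.-integrable D (EFin \o (fun t => s^-1 * gker (s + 1) t - 2 * gker s t + s * gker (s - 1) t)).
  by apply: integrable_add => //; apply: iZ.
have -> : gam s - 4 * tau ^+ 2 * (s^-1 * gam (s + 1) - 2 * gam s + s * gam (s - 1))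
    = \int[mu]_(t in D) g t.
  rewrite /g RintegralB//; last by apply: integrable_scale.
  rewrite [in RHS]RintegralZl// RintegralD//; last exact: iZ.
  rewrite RintegralB//; [|apply: iZ; lra|exact: iZ].
  by rewrite !RintegralZl.
rewrite -Dlin//; apply: le_Rintegral => //.
- by apply: integrable_sub => //; apply: integrable_scale.
- apply: (@integrable_gkerM _ (`|cos c| + `|sin c|)) => // t.
    by move=> t0; apply: cvgD; apply: cvgM; try exact: cvg_cst; [exact: ccos|exact: csin].
  by rewrite (le_trans (ler_normD _ _))// !normrM lerD// ler_piMr// ?cos_max ?sin_max.
move=> t /D0 t0.
have gp : gker (s + 1) t = gker s t * t.
  by rewrite /gker addrK -(mulr_powRB1 (ltW t0) s0); ring.
have gm : gker (s - 1) t = gker s t / t.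
  rewrite /gker -(@mulr_powRB1 _ t (s - 1) (ltW t0)); last by lra.
  by field; rewrite gt_eqF.
rewrite /g gp gm.
have -> : gker s t - 4 * tau ^+ 2 * (s^-1 * (gker s t * t) - 2 * gker s t + s * (gker s t / t))
  = gker s t * (1 - 4 * tau ^+ 2 * (t / s - 2 + (t / s)^-1)).
  by field; apply/andP; split; lra.
apply: ler_wpM2l; first exact: gker_ge0.
rewrite -!(mulrC (cos (tau * ln t))) -!(mulrC (sin (tau * ln t))) -cosB /c -mulrBr -ln_div ?posrE//.
have h1 := one_minus_cos_le (tau * ln (t / s)).
have h2 := sqr_ln_le (divr_gt0 t0 s0).
have h3 := sqr_ge0 tau; rewrite exprMn in h1.
have h4 : tau ^+ 2 * ln (t / s) ^+ 2 <= tau ^+ 2 * (4 * (t / s - 2 + (t / s)^-1)) by rewrite ler_wpM2l.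
lra.
Qed.

Lemma gam_prod s n : 1 <= s -> gam (s + n%:R) = \prod_(k < n) (s + k%:R) * gam s.
Proof.
move=> s1; elim: n => [|n IH]; first by rewrite addr0 big_ord0 mul1r.
rewrite big_ord_recr/= -natr1 addrA gamS ?IH; first by ring.
by rewrite (le_trans s1)// lerDl.
Qed.

Lemma gnorm2_prod s tau n : 1 <= s ->
  gnorm2 (s + n%:R) tau = \prod_(k < n) ((s + k%:R) ^+ 2 + tau ^+ 2) * gnorm2 s tau.
Proof.
move=> s1; elim: n => [|n IH]; first by rewrite addr0 big_ord0 mul1r.
rewrite big_ord_recr/= -natr1 addrA gnorm2S ?IH; first by ring.
by rewrite (le_trans s1)// lerDl.
Qed.

(* Partial products of the Euler product for [|Gamma s / Gamma (s + i tau)| ^ 2]. *)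
Definition gprod s tau n := \prod_(k < n) (1 + (tau / (s + k%:R)) ^+ 2).

Let sk s k : 1 <= s -> 0 < s + k%:R.
Proof. by move=> s1; rewrite ltr_wpDr// (lt_le_trans ltr01). Qed.

Lemma gprodE s tau n : 1 <= s ->
  gprod s tau n * gam (s + n%:R) ^+ 2 * gnorm2 s tau = gnorm2 (s + n%:R) tau * gam s ^+ 2.
Proof.
move=> s1; rewrite gam_prod// gnorm2_prod// exprMn -prodrXl.
have -> : \prod_(k < n) ((s + k%:R) ^+ 2 + tau ^+ 2) =
    gprod s tau n * \prod_(k < n) (s + k%:R) ^+ 2.
  rewrite -big_split/=; apply: eq_bigr => k _.
  by have := sk k s1 => h; field; rewrite gt_eqF.
ring.
Qed.

(** A zero would propagate to [s + n] by the functional equation, and [gnorm2_ge] excludes it once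
    [n] exceeds [4 * tau ^+ 2 + 2]. *)
Lemma gnorm2_gt0 s tau : 1 <= s -> 0 < gnorm2 s tau.
Proof.
move=> s1; rewrite lt_neqAle addr_ge0 ?sqr_ge0// andbT eq_sym; apply/eqP => g0.
pose n := (Num.Def.trunc (4 * tau ^+ 2 + 2)).+1.
have hn : 4 * tau ^+ 2 + 2 < n%:R by exact: truncnS_gt.
have t2 := sqr_ge0 tau.
have s2 : 2 <= s + n%:R by lra.
have := gnorm2_ge tau s2; rewrite gnorm2_prod// g0 mulr0 sqrtr0 leNgt; case/negP.
rewrite mulr_gt0 ?gam_gt0//; first by lra.
by rewrite subr_gt0 ltr_pdivrMr; lra.
Qed.

(** The partial product is its limit multiplied by [gnorm2 (s + n) tau / gam (s + n) ^ 2], a ratio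
    squeezed to 1 by [gnorm2_ge] and [gnorm2_le]. *)
Lemma gprod_cvg s tau : 1 <= s -> gprod s tau n @[n --> \oo] --> gam s ^+ 2 / gnorm2 s tau.
Proof.
move=> s1; pose r n := gnorm2 (s + n%:R) tau / gam (s + n%:R) ^+ 2.
have g0 n : 0 < gam (s + n%:R) by rewrite gam_gt0// (le_trans s1)// lerDl.
have -> : gprod s tau = fun n => r n * (gam s ^+ 2 / gnorm2 s tau).
  apply/funext => n; have h := gprodE tau n s1; have h1 := gnorm2_gt0 tau s1.
  have e : gprod s tau n = gnorm2 (s + n%:R) tau * gam s ^+ 2 / (gam (s + n%:R) ^+ 2 * gnorm2 s tau).
    by rewrite -h; field; rewrite !gt_eqF.
  by rewrite e /r; field; rewrite !gt_eqF.
rewrite -[X in _ --> X]mul1r; apply: cvgMl.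
(* The 8 comes from [s + n - 1 >= n >= (n + 1) / 2], applied to the error
   [4 * tau ^+ 2 / (s + n - 1)]. *)
have lo : (1 - 8 * tau ^+ 2 * n.+1%:R^-1) ^+ 2 @[n --> \oo] --> (1 : R).
  have h : 1 - 8 * tau ^+ 2 * n.+1%:R^-1 @[n --> \oo] --> (1 : R).
    rewrite -[X in _ --> X](subr0 1) -(mulr0 (8 * tau ^+ 2)); apply: cvgB; first exact: cvg_cst.
    by apply: cvgMr; exact: cvg_harmonic.
  rewrite -[X in _ --> X](mulr1 1); under eq_fun do rewrite expr2; exact: cvgM.
apply: (@squeeze_cvgr _ _ _ _ (fun n => (1 - 8 * tau ^+ 2 * n.+1%:R^-1) ^+ 2) (cst 1)) => //; last exact: cvg_cst.
exists (Num.Def.trunc (8 * tau ^+ 2)).+2 => // n /= hn.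
have hn1 : 8 * tau ^+ 2 + 1 <= n%:R.
  have h := truncnS_gt (8 * tau ^+ 2); apply: (@le_trans _ _ ((Num.Def.trunc (8 * tau ^+ 2)).+1%:R + 1)).
    by rewrite lerD2r ltW.
  by rewrite natr1 ler_nat.
have t2 : 0 <= tau ^+ 2 by exact: sqr_ge0.
have g := g0 n; have s1n : 1 <= s + n%:R by lra.
apply/andP; split; last first.
  by rewrite ler_pdivrMr ?exprn_gt0// mul1r gnorm2_le.
rewrite ler_pdivlMr ?exprn_gt0// -exprMn.
rewrite -[leRHS](sqr_sqrtr (ltW (gnorm2_gt0 tau s1n))) lerXn2r ?nnegrE ?sqrtr_ge0//.
  rewrite mulr_ge0 ?(ltW g)// subr_ge0 ler_pdivrMr// mul1r -natr1; lra.
apply: le_trans (gnorm2_ge tau _); last by lra.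
rewrite mulrC ler_wpM2l ?(ltW g)// lerD2l lerN2.
have -> : 8 * tau ^+ 2 / n.+1%:R = 4 * tau ^+ 2 * (n.+1%:R / 2)^-1 by field; rewrite nat1r.
apply: ler_wpM2l; first by rewrite mulr_ge0.
have p1 : 0 < s + n%:R - 1 by lra.
have p2 : 0 < n.+1%:R / 2 :> R by rewrite divr_gt0.
by rewrite lef_pV2 ?posrE// -natr1; lra.
Qed.

End GammaModulus.

Section GammaContinuity.
Variable R : realType.
Local Notation mu := (@lebesgue_measure R).
Local Notation D := (`]0, +oo[%classic : set R).
Let mD : measurable D. Proof. exact: measurable_itv. Qed.

Lemma continuous_gnorm2 (s : R) : 1 <= s -> continuous (gnorm2 s).
Proof.
move=> s1 tau.
have key (g : R -> R) : continuous g -> (forall t, `|g t| <= 1) ->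
    {for tau, continuous (fun x : R => \int[mu]_(t in D) (gker s t * g (x * ln t)))}.
  move=> cg gb.
  have := @continuity_under_integral R _ _ mu (fun x t => gker s t * g (x * ln t)) D mD
    (tau - 1) (tau + 1) _ _ (fun t => gker s t) (integrable_gker s1) _ tau.
  apply.
  - move=> x _; apply: (integrable_gkerM (h := fun t => g (x * ln t)) (H := 1)) => // t t0.
    apply: continuous_comp; last exact: cg.
    by apply: cvgM; [exact: cvg_cst|exact: continuous_ln].
  - apply: aeW => t _ x _; apply: cvgM; first exact: cvg_cst.
    apply: continuous_comp; last exact: cg.
    by apply: cvgM; [exact: cvg_id|exact: cvg_cst].
  - move=> x _; apply: aeW => t _; rewrite normrM ger0_norm ?gker_ge0//.
    by rewrite ler_piMr ?gker_ge0.
  - by rewrite inE /= in_itv/=; apply/andP; split; lra.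
have c1 : {for tau, continuous (gcos s)} by apply: key; [exact: continuous_cos|exact: cos_max].
have c2 : {for tau, continuous (gsin s)} by apply: key; [exact: continuous_sin|exact: sin_max].
rewrite /gnorm2; apply: cvgD.
  by rewrite expr2; under eq_fun do rewrite expr2; exact: (cvgM c1 c1).
by rewrite expr2; under eq_fun do rewrite expr2; exact: (cvgM c2 c2).
Qed.

Lemma normc_cGamma (s tau : R) :
  ComplexField.Normc.normc (cGamma (Complex s tau)) ^+ 2 = gnorm2 s tau.
Proof.
rewrite /cGamma /= sqr_sqrtr ?addr_ge0 ?sqr_ge0//.
Qed.

End GammaContinuity.

(** * Complex sequences and binomial coefficients *)

Section ComplexSequences.
Variable R : realType.
Local Notation C := R[i].
Local Notation Re := complex.Re.
Local Notation Im := complex.Im.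
Implicit Types (x y z w s : C) (u v : nat -> C).

Definition nrm2 x : R := Re x ^+ 2 + Im x ^+ 2.

Lemma nrm2M x y : nrm2 (x * y) = nrm2 x * nrm2 y.
Proof. by case: x => a b; case: y => c d; rewrite /nrm2 /=; ring. Qed.

Lemma nrm2_ge0 x : 0 <= nrm2 x.
Proof. by rewrite addr_ge0 ?sqr_ge0. Qed.

Lemma nrm2_gt0 x : x != 0 -> 0 < nrm2 x.
Proof.
case: x => a b; rewrite eq_complex /= negb_and /nrm2/= => h.
by rewrite lt_neqAle addr_ge0 ?sqr_ge0// andbT eq_sym paddr_eq0 ?sqr_ge0// !sqrf_eq0 negb_and.
Qed.

Lemma nrm2_real (a : R) : nrm2 (Complex a 0) = a ^+ 2.
Proof. by rewrite /nrm2 /= expr0n addr0. Qed.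

Lemma nrm2V x : nrm2 x^-1 = (nrm2 x)^-1.
Proof.
have [->|x0] := eqVneq x 0; first by rewrite invr0 /nrm2 /= !expr0n addr0 invr0.
have h := lt0r_neq0 (nrm2_gt0 x0); apply: (mulfI h).
by rewrite -nrm2M mulfV// mulfV// /nrm2 /= expr1n expr0n addr0.
Qed.

Lemma normr_Re_le x : `|Re x| <= Num.sqrt (nrm2 x).
Proof. by rewrite -sqrtr_sqr ler_wsqrtr// lerDl sqr_ge0. Qed.
Lemma normr_Im_le x : `|Im x| <= Num.sqrt (nrm2 x).
Proof. by rewrite -sqrtr_sqr ler_wsqrtr// lerDr sqr_ge0. Qed.

Lemma ReIm_eq x y : Re x = Re y -> Im x = Im y -> x = y.
Proof. by case: x => a b; case: y => c d /= -> ->. Qed.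

Definition ccvg u x := (Re (u n) @[n --> \oo] --> Re x) /\ (Im (u n) @[n --> \oo] --> Im x).

Lemma ccvg_ext u v x : u =1 v -> ccvg u x -> ccvg v x.
Proof. by move=> /funext ->. Qed.

Lemma ccvg_cst x : ccvg (fun=> x) x.
Proof. by split; exact: cvg_cst. Qed.

Lemma ccvgM u v x y : ccvg u x -> ccvg v y -> ccvg (fun n => u n * v n) (x * y).
Proof.
move=> [u1 u2] [v1 v2]; split.
  have -> : (fun n => Re (u n * v n)) = fun n => Re (u n) * Re (v n) - Im (u n) * Im (v n).
    by apply/funext => n; case: (u n) => ? ?; case: (v n).
  have -> : Re (x * y) = Re x * Re y - Im x * Im y by case: (x) => ? ?; case: (y).
  by apply: cvgB; apply: cvgM.
have -> : (fun n => Im (u n * v n)) = fun n => Re (u n) * Im (v n) + Im (u n) * Re (v n).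
  by apply/funext => n; case: (u n) => ? ?; case: (v n).
have -> : Im (x * y) = Re x * Im y + Im x * Re y by case: (x) => ? ?; case: (y).
by apply: cvgD; apply: cvgM.
Qed.

Lemma ccvgD u v x y : ccvg u x -> ccvg v y -> ccvg (fun n => u n + v n) (x + y).
Proof.
move=> [u1 u2] [v1 v2]; split.
  have -> : (fun n => Re (u n + v n)) = fun n => Re (u n) + Re (v n).
    by apply/funext => n; case: (u n) => ? ?; case: (v n).
  have -> : Re (x + y) = Re x + Re y by case: (x) => ? ?; case: (y).
  exact: cvgD.
have -> : (fun n => Im (u n + v n)) = fun n => Im (u n) + Im (v n).
  by apply/funext => n; case: (u n) => ? ?; case: (v n).
have -> : Im (x + y) = Im x + Im y by case: (x) => ? ?; case: (y).
exact: cvgD.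
Qed.

Lemma ccvgN u x : ccvg u x -> ccvg (fun n => - u n) (- x).
Proof.
move=> h; have := ccvgM (ccvg_cst (-1)) h; rewrite mulN1r.
by apply: ccvg_ext => n; rewrite mulN1r.
Qed.

Lemma ccvgB u v x y : ccvg u x -> ccvg v y -> ccvg (fun n => u n - v n) (x - y).
Proof. by move=> h1 /ccvgN; exact: ccvgD. Qed.

Lemma cvg_nrm2 u x : ccvg u x -> nrm2 (u n) @[n --> \oo] --> nrm2 x.
Proof.
move=> [u1 u2]; rewrite /nrm2; apply: cvgD.
  by rewrite expr2; under eq_fun do rewrite expr2; exact: (cvgM u1 u1).
by rewrite expr2; under eq_fun do rewrite expr2; exact: (cvgM u2 u2).
Qed.

Lemma ccvgV u x : x != 0 -> ccvg u x -> ccvg (fun n => (u n)^-1) x^-1.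
Proof.
move=> x0 ux; have n0 := lt0r_neq0 (nrm2_gt0 x0).
have VE y : y^-1 = Complex (Re y / nrm2 y) (- Im y / nrm2 y).
  by case: y => a b; rewrite /nrm2 /=; apply: ReIm_eq => //=; rewrite mulNr.
have nV : (nrm2 (u n))^-1 @[n --> \oo] --> (nrm2 x)^-1 by apply: cvgV => //; exact: cvg_nrm2.
have [u1 u2] := ux.
apply: (@ccvg_ext (fun n => Complex (Re (u n) / nrm2 (u n)) (- Im (u n) / nrm2 (u n)))).
  by move=> n; rewrite [RHS]VE.
rewrite VE; split => /=; first exact: cvgM.
by apply: cvgM => //; exact: cvgN.
Qed.

Lemma ccvg_nrm2_0 u x : nrm2 (u n - x) @[n --> \oo] --> (0 : R) -> ccvg u x.
Proof.
move=> h; have h2 : Num.sqrt (nrm2 (u n - x)) @[n --> \oo] --> (0 : R).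
  by rewrite -(sqrtr0 R); apply: continuous_cvg h; exact: sqrt_continuous.
split; apply/subr_cvg0; apply: norm_cvg0;
  apply: (@squeeze_cvgr _ _ _ _ (cst 0) _ _ _ _ _ h2); try exact: cvg_cst;
  apply: nearW => n; rewrite normr_ge0/=.
  apply: le_trans (normr_Re_le _); case: (u n) => ? ?; case: (x) => ? ? /=; exact: lexx.
apply: le_trans (normr_Im_le _); case: (u n) => ? ?; case: (x) => ? ? /=; exact: lexx.
Qed.

(* [expc u v] is [exp (u + i v)] *)
Definition expc (a b : R) : C := Complex (expR a * cos b) (expR a * sin b).

Lemma expcD a b c d : expc (a + c) (b + d) = expc a b * expc c d.
Proof. by apply: ReIm_eq; rewrite /= expRD ?cosD ?sinD; ring. Qed.

Lemma nrm2_expc a b : nrm2 (expc a b) = expR (a *+ 2).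
Proof.
rewrite /nrm2 /= !exprMn -mulrDr cos2Dsin2 mulr1 expr2 -expRD mulr2n//.
Qed.

Lemma expc_neq0 a b : expc a b != 0.
Proof.
apply/eqP => h; have := nrm2_expc a b; rewrite h /nrm2 /= expr0n addr0 => /eqP.
by rewrite eq_sym expR_eq0.
Qed.

Lemma expcV a b : (expc a b)^-1 = expc (- a) (- b).
Proof.
apply: (mulfI (expc_neq0 a b)); rewrite mulfV ?expc_neq0// -expcD !subrr.
by apply: ReIm_eq; rewrite /= expR0 ?cos0 ?sin0 ?mulr1 ?mulr0.
Qed.

Lemma expcX a b n : expc a b ^+ n = expc (n%:R * a) (n%:R * b).
Proof.
elim: n => [|n IH]; last by rewrite exprSr IH -expcD -natr1 !mulrDl !mul1r.
by rewrite expr0 !mul0r; apply: ReIm_eq; rewrite /= expR0 ?cos0 ?sin0 ?mulr1 ?mulr0.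
Qed.

(* Coefficients of [(1 - w t) ^ (- s)]. *)
Definition bcoef s w n : C := \prod_(k < n) (w * (s + k%:R) / k.+1%:R).

Lemma natC_neq0 n : (n.+1%:R : C) != 0.
Proof. by rewrite pnatr_eq0. Qed.

Lemma bcoefS s w n : n.+1%:R * bcoef s w n.+1 = w * (s + n%:R) * bcoef s w n.
Proof.
rewrite /bcoef big_ord_recr /=; have := natC_neq0 n.
by move: (n.+1%:R : C) => N N0; field.
Qed.

Lemma bcoef0 s w : bcoef s w 0 = 1.
Proof. by rewrite /bcoef big_ord0. Qed.

Lemma bcoef_scale s w y n : bcoef s (w * y) n = bcoef s w n * y ^+ n.
Proof.
elim: n => [|n IH]; first by rewrite !bcoef0 expr0 mulr1.
apply: (mulfI (natC_neq0 n)); rewrite bcoefS IH [RHS]mulrA bcoefS exprS; ring.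
Qed.

(** Coefficient form of [(1 - w t)^(1 - s) = (1 - w t) * (1 - w t)^(- s)]. *)
Lemma bcoef_shift s w n : bcoef (s - 1) w n.+1 = bcoef s w n.+1 - w * bcoef s w n.
Proof.
have key : n.+1%:R * bcoef (s - 1) w n.+1 = w * (s - 1) * bcoef s w n.
  elim: n => [|n IH]; first by rewrite bcoefS !bcoef0 addr0.
  apply: (mulfI (natC_neq0 n)).
  rewrite bcoefS mulrCA IH [in RHS]mulrCA bcoefS -[n.+1%:R]natr1; ring.
apply: (mulfI (natC_neq0 n)); rewrite key [RHS]mulrBr bcoefS -natr1; ring.
Qed.

Definition cconv u v n := \sum_(j < n.+1) u j * v (n - j)%N.

Section ConvRec.
Variables (s s' w w' : C).
Hypothesis ww' : w * w' = 1.
Local Notation Y := (cconv (bcoef s w) (bcoef s' w')).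
Let A n := \sum_(j < n.+1) j%:R * bcoef s w j * bcoef s' w' (n - j)%N.
Let B n := \sum_(j < n.+1) bcoef s w j * ((n - j)%:R * bcoef s' w' (n - j)%N).

Let AB n : n%:R * Y n = A n + B n.
Proof.
rewrite /cconv mulr_sumr -big_split; apply: eq_bigr => j _ /=.
have jn : (j <= n)%N by rewrite -ltnS.
rewrite natrB//; ring.
Qed.

Let AS n : A n.+1 = w * (s * Y n + A n).
Proof.
rewrite /A big_ord_recl mul0r mul0r add0r /cconv mulr_sumr -big_split mulr_sumr.
apply: eq_bigr => j _ /=; rewrite /bump /= add1n subSS bcoefS; ring.
Qed.

Let BS n : B n.+1 = w' * (s' * Y n + B n).
Proof.
rewrite /B big_ord_recr /= subnn mul0r mulr0 addr0 /cconv mulr_sumr -big_split mulr_sumr.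
apply: eq_bigr => j _ /=; have jn : (j <= n)%N by rewrite -ltnS.
rewrite subSn// bcoefS; ring.
Qed.

(** The product [G] of [(1 - w t)^(- s)] and [(1 - w' t)^(- s')] satisfies [(1 - w t)(1 - w' t) G' =
    (w s (1 - w' t) + w' s' (1 - w t)) G], and coefficients are compared using [w * w' = 1]. [A] and
    [B] are the coefficients obtained by applying [t d/dt] to the first and to the second factor. *)
Lemma cconv_rec n : n.+2%:R * Y n.+2 =
  (w * s + w' * s' + (w + w') * n.+1%:R) * Y n.+1 - (s + s' + n%:R) * Y n.
Proof.
have e1 := AB n.+1; have e0 := AB n; rewrite AB AS BS.
have -> : w * (s * Y n.+1 + A n.+1) + w' * (s' * Y n.+1 + B n.+1) =
  (w * s + w' * s') * Y n.+1 + (w + w') * (A n.+1 + B n.+1) - w' * A n.+1 - w * B n.+1 by ring.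
have wA : w' * A n.+1 = s * Y n + A n by rewrite AS mulrA [w' * w]mulrC ww' mul1r.
have wB : w * B n.+1 = s' * Y n + B n by rewrite BS mulrA ww' mul1r.
rewrite wA wB -e1 [in RHS]mulrDl -[in RHS]mulrA.
have -> : (s + s' + n%:R) * Y n = (s + s') * Y n + n%:R * Y n by ring.
rewrite e0; ring.
Qed.

Lemma cconv0 : Y 0 = 1.
Proof. by rewrite /cconv big_ord1 !bcoef0 mulr1. Qed.

Lemma cconv1 : Y 1 = w * s + w' * s'.
Proof.
have := AB 1; rewrite mul1r => ->.
by rewrite AS BS cconv0 /A /B !big_ord1 !mul0r !mulr0; ring.
Qed.

End ConvRec.

Lemma cconv_shift u s w n :
  cconv u (bcoef (s - 1) w) n.+1 = cconv u (bcoef s w) n.+1 - w * cconv u (bcoef s w) n.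
Proof.
rewrite /cconv big_ord_recr /= [in RHS]big_ord_recr /= subnn !bcoef0 addrAC; congr (_ + _).
rewrite mulr_sumr -sumrB; apply: eq_bigr => j _.
have jn : (j <= n)%N by rewrite -ltnS.
rewrite subSn// bcoef_shift; ring.
Qed.

Lemma tannery (t : nat -> nat -> R) (l M : nat -> R) :
  (forall n j, (j <= n)%N -> `|t n j| <= M j) -> cvgn (series M) ->
  (forall j, t n j @[n --> \oo] --> l j) ->
  cvgn (series l) /\ \sum_(j < n.+1) t n j @[n --> \oo] --> limn (series l).
Proof.
move=> tM cM tl.
have M0 j : 0 <= M j by apply: le_trans (tM j j (leqnn j)).
have lM j : `|l j| <= M j.
  have h : `|t n j| @[n --> \oo] --> `|l j| by apply: cvg_norm; exact: tl.
  rewrite -(cvg_lim _ h)//.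
  apply: limr_le; first by apply/cvg_ex; eexists; exact: h.
  by exists j => // n /= jn; exact: tM.
have cl : cvgn (series l).
  by apply: normed_cvg; apply: (series_le_cvg _ M0 lM cM) => n; exact: normr_ge0.
split => //; apply/cvgrPdist_le => e e0.
(* Past [J] the terms contribute at most [e / 4] both in the finite sums and in the limit series;
   before [J] the finitely many terms converge to within [e / 8]. *)
have e4 : 0 < e / 8 by rewrite divr_gt0.
have MC := cM; move/cvgrPdist_lt : MC => /(_ _ e4)[J _ hJ].
have tail (n : nat) : (J <= n)%N -> \sum_(J <= j < n) M j <= e / 4.
  move=> Jn; have := hJ n Jn; have := hJ J (leqnn J).
  rewrite (_ : \sum_(J <= j < n) M j = series M n - series M J); last first.
    by rewrite sub_series_geq.
  move=> h1 h2; have := ler_norm (series M n - series M J).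
  have := ler_distD (limn (series M)) (series M n) (series M J).
  rewrite (distrC (series M n) (limn _)) => h3 h4; lra.
have ltail (n : nat) : (J <= n)%N -> `|series l n - series l J| <= e / 4.
  move=> Jn; rewrite (_ : _ - _ = \sum_(J <= j < n) l j); last first.
    by rewrite sub_series_geq.
  rewrite (le_trans (ler_norm_sum _ _ _))// (le_trans _ (tail n Jn))//.
  by apply: ler_sum => j _; exact: lM.
have Ltail : `|limn (series l) - series l J| <= e / 4.
  have h : `|series l n - series l J| @[n --> \oo] --> `|limn (series l) - series l J|.
    by apply: cvg_norm; apply: cvgB => //; exact: cvg_cst.
  rewrite -(cvg_lim _ h)//; apply: limr_le; first by apply/cvg_ex; eexists; exact: h.
  by exists J => // n /= Jn; exact: ltail.
have head : \sum_(j < J) t n j @[n --> \oo] --> \sum_(j < J) l j.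
  elim: (J) => [|k IH]; first by rewrite big_ord0; under eq_fun do rewrite big_ord0; exact: cvg_cst.
  by rewrite big_ord_recr/=; under eq_fun do rewrite big_ord_recr/=; exact: cvgD.
move/cvgrPdist_le : head => /(_ _ e4)[K _ hK].
exists (maxn J K) => // n /=; rewrite geq_max => /andP[Jn Kn].
have := hK n Kn.
have -> : \sum_(j < n.+1) t n j = \sum_(j < J) t n j + \sum_(J <= j < n.+1) t n j.
  by rewrite -(big_mkord xpredT (t n)) -(big_mkord xpredT (t n)) -big_cat_nat// leqW.
have e0l : \sum_(j < J) l j = series l J by rewrite /series/= big_mkord.
have ht : `|\sum_(J <= j < n.+1) t n j| <= e / 4.
  rewrite (le_trans (ler_norm_sum _ _ _))// (le_trans _ (tail n.+1 (leqW Jn)))//.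
  rewrite !big_nat; apply: ler_sum => j /andP[_ jn]; exact: tM.
move: Ltail ht; rewrite e0l; set a := limn _; set b := series _ _; set c := \sum_(j < J) _; set d := \sum_(J <= j < n.+1) _.
move=> h1 h2 h3.
have -> : a - (c + d) = (a - b) + (b - c) - d by ring.
rewrite (le_trans (ler_normB _ _))//.
have := ler_normD (a - b) (b - c); lra.
Qed.

End ComplexSequences.

(** * The binomial series on the unit circle *)

Section BinomialSeries.
Variable R : realType.
Local Notation C := R[i].
Local Notation Re := complex.Re.
Local Notation Im := complex.Im.

(** A telescoping comparison series with explicit partial sums, of the size of [j^-2]. *)
Definition tele (j : nat) : R := (j.+1%:R * j.+2%:R)^-1.

Lemma tele_gt0 j : 0 < tele j. Proof. by rewrite invr_gt0 mulr_gt0. Qed.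

Lemma tele_sum n : \sum_(j < n) tele j = 1 - n.+1%:R^-1.
Proof.
elim: n => [|n IH]; first by rewrite big_ord0 invr1 subrr.
rewrite big_ord_recr/= IH /tele -[n.+2%:R]natr1; have h : n.+1%:R != 0 :> R by [].
have h2 : n.+1%:R + 1 != 0 :> R by rewrite natr1.
by move: (n.+1%:R : R) h h2 => x h h2; field; rewrite h h2.
Qed.

Lemma cvg_series_tele (f : nat -> R) (K : R) :
  (forall j, `|f j| <= K * tele j) -> cvgn (series f).
Proof.
move=> fK.
have K0 : 0 <= K by have := le_trans (normr_ge0 _) (fK 0); rewrite pmulr_lge0// tele_gt0.
apply: normed_cvg; apply: nondecreasing_is_cvgn.
  by apply: nondecreasing_series => n _ _; exact: normr_ge0.
exists K => _ [n _ <-].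
rewrite -[leLHS]/(\sum_(0 <= j < n) `|f j|) big_mkord.
apply: (@le_trans _ _ (\sum_(j < n) K * tele j)); first by apply: ler_sum => j _; exact: fK.
rewrite -mulr_sumr tele_sum ler_piMr// gerBl// invr_ge0//.
Qed.

Lemma bounded_of_eventually_nonincreasing (b : nat -> R) J : (forall j, 0 <= b j) ->
  (forall j, (J <= j)%N -> b j.+1 <= b j) -> exists2 K, 0 <= K & forall j, b j <= K.
Proof.
move=> b0 bJ; exists (\sum_(j < J.+1) b j); first by apply: sumr_ge0.
have le j : (j <= J)%N -> b j <= \sum_(j < J.+1) b j.
  move=> jJ; rewrite (bigD1 (Ordinal (jJ : (j < J.+1)%N)))//= lerDl; exact: sumr_ge0.
elim=> [|j IH]; first exact: le.
by have [h|h] := leqP j.+1 J; [exact: le|rewrite (le_trans (bJ _ _))].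
Qed.

(** Decay like the inverse of this quartic product leaves a power series, its derivative and its
    second derivative dominated by [tele] on the closed unit disc. *)
Definition qpoch (j : nat) : R := (j.+1 * j.+2 * j.+3 * j.+4)%:R.

Lemma natrC n : n%:R = Complex n%:R 0 :> C.
Proof. by rewrite -[LHS]raddfMn. Qed.

Lemma bcoef_nrm2S (s w : C) j : nrm2 w = 1 ->
  j.+1%:R ^+ 2 * nrm2 (bcoef s w j.+1) =
  ((Re s + j%:R) ^+ 2 + Im s ^+ 2) * nrm2 (bcoef s w j).
Proof.
move=> w1; rewrite -nrm2_real -nrm2M -natrC bcoefS !nrm2M w1 mul1r; congr (_ * _).
by rewrite /nrm2 natrC; case: (s) => x y /=; rewrite addr0.
Qed.

(** Coefficients of [(1 - w t)^(- s)] behave like [j^(Re s - 1)], so [Re s <= -5] leaves room for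
    the quartic factor. It suffices that [b] is eventually nonincreasing, which is a polynomial
    inequality in [j]. *)
Lemma bcoef_decay (s w : C) : nrm2 w = 1 -> Re s <= -5 ->
  exists2 K, 0 <= K & forall j, Num.sqrt (nrm2 (bcoef s w j)) * qpoch j <= K.
Proof.
move=> w1 s5.
pose b j := nrm2 (bcoef s w j) * qpoch j ^+ 2.
(* Beyond this index [0 <= Re s + j <= j - 5], [Im s ^+ 2 <= j / 4] and [10 <= j], which is what the
   inequality [key] uses. *)
pose J := (Num.Def.trunc (10 - Re s + 4 * Im s ^+ 2)).+1.
have [||K K0 bK] := @bounded_of_eventually_nonincreasing b J.
- by move=> j; rewrite mulr_ge0 ?nrm2_ge0 ?sqr_ge0.
- move=> j Jj.
  have hj : 10 - Re s + 4 * Im s ^+ 2 <= j%:R.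
    by rewrite (le_trans (ltW (truncnS_gt _)))// ler_nat.
  have rec := bcoef_nrm2S s j w1.
  rewrite /b /qpoch !natrM.
  have j1 : 0 < j.+1%:R :> R by [].
  have -> : nrm2 (bcoef s w j.+1) = ((Re s + j%:R) ^+ 2 + Im s ^+ 2) * nrm2 (bcoef s w j) / j.+1%:R ^+ 2.
    by rewrite -rec mulrAC mulfV ?mul1r// expf_neq0// gt_eqF.
  have e5 : j.+1.+4%:R = j%:R + 5 :> R by rewrite -(natrD _ j 5) addnC.
  have e1 : j.+1%:R = j%:R + 1 :> R by rewrite -natr1.
  set x : R := j%:R in hj e5 e1 *.
  have i2 := sqr_ge0 (Im s).
  have key : ((Re s + x) ^+ 2 + Im s ^+ 2) * (x + 5) ^+ 2 <= (x + 1) ^+ 4.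
    have h1 : (Re s + x) ^+ 2 <= (x - 5) ^+ 2 by rewrite lerXn2r ?nnegrE; lra.
    have h2 : (x + 5) ^+ 2 <= 4 * x ^+ 2.
      have -> : 4 * x ^+ 2 = (2 * x) ^+ 2 by ring.
      by rewrite lerXn2r ?nnegrE; lra.
    have h3 : (Re s + x) ^+ 2 * (x + 5) ^+ 2 <= (x - 5) ^+ 2 * (x + 5) ^+ 2 by rewrite ler_wpM2r ?sqr_ge0.
    have h4 : Im s ^+ 2 * (x + 5) ^+ 2 <= x / 4 * (4 * x ^+ 2).
      by rewrite ler_pM ?sqr_ge0//; lra.
    have x0 : 0 <= x by lra.
    have x2 : 100 <= x ^+ 2 by nra.
    have x3 : 0 <= x ^+ 3 by rewrite exprn_ge0.
    rewrite mulrDl (le_trans (lerD h3 h4))//.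
    have -> : (x - 5) ^+ 2 * (x + 5) ^+ 2 + x / 4 * (4 * x ^+ 2) = x ^+ 4 - 50 * x ^+ 2 + 625 + x ^+ 3 by field.
    have -> : (x + 1) ^+ 4 = x ^+ 4 + 4 * x ^+ 3 + 6 * x ^+ 2 + 4 * x + 1 by ring.
    lra.
  rewrite e5 e1 -[leLHS]mulrA -[X in _ * (_^-1 * X)]/(_ ^+ 2).
  set y := j.+2%:R; set z := j.+3%:R; set t := j.+4%:R; set N := nrm2 (bcoef _ _ _).
  have N0 : 0 <= N by exact: nrm2_ge0.
  have x1 : 0 < x + 1 by rewrite -e1.
  have -> : ((Re s + x) ^+ 2 + Im s ^+ 2) * N * ((x + 1) ^- 2 * (y * z * t * (x + 5)) ^+ 2) =
    (((Re s + x) ^+ 2 + Im s ^+ 2) * (x + 5) ^+ 2) * (N * (y * z * t) ^+ 2 / (x + 1) ^+ 2).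
    by field; rewrite gt_eqF.
  have -> : N * ((x + 1) * y * z * t) ^+ 2 = (x + 1) ^+ 4 * (N * (y * z * t) ^+ 2 / (x + 1) ^+ 2).
    by field; rewrite gt_eqF.
  by rewrite ler_wpM2r// divr_ge0 ?sqr_ge0// mulr_ge0 ?sqr_ge0.
- exists (Num.sqrt K); first exact: sqrtr_ge0.
  move=> j; have q0 : 0 <= qpoch j by exact: ler0n.
  by rewrite -{1}(ger0_norm q0) -sqrtr_sqr -sqrtrM ?nrm2_ge0// ler_wsqrtr// bK.
Qed.

Section Value.
Variables (s : C) (p q : R).
Hypotheses (pq : p ^+ 2 + q ^+ 2 = 1) (p1 : p < 1) (s5 : Re s <= -5).
Let zeta : C := Complex p (- q).
Let beta := bcoef s zeta.
Let b j := Re (beta j).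
Let d j := Im (beta j).

Let nz1 : nrm2 zeta = 1. Proof. by rewrite /nrm2 /= sqrrN. Qed.

Let decay : exists2 K, 0 <= K & forall j, `|b j| * qpoch j <= K /\ `|d j| * qpoch j <= K.
Proof.
have [K K0 hK] := bcoef_decay nz1 s5.
have q0 j : 0 <= qpoch j by exact: ler0n.
exists K => // j; split; rewrite (le_trans _ (hK j))// ler_wpM2r//.
  exact: normr_Re_le.
exact: normr_Im_le.
Qed.

Section RealPart.
Variables (f : nat -> R) (K : R).
Hypothesis fK : forall j, `|f j| * qpoch j <= K.

Let K0 : 0 <= K.
Proof. by apply: le_trans (fK 0); rewrite mulr_ge0 ?ler0n. Qed.

Let fb a c j : (a * (j.+1 * j.+2) <= (c + j).+1 * (c + j).+2 * (c + j).+3 * (c + j).+4)%N ->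
  `|a%:R * f (c + j)%N| <= K * tele j.
Proof.
move=> h; rewrite normrM ger0_norm// /tele -natrM ler_pdivlMr ?ltr0n// mulrAC -natrM.
by rewrite (le_trans _ (fK (c + j)))// mulrC ler_wpM2l// ler_nat.
Qed.

Let cvg1 (g : nat -> R) r : `|r| <= 1 -> (forall j, `|g j| <= K * tele j) -> cvgn (pseries g r).
Proof.
move=> r1 h; apply: (@cvg_series_tele _ K) => j /=.
rewrite normrM (le_trans _ (h j))// ler_piMr// normrX exprn_ile1//.
Qed.

Let c0 r : `|r| <= 1 -> cvgn (pseries f r).
Proof. by move=> r1; apply: cvg1 => // j; rewrite -[f j]mul1r; apply: (@fb 1 0); nia. Qed.
Let c1 r : `|r| <= 1 -> cvgn (pseries (pseries_diffs f) r).
Proof. by move=> r1; apply: cvg1 => // j; apply: (@fb j.+1 1); nia. Qed.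
Let c2 r : `|r| <= 1 -> cvgn (pseries (pseries_diffs (pseries_diffs f)) r).
Proof.
move=> r1; apply: cvg1 => // j; rewrite /pseries_diffs mulrA -natrM.
by apply: (@fb (j.+1 * j.+2) 2); nia.
Qed.
Let n1 : `|1 : R| <= 1. Proof. by rewrite normr1. Qed.

Definition psum (r : R) : R := limn (pseries f r).
Definition dpsum (r : R) : R := limn (pseries (pseries_diffs f) r).

Lemma is_derive_psum (r : R) : `|r| < 1 -> is_derive r 1 psum (dpsum r).
Proof.
move=> r1; apply: (@pseries_snd_diffs _ f 1 r); [exact: c0|exact: c1|exact: c2|].
by rewrite normr1.
Qed.

Lemma cvg_psum r : `|r| <= 1 -> pseries f r n @[n --> \oo] --> psum r.
Proof. exact: c0. Qed.

Lemma cvg_dpsum r : `|r| <= 1 -> pseries (pseries_diffs f) r n @[n --> \oo] --> dpsum r.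
Proof. exact: c1. Qed.

Lemma psum0 : psum 0 = f 0.
Proof.
apply/cvg_lim => //; apply: cvg_near_cst; exists 1 => // n /= n1'.
rewrite /pseries /series /= big_ltn// big_nat big1 ?addr0 ?expr0 ?mulr1//.
by move=> j /andP[j0 _]; rewrite expr0n gtn_eqF// mulr0.
Qed.

(** Since [j * f j] is summable and [1 - r ^+ j <= j * (1 - r)], the sum is Lipschitz up to the
    boundary point 1. This plays the part of Abel's theorem in passing to the unit circle. *)
Lemma psum_lip r : 0 <= r <= 1 -> `|psum 1 - psum r| <= K * (1 - r).
Proof.
move=> /andP[r0 r1].
have h1 : pseries f 1 n @[n --> \oo] --> psum 1 by apply: cvg_psum; rewrite normr1.
have h2 : pseries f r n @[n --> \oo] --> psum r by apply: cvg_psum; rewrite ger0_norm.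
have h : `|pseries f 1 n - pseries f r n| @[n --> \oo] --> `|psum 1 - psum r|.
  by apply: cvg_norm; exact: cvgB.
rewrite -(cvg_lim _ h)//; apply: limr_le; first by apply/cvg_ex; eexists; exact: h.
apply: nearW => n; rewrite /pseries /series/= -sumrB big_mkord.
apply: (le_trans (ler_norm_sum _ _ _)).
apply: (@le_trans _ _ (\sum_(j < n) K * tele j * (1 - r))).
  apply: ler_sum => j _; rewrite expr1n -mulrBr normrM.
  have rj : 0 <= 1 - r ^+ j by rewrite subr_ge0 exprn_ile1.
  have hj : 1 - r ^+ j <= j%:R * (1 - r).
    elim: (nat_of_ord j) => [|k IH]; first by rewrite expr0 subrr mul0r.
    have : 0 <= (1 - r ^+ k) * (1 - r) by rewrite mulr_ge0 ?subr_ge0// exprn_ile1.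
    by rewrite exprS -natr1; lra.
  have h3 : `|j%:R * f j| <= K * tele j by apply: (@fb j 0); nia.
  rewrite (ger0_norm rj) (le_trans (ler_wpM2l (normr_ge0 _) hj))//.
  by rewrite mulrA ler_wpM2r ?subr_ge0// mulrC; move: h3; rewrite normrM ger0_norm.
rewrite -mulr_suml ler_wpM2r ?subr_ge0// -mulr_sumr tele_sum ler_piMr// gerBl invr_ge0//.
Qed.

End RealPart.
Let X := psum b. Let Y := psum d.
Let X' := dpsum b. Let Y' := dpsum d.

Let real_mul (x y r : R) : Complex x y * Complex r 0 = Complex (x * r) (y * r).
Proof. by apply: ReIm_eq; rewrite /=; ring. Qed.

Let H_ r n : C := Complex (pseries b r n) (pseries d r n).
Let G_ r n : C := Complex (pseries (pseries_diffs b) r n) (pseries (pseries_diffs d) r n).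

Let bE n : beta n = Complex (b n) (d n).
Proof. by rewrite /b /d; case: (beta n). Qed.

Let HS r n : H_ r n.+1 = H_ r n + beta n * Complex (r ^+ n) 0.
Proof.
rewrite /H_ /pseries !seriesSr /=; rewrite bE real_mul.
exact: ReIm_eq.
Qed.

Let GS r n : G_ r n.+1 = G_ r n + n.+1%:R * beta n.+1 * Complex (r ^+ n) 0.
Proof.
rewrite /G_ /pseries !seriesSr /= natrC bE.
by apply: ReIm_eq; rewrite /= /pseries_diffs; ring.
Qed.

(** Partial-sum form of the equation [(1 - zeta r) H' = zeta s H]; the extra term is a boundary
    term, removed by [bdry] in the limit. *)
Let ode_ r n : G_ r n * (1 - zeta * Complex r 0) =
  zeta * s * H_ r n - zeta * (n%:R * beta n * Complex (r ^+ n) 0).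
Proof.
elim: n => [|n IH].
  by rewrite mul0r mul0r mulr0 subr0 /G_ /H_ /pseries /series /= !big_geq//; apply: ReIm_eq; rewrite /= ; case: (zeta * s) => ? ? /=; ring.
rewrite GS HS mulrDl IH bcoefS.
have -> : Complex (r ^+ n.+1) 0 = Complex (r ^+ n) 0 * Complex r 0 :> C.
  by rewrite real_mul mul0r exprSr.
rewrite -/beta; ring.
Qed.

Let bdry r (f : nat -> R) K : (forall j, `|f j| * qpoch j <= K) -> `|r| <= 1 ->
  n%:R * f n * r ^+ n @[n --> \oo] --> (0 : R).
Proof.
move=> fK r1.
have K0 : 0 <= K by apply: le_trans (fK 0); rewrite mulr_ge0 ?ler0n.
have h : K * n.+1%:R^-1 @[n --> \oo] --> (0 : R).
  by rewrite -(mulr0 K); apply: cvgMr; exact: cvg_harmonic.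
apply: norm_cvg0; apply: (@squeeze_cvgr _ _ _ _ (cst 0) _ _ _ _ _ h); last exact: cvg_cst.
apply: nearW => n; rewrite normr_ge0/= normrM normrX.
rewrite (@le_trans _ _ `|n%:R * f n|)//; first by rewrite ler_piMr// exprn_ile1.
rewrite normrM ger0_norm// ler_pdivlMr// mulrAC -natrM (le_trans _ (fK n))// mulrC.
by rewrite ler_wpM2l// ler_nat; nia.
Qed.

Let ode r : `|r| < 1 ->
  Complex (X' r) (Y' r) * (1 - zeta * Complex r 0) = zeta * s * Complex (X r) (Y r).
Proof.
move=> r1; have [K K0 hK] := decay; have r1' := ltW r1.
have cG : ccvg (G_ r) (Complex (X' r) (Y' r)).
  by split => /=; [apply: (@cvg_dpsum b K) => // j; case: (hK j)|apply: (@cvg_dpsum d K) => // j; case: (hK j)].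
have cH : ccvg (H_ r) (Complex (X r) (Y r)).
  by split => /=; [apply: (@cvg_psum b K) => // j; case: (hK j)|apply: (@cvg_psum d K) => // j; case: (hK j)].
have cB : ccvg (fun n => n%:R * beta n * Complex (r ^+ n) 0) 0.
  have e n : n%:R * beta n * Complex (r ^+ n) 0 = Complex (n%:R * b n * r ^+ n) (n%:R * d n * r ^+ n).
    rewrite natrC /b /d; case: (beta n) => x y; apply: ReIm_eq; rewrite /=; ring.
  apply: (ccvg_ext (fun n => esym (e n))); split => /=.
    by apply: (@bdry _ _ K) => // j; case: (hK j).
  by apply: (@bdry _ _ K) => // j; case: (hK j).
have c1 := ccvgM cG (ccvg_cst (1 - zeta * Complex r 0)).
have c2 := ccvgB (ccvgM (ccvg_cst (zeta * s)) cH) (ccvgM (ccvg_cst zeta) cB).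
have {}c1 := ccvg_ext (ode_ r) c1.
rewrite mulr0 subr0 in c2.
have [a1 a2] := c1; have [b1 b2] := c2.
by apply: ReIm_eq; [exact: (cvg_unique _ a1 b1)|exact: (cvg_unique _ a2 b2)].
Qed.

(** [ell r + i alp r] is the logarithm of [1 - zeta r]; the principal branch is legitimate because
    the real part [1 - r * p] stays positive. Then [u + i v] is [s] times this logarithm, and [E] is
    [(1 - zeta r)^s]. *)
Let N (r : R) : R := (1 - r * p) ^+ 2 + (r * q) ^+ 2.
Let ell (r : R) : R := ln (N r) / 2.
Let alp (r : R) : R := atan (r * q / (1 - r * p)).
Let u r := Re s * ell r - Im s * alp r.
Let v r := Re s * alp r + Im s * ell r.

Let rp (r : R) : 0 <= r <= 1 -> 0 < 1 - r * p.
Proof.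
move=> /andP[r0 r1]; have [p0|/ltW p0] := leP 0 p; last by nra.
have h : r * p <= p by rewrite ler_piMl.
by have := p1; lra.
Qed.

Let N0 (r : R) : 0 <= r <= 1 -> 0 < N r.
Proof. by move=> h; rewrite /N ltr_pwDl ?sqr_ge0// exprn_gt0// rp. Qed.

Let dell (r : R) : 0 <= r <= 1 -> is_derive r 1 ell ((- p * (1 - r * p) + r * q ^+ 2) / N r).
Proof.
move=> h; have n0 := N0 h.
have dN : is_derive r 1 N (2 * (- p * (1 - r * p) + r * q ^+ 2)).
  by apply: is_derive_eq; rewrite !scale_oE; ring.
have dl := is_derive1_ln n0.
by apply: is_derive_eq; rewrite !scale_oE; field; rewrite gt_eqF.
Qed.

Let dalp (r : R) : 0 <= r <= 1 -> is_derive r 1 alp (q / N r).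
Proof.
move=> h; have n0 := N0 h; have r0 := rp h.
have dV : is_derive r 1 (fun x : R => (1 - x * p)^-1) (p / (1 - r * p) ^+ 2).
  have d1 : is_derive r 1 (fun x : R => 1 - x * p) (- p).
    by apply: is_derive_eq; rewrite !scale_oE; ring.
  have h1 := @is_deriveV _ (fun x : R => 1 - x * p) r (- p) 1 (lt0r_neq0 r0) d1.
  by apply: (is_derive_eq h1); rewrite !scale_oE; field; rewrite gt_eqF.
have dQ : is_derive r 1 (fun x : R => x * q / (1 - x * p)) (q / (1 - r * p) ^+ 2).
  by apply: is_derive_eq; rewrite !scale_oE; field; rewrite gt_eqF.
apply: is_derive_eq; rewrite /N; field.
by rewrite !gt_eqF//; move: n0; rewrite /N.
Qed.

Let E r := expc (u r) (v r).
(** [D1] and [D2] are the real and imaginary parts of [(X + i Y) * E], which the differential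
    equation makes constant. *)
Let D1 r := X r * (expR (u r) * cos (v r)) - Y r * (expR (u r) * sin (v r)).
Let D2 r := X r * (expR (u r) * sin (v r)) + Y r * (expR (u r) * cos (v r)).

Let dD (r : R) : 0 <= r -> r < 1 -> is_derive r 1 D1 0 /\ is_derive r 1 D2 0.
Proof.
move=> r0 r1; have h : 0 <= r <= 1 by rewrite r0 ltW.
have ar : `|r| < 1 by rewrite ger0_norm.
have [K K0 hK] := decay.
have dX : is_derive r 1 X (X' r) by apply: (@is_derive_psum b K) => // j; case: (hK j).
have dY : is_derive r 1 Y (Y' r) by apply: (@is_derive_psum d K) => // j; case: (hK j).
have n0 := lt0r_neq0 (N0 h).
pose l' := (- p * (1 - r * p) + r * q ^+ 2) / N r. pose a' := q / N r.
have du : is_derive r 1 u (Re s * l' - Im s * a').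
  have h1 := dell h; have h2 := dalp h.
  by apply: is_derive_eq; rewrite !scale_oE /l' /a'; ring.
have dv : is_derive r 1 v (Re s * a' + Im s * l').
  have h1 := dell h; have h2 := dalp h.
  by apply: is_derive_eq; rewrite !scale_oE /l' /a'; ring.
have o := ode ar.
pose sg := Re s; pose ta := Im s.
have [oR' oI'] : X' r * (1 - r * p) - Y' r * (r * q) = (p * sg + q * ta) * X r - (p * ta - q * sg) * Y r /\
    X' r * (r * q) + Y' r * (1 - r * p) = (p * sg + q * ta) * Y r + (p * ta - q * sg) * X r.
  have := congr1 (@complex.Im R) o; have := congr1 (@complex.Re R) o.
  rewrite /sg /ta; case: (s) => s1 s2 /= h1 h2; split; lra.
have eL : N r * l' = - p * (1 - r * p) + r * q ^+ 2 by rewrite /l' mulrC divfK.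
have eA : N r * a' = q by rewrite /a' mulrC divfK.
have e1 : X' r + (X r * (sg * l' - ta * a') - Y r * (sg * a' + ta * l')) = 0.
  apply: (mulfI n0); rewrite mulr0.
  transitivity (N r * X' r + (X r * (sg * (N r * l') - ta * (N r * a')) - Y r * (sg * (N r * a') + ta * (N r * l')))).
    by ring.
  rewrite eL eA.
  have -> : N r * X' r = (1 - r * p) * (X' r * (1 - r * p) - Y' r * (r * q)) + (r * q) * (X' r * (r * q) + Y' r * (1 - r * p)).
    by rewrite /N; ring.
  by rewrite oR' oI'; ring.
have e2 : Y' r + (X r * (sg * a' + ta * l') + Y r * (sg * l' - ta * a')) = 0.
  apply: (mulfI n0); rewrite mulr0.
  transitivity (N r * Y' r + (X r * (sg * (N r * a') + ta * (N r * l')) + Y r * (sg * (N r * l') - ta * (N r * a')))).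
    by ring.
  rewrite eL eA.
  have -> : N r * Y' r = (1 - r * p) * (X' r * (r * q) + Y' r * (1 - r * p)) - (r * q) * (X' r * (1 - r * p) - Y' r * (r * q)).
    by rewrite /N; ring.
  by rewrite oR' oI'; ring.
set e := expR (u r); set c := cos (v r); set d1 := sin (v r).
split; apply: is_derive_eq; rewrite !scale_oE -/sg -/ta -/e -/c -/d1.
  transitivity (e * (c * (X' r + (X r * (sg * l' - ta * a') - Y r * (sg * a' + ta * l')))
     - d1 * (Y' r + (X r * (sg * a' + ta * l') + Y r * (sg * l' - ta * a'))))); first by ring.
  by rewrite e1 e2; ring.
transitivity (e * (d1 * (X' r + (X r * (sg * l' - ta * a') - Y r * (sg * a' + ta * l')))
   + c * (Y' r + (X r * (sg * a' + ta * l') + Y r * (sg * l' - ta * a'))))); first by ring.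
by rewrite e1 e2; ring.
Qed.

Let E0 : (u 0 = 0) * (v 0 = 0).
Proof.
have e0 : ell 0 = 0 by rewrite /ell /N !mul0r subr0 expr1n expr0n addr0 ln1 mul0r.
have a0 : alp 0 = 0 by rewrite /alp !mul0r atan0.
by rewrite /u /v e0 a0 !mulr0 subrr addr0.
Qed.

Let X0 : X 0 = 1. Proof. by rewrite /X psum0 /b /beta bcoef0. Qed.
Let Y0 : Y 0 = 0. Proof. by rewrite /Y psum0 /d /beta bcoef0. Qed.

Let HE (r : R) : 0 <= r -> r < 1 -> Complex (X r) (Y r) = (E r)^-1.
Proof.
move=> r0 r1; apply: (mulIf (expc_neq0 (u r) (v r))); rewrite mulVf ?expc_neq0//.
have h1 : D1 r = D1 0.
  apply: is_derive0_eq => // t /andP[t0 tr]; exact: (dD t0 (le_lt_trans tr r1)).1.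
have h2 : D2 r = D2 0.
  apply: is_derive0_eq => // t /andP[t0 tr]; exact: (dD t0 (le_lt_trans tr r1)).2.
move: h1 h2; rewrite /D1 /D2 !E0 expR0 cos0 sin0 X0 Y0 !mulr1 !mulr0 subr0 addr0 => h1 h2.
apply: ReIm_eq => /=; [by rewrite h1|by rewrite addrC in h2; rewrite addrC h2].
Qed.

Let rn (n : nat) : R := 1 - n.+1%:R^-1.
Let rn01 n : (0 <= rn n) * (rn n < 1).
Proof. by rewrite /rn subr_ge0 invf_le1// ler1n gtrBl invr_gt0. Qed.
Let rn1 : rn n @[n --> \oo] --> (1 : R).
Proof. by rewrite -[X in _ --> X](subr0 1); apply: cvgB; [exact: cvg_cst|exact: cvg_harmonic]. Qed.

Let lim1 (f : nat -> R) K : (forall j, `|f j| * qpoch j <= K) ->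
  psum f (rn n) @[n --> \oo] --> psum f 1.
Proof.
move=> fK; apply/subr_cvg0; apply: norm_cvg0.
have h : K * (1 - rn n) @[n --> \oo] --> (0 : R).
  rewrite -(mulr0 K) -(subrr 1); apply: cvgMr; apply: cvgB; [exact: cvg_cst|exact: rn1].
apply: (@squeeze_cvgr _ _ _ _ (cst 0) _ _ _ _ _ h); last exact: cvg_cst.
apply: nearW => n; rewrite normr_ge0/= distrC; apply: (psum_lip fK).
by rewrite rn01 ltW ?rn01.
Qed.

(** The identity [H = (1 - zeta r)^(- s)] for [r < 1] is carried to [r = 1] along [rn]: the series
    side by [psum_lip], the closed form by continuity, as [p < 1] keeps [1 - zeta] away from 0. *)
Lemma bcoef_sum_expc : let ell1 := ln ((1 - p) ^+ 2 + q ^+ 2) / 2 in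
  let alp1 := atan (q / (1 - p)) in
  ccvg (fun n => Complex (series b n) (series d n))
    (expc (- (Re s * ell1 - Im s * alp1)) (- (Re s * alp1 + Im s * ell1))).
Proof.
move=> ell1 alp1.
have eu : u 1 = Re s * ell1 - Im s * alp1 by rewrite /u /ell /alp /N !mul1r.
have ev : v 1 = Re s * alp1 + Im s * ell1 by rewrite /v /ell /alp /N !mul1r.
have [K K0 hK] := decay.
have cu : u (rn n) @[n --> \oo] --> u 1.
  have := dell (_ : 0 <= 1 <= 1); rewrite ler01 lexx => /(_ isT)/is_derive_continuous h1.
  have := dalp (_ : 0 <= 1 <= 1); rewrite ler01 lexx => /(_ isT)/is_derive_continuous h2.
  by apply: cvgB; apply: cvgMr; apply: continuous_cvg rn1.
have cv : v (rn n) @[n --> \oo] --> v 1.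
  have := dell (_ : 0 <= 1 <= 1); rewrite ler01 lexx => /(_ isT)/is_derive_continuous h1.
  have := dalp (_ : 0 <= 1 <= 1); rewrite ler01 lexx => /(_ isT)/is_derive_continuous h2.
  by apply: cvgD; apply: cvgMr; apply: continuous_cvg rn1.
have HEn n : Complex (X (rn n)) (Y (rn n)) = expc (- u (rn n)) (- v (rn n)).
  by rewrite HE ?rn01// /E expcV.
have cE : ccvg (fun n => expc (- u (rn n)) (- v (rn n))) (expc (- u 1) (- v 1)).
  split => /=; apply: cvgM.
  - by apply: continuous_cvg; [exact: continuous_expR|exact: cvgN].
  - by apply: continuous_cvg; [exact: continuous_cos|exact: cvgN].
  - by apply: continuous_cvg; [exact: continuous_expR|exact: cvgN].
  - by apply: continuous_cvg; [exact: continuous_sin|exact: cvgN].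
have {}cE := ccvg_ext (fun n => esym (HEn n)) cE.
have [c1 c2] := cE.
have kb j : `|b j| * qpoch j <= K by case: (hK j).
have kd j : `|d j| * qpoch j <= K by case: (hK j).
have n1 : `|1 : R| <= 1 by rewrite normr1.
rewrite -eu -ev.
have <- : Complex (X 1) (Y 1) = expc (- u 1) (- v 1).
  apply: ReIm_eq; [exact: (cvg_unique _ (lim1 kb) c1)|exact: (cvg_unique _ (lim1 kd) c2)].
have p1E (f : nat -> R) : pseries f 1 = series f.
  by rewrite /pseries; congr series; apply/funext => j /=; rewrite expr1n mulr1.
split => /=; rewrite -?p1E; [exact: (cvg_psum kb n1)|exact: (cvg_psum kd n1)].
Qed.

End Value.
End BinomialSeries.

(** * Darboux asymptotics *)

Lemma rcvg_ext (R : realType) (u v : nat -> R) (l : R) : u =1 v ->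
  u n @[n --> \oo] --> l -> v n @[n --> \oo] --> l.
Proof. by move=> /funext ->. Qed.

Lemma ccvg_shiftn (R : realType) j (u : nat -> R[i]) x :
  ccvg (fun n => u (n + j)%N) x <-> ccvg u x.
Proof.
have e (v : nat -> R) (l : R) : (v (n + j)%N @[n --> \oo] --> l) = (v n @[n --> \oo] --> l).
  exact: (cvg_shiftn j v (nbhs l)).
by split=> -[h1 h2]; split; move: h1 h2; rewrite ?(e (fun n => complex.Re (u n))) ?(e (fun n => complex.Im (u n))).
Qed.

Section Darboux.
Variables (R : realType) (lam a phi theta : R).
Hypotheses (hl : 1 <= lam) (ht : 0 < theta < pi).
Hypothesis hax : a * cos theta = phi * sin theta.
Local Notation C := R[i].
Local Notation Re := complex.Re.
Local Notation Im := complex.Im.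
Local Notation x := (cos theta).

Let z := expc 0 theta.
Let zb := expc 0 (- theta).
Let s : C := Complex lam (- phi).
Let sb : C := Complex lam phi.
Let c n := bcoef s z n.
(* [c n] and [Y m n] are the coefficients of [(1 - z t) ^ (- s)] and of
   [(1 - z t) ^ (- s) * (1 - zb t) ^ (m - sb)]; for [m = 0] the latter generates the
   Pollaczek polynomials.  For large [m] the factor [(1 - zb t) ^ (m - sb)] is smooth
   on the unit circle and [Y m n / c n] converges by dominated convergence; going back
   to [m = 1] uses that [Y 1] satisfies a first order recurrence up to [O(1/n)]. *)
Let Y m n := cconv (bcoef s z) (bcoef (sb - m%:R) zb) n.

(** [L + i Ar] is the logarithm of [1 - zb * zb], that is of [2 sin theta] times the unit number of
    angle [pi / 2 - theta]; see [wE]. *)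
Let L := ln (2 * sin theta).
Let Ar := pi / 2 - theta.

Let sin0 : 0 < sin theta. Proof. exact: sin_gt0_pi. Qed.

Let zzb : z * zb = 1.
Proof.
rewrite -expcD addr0 subrr; apply: ReIm_eq; rewrite /= expR0 ?cos0 ?trigo.sin0 ?mulr1 ?mulr0//.
Qed.

Let nz : nrm2 z = 1. Proof. by rewrite nrm2_expc mul0rn expR0. Qed.
Let nzb : nrm2 zb = 1. Proof. by rewrite nrm2_expc mul0rn expR0. Qed.

Let zE : z = Complex x (sin theta). Proof. by apply: ReIm_eq; rewrite /= expR0 mul1r. Qed.
Let zbE : zb = Complex x (- sin theta).
Proof. by apply: ReIm_eq; rewrite /= expR0 mul1r ?cosN ?sinN. Qed.

Let c_gt0 n : 0 < nrm2 (c n).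
Proof.
elim: n => [|n IH]; first by rewrite /c bcoef0 /nrm2 /= expr1n expr0n addr0.
have := bcoef_nrm2S s n nz; rewrite -/c => h.
have : 0 < n.+1%:R ^+ 2 * nrm2 (c n.+1).
  rewrite h mulr_gt0// ltr_pwDl ?sqr_ge0// exprn_gt0//= ltr_wpDr//.
  by rewrite (lt_le_trans _ hl).
by rewrite pmulr_rgt0// exprn_gt0.
Qed.

Let c_neq0 n : c n != 0.
Proof. by apply/eqP => h; have := c_gt0 n; rewrite h /nrm2 /= expr0n addr0 ltxx. Qed.

(** From [1 <= lam], the modulus of [s + n] is at least [n + 1]. The resulting bound 1 on the
    modulus of [c (n - j) / c n] is the domination required by [tannery]. *)
Let c_nd m n : (m <= n)%N -> nrm2 (c m) <= nrm2 (c n).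
Proof.
elim: n => [|n IH]; first by rewrite leqn0 => /eqP ->.
rewrite leq_eqVlt => /predU1P[->//|/IH h]; apply: (le_trans h).
have := bcoef_nrm2S s n nz; rewrite -/c => e.
have n1 : 0 < n.+1%:R ^+ 2 :> R by rewrite exprn_gt0.
rewrite -(ler_pM2l n1) e ler_wpM2r ?nrm2_ge0//.
rewrite (@le_trans _ _ ((lam + n%:R) ^+ 2))//; last by rewrite lerDl sqr_ge0.
by rewrite lerXn2r ?nnegrE ?addr_ge0// ?(le_trans ler01 hl)// -nat1r lerD2r.
Qed.

Let real_cvg (r : nat -> R) l : r n @[n --> \oo] --> l ->
  ccvg (fun n => Complex (r n) 0) (Complex l 0).
Proof. by move=> h; split => //=; exact: cvg_cst. Qed.

Let ratio1 : ccvg (fun n => c n / c n.+1) zb.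
Proof.
have e n : (z * (1 + (s - 1) * Complex n.+1%:R^-1 0))^-1 = c n / c n.+1.
  have N0 := natC_neq0 R n.
  have iE : Complex n.+1%:R^-1 0 = n.+1%:R^-1 :> C.
    apply: (mulfI N0); rewrite mulfV// natrC; apply: ReIm_eq; rewrite /= ?mul0r ?mulr0 ?addr0 ?subr0//.
    by rewrite mulfV.
  set W := z * _; have h : c n.+1 = W * c n.
    apply: (mulfI N0); rewrite -/c [LHS]bcoefS /W iE -/(c n) -natr1 in N0 *.
    by field.
  by rewrite -invf_div h mulfK.
apply: (ccvg_ext e).
have -> : zb = (z * (1 + (s - 1) * Complex 0 0))^-1.
  by rewrite mulr0 addr0 mulr1; apply: (mulfI (expc_neq0 0 theta)); rewrite -/z zzb mulfV// expc_neq0.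
apply: ccvgV; first by rewrite mulr0 addr0 mulr1 expc_neq0.
apply: ccvgM; first exact: ccvg_cst.
apply: ccvgD; first exact: ccvg_cst.
apply: ccvgM; first exact: ccvg_cst.
by apply: real_cvg; exact: cvg_harmonic.
Qed.

Let ratioj j : ccvg (fun n => c n / c (n + j)%N) (zb ^+ j).
Proof.
elim: j => [|j IH].
  by apply: (ccvg_ext _ (ccvg_cst 1)) => n; rewrite addn0 divff.
have h1 : ccvg (fun n => c (n + j)%N / c (n + j).+1) zb.
  by apply: (ccvg_shiftn j (fun n => c n / c n.+1) zb).2; exact: ratio1.
rewrite exprSr; apply: (ccvg_ext _ (ccvgM IH h1)) => n.
by rewrite addnS mulrA divfK.
Qed.


Section Tannery.
Variable m : nat.
Hypothesis hm : lam - m%:R <= -5.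
Let E j := bcoef (sb - m%:R) zb j.
Let ReE : Re (sb - m%:R) = lam - m%:R. Proof. by rewrite natrC. Qed.
Let ImE : Im (sb - m%:R) = phi. Proof. by rewrite natrC /= subr0. Qed.

Let T n j := E j * (c (n - j)%N / c n).

Let YT n : Y m n / c n = \sum_(j < n.+1) T n j.
Proof.
rewrite /Y /cconv mulr_suml (reindex_inj rev_ord_inj) /=; apply: eq_bigr => j _.
have jn : (j <= n)%N by rewrite -ltnS.
by rewrite subSS subKn// /T /E /c mulrCA mulrA.
Qed.

Let Tlim j : ccvg (T^~ j) (bcoef (sb - m%:R) (zb * zb) j).
Proof.
rewrite bcoef_scale; apply: ccvgM; first exact: ccvg_cst.
apply: (ccvg_shiftn j (fun n => c (n - j)%N / c n) _).1.
by apply: (ccvg_ext _ (ratioj j)) => n; rewrite addnK.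
Qed.

Let Tle n j : (j <= n)%N -> Num.sqrt (nrm2 (T n j)) <= Num.sqrt (nrm2 (E j)).
Proof.
move=> jn; rewrite ler_wsqrtr// !nrm2M nrm2V ler_piMr ?nrm2_ge0//.
by rewrite ler_pdivrMr// mul1r c_nd// leq_subr.
Qed.

Let Re_sum (F : nat -> C) n : Re (\sum_(j < n) F j) = \sum_(j < n) Re (F j).
Proof.
elim: n => [|n IH]; first by rewrite !big_ord0.
by rewrite !big_ord_recr/= -IH; case: (\sum_(i < n) _) => ? ?; case: (F n).
Qed.
Let Im_sum (F : nat -> C) n : Im (\sum_(j < n) F j) = \sum_(j < n) Im (F j).
Proof.
elim: n => [|n IH]; first by rewrite !big_ord0.
by rewrite !big_ord_recr/= -IH; case: (\sum_(i < n) _) => ? ?; case: (F n).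
Qed.

Let Ar_bound : - (pi / 2) < Ar < pi / 2.
Proof. by rewrite /Ar; move: ht => /andP[h1 h2]; apply/andP; split; lra. Qed.

(** After division by [c n] the [j]-th term of the convolution tends to [E j * zb ^+ j], so the
    limit is the binomial series of [(1 - y)^(m - sb)] at the boundary point [y = zb * zb]. *)
Lemma darboux_shifted : ccvg (fun n => Y m n / c n)
  (expc ((m%:R - lam) * L + phi * Ar) ((m%:R - lam) * Ar - phi * L)).
Proof.
have sumE : cvgn (series (fun j => Num.sqrt (nrm2 (E j)))).
  have ms : Re (sb - m%:R) <= -5 by rewrite ReE.
  have [K K0 hK] := bcoef_decay nzb ms.
  apply: (@cvg_series_tele _ _ K) => j; rewrite ger0_norm ?sqrtr_ge0//.
  have tp : 0 < (j.+1 * j.+2)%:R :> R by rewrite ltr0n.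
  rewrite /tele -natrM ler_pdivlMr// (le_trans _ (hK j))// ler_wpM2l ?sqrtr_ge0//.
  by rewrite /qpoch ler_nat; nia.
have [_ h1] := @tannery R (fun n j => Re (T n j)) _ _
  (fun n j jn => le_trans (normr_Re_le _) (Tle jn)) sumE (fun j => (Tlim j).1).
have [_ h2] := @tannery R (fun n j => Im (T n j)) _ _
  (fun n j jn => le_trans (normr_Im_le _) (Tle jn)) sumE (fun j => (Tlim j).2).
have zbb : zb * zb = Complex (cos (theta *+ 2)) (- sin (theta *+ 2)).
  rewrite /zb -expcD addr0 -opprD -mulr2n; apply: ReIm_eq; rewrite /= expR0 mul1r ?cosN ?sinN//.
have c2 : cos (theta *+ 2) = 1 - sin theta ^+ 2 *+ 2.
  by rewrite cos_mulr2n; have := cos2Dsin2 theta; rewrite !mulr2n; lra.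
have p1 : cos (theta *+ 2) < 1 by rewrite c2 gtrBl pmulrn_lgt0// exprn_gt0.
have ms : Re (sb - m%:R) <= -5 by rewrite ReE.
have [v1 v2] := bcoef_sum_expc (cos2Dsin2 (theta *+ 2)) p1 ms.
rewrite -zbb /= in v1 v2.
suff -> : expc ((m%:R - lam) * L + phi * Ar) ((m%:R - lam) * Ar - phi * L) =
  Complex (limn (series (fun j => Re (bcoef (sb - m%:R) (zb * zb) j))))
          (limn (series (fun j => Im (bcoef (sb - m%:R) (zb * zb) j)))).
  split => /=.
    by apply: rcvg_ext h1 => n /=; rewrite YT Re_sum.
  by apply: rcvg_ext h2 => n /=; rewrite YT Im_sum.
have sn0 := lt0r_neq0 sin0.
have ee : ln ((1 - cos (theta *+ 2)) ^+ 2 + sin (theta *+ 2) ^+ 2) / 2 = L.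
  rewrite (_ : _ + _ = (2 * sin theta) ^+ 2); last first.
    rewrite c2 sin_mulr2n; have := cos2Dsin2 theta; move: (cos theta) (sin theta) => C0 S0 e.
    by transitivity (4 * S0 ^+ 2 * (C0 ^+ 2 + S0 ^+ 2)); [ring|rewrite e; ring].
  by rewrite /L lnXn ?mulr_gt0// -(mulr_natr (ln _)) mulfK.
have aa : atan (sin (theta *+ 2) / (1 - cos (theta *+ 2))) = Ar.
  rewrite -[RHS]tanK//; congr atan.
  rewrite /tan /Ar sinB cosB sin_pihalf cos_pihalf c2 sin_mulr2n.
  rewrite (_ : 1 - (1 - _) = 2 * sin theta * sin theta); last by ring.
  by rewrite !mul0r !mul1r subr0 add0r mulr2n; field; rewrite sn0.
rewrite ee aa ReE ImE in v1 v2.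
rewrite (cvg_lim _ v1)// (cvg_lim _ v2)//.
by rewrite /expc; congr (Complex (expR _ * cos _) (expR _ * sin _)); ring.
Qed.
End Tannery.

Let Y1E j n : Y j.+1 n.+1 = Y j n.+1 - zb * Y j n.
Proof. by rewrite /Y -natr1 opprD addrA cconv_shift. Qed.

Let Y_0 j : Y j 0 = 1. Proof. by rewrite /Y cconv0. Qed.

Variable P : nat -> R.
Hypotheses (P0 : P 0 = 1) (P1 : P 1 = 2 * (lam + a) * x).
Hypothesis PS : forall n, n.+2%:R * P n.+2 =
  2 * (n.+1%:R + lam + a) * x * P n.+1 - (n%:R + 2 * lam) * P n.

Let zs : z * s + zb * sb = Complex (2 * (lam + a) * x) 0.
Proof.
rewrite zE zbE /s /sb; apply: ReIm_eq; rewrite /=; last by ring.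
rewrite (_ : 2 * (lam + a) * x = 2 * lam * x + 2 * (a * x)); last by ring.
by rewrite hax; ring.
Qed.

Let YP n : Y 0 n = Complex (P n) 0.
Proof.
have e0 : sb - 0%:R = sb by rewrite subr0.
suff [] : Y 0 n = Complex (P n) 0 /\ Y 0 n.+1 = Complex (P n.+1) 0 by [].
elim: n => [|n [IH1 IH2]].
  by rewrite Y_0 P0; split => //; rewrite /Y e0 cconv1// zs P1.
split => //; apply: (mulfI (natC_neq0 R n.+1)).
have := cconv_rec s sb zzb n; rewrite -e0 -/(Y 0 _) -/(Y 0 _) -/(Y 0 _) => ->.
rewrite e0 zs IH1 IH2 !natrC zE zbE /s /sb.
by apply: ReIm_eq; rewrite /= ?mul0r ?mulr0 ?subr0 ?addr0 ?add0r ?PS; ring.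
Qed.

Let Y1 n := Y 1 n.
Let Y1P n : Y1 n.+1 = Complex (P n.+1 - x * P n) (sin theta * P n).
Proof. by rewrite /Y1 Y1E !YP zbE; apply: ReIm_eq; rewrite /=; ring. Qed.

(** A zero would make [P n] and [P n.+1] vanish together, and the recurrence run backwards would
    reach [P 0 = 0]. *)
Let Y1_neq0 n : Y1 n.+1 != 0.
Proof.
rewrite Y1P; apply/eqP => -[h1 h2].
have {}h2 : P n = 0 by move/eqP: h2; rewrite mulf_eq0 gt_eqF//= => /eqP.
have {h1} : P n.+1 = 0 by move: h1; rewrite h2 mulr0 subr0.
elim: n h2 => [|n IH] h2 h1; first by move: h2; rewrite P0 => /eqP; rewrite oner_eq0.
apply: (IH _ h2); have /eqP := PS n; rewrite h1 h2 !mulr0 eq_sym subr_eq0 eq_sym mulf_eq0.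
rewrite gt_eqF => [/eqP//|]; rewrite ltr_wpDl// mulr_gt0//.
exact: lt_le_trans hl.
Qed.

Let del n := Complex ((2 * (lam + a - 1) * x * P n.+1 - (2 * lam - 2) * P n) / n.+2%:R) 0 : C.

Let Y1S n : Y1 n.+2 = z * Y1 n.+1 + del n.
Proof.
have n2 : n.+2%:R != 0 :> R by [].
have e : P n.+2 = 2 * x * P n.+1 - P n + Re (del n).
  apply: (mulfI n2); rewrite PS [RHS]mulrDr /= [X in _ = _ + X]mulrCA divff// mulr1.
  have -> : n.+2%:R = n%:R + 2 :> R by rewrite -addn2 natrD.
  by rewrite -natr1; ring.
rewrite !Y1P zE e /del; apply: ReIm_eq; rewrite /=; last by ring.
have := cos2Dsin2 theta; move: (cos theta) (sin theta) => C0 S0 e1.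
set D := _ / n.+2%:R; apply/eqP; rewrite -subr_eq0; apply/eqP.
by transitivity (P n * (C0 ^+ 2 + S0 ^+ 2 - 1)); [ring|rewrite e1 subrr mulr0].
Qed.

(** The imaginary part of [Y1 n.+1] is [sin theta * P n], and with the real part it bounds both
    [P n] and [P n.+1] by multiples of the modulus of [Y1 n.+1]. The denominator [n.+2] in [del]
    then gives relative size [O(1/n)]. *)
Let del_small : nrm2 (del n / Y1 n.+1) @[n --> \oo] --> (0 : R).
Proof.
pose K1 := `|2 * (lam + a - 1) * x|; pose K2 := `|2 * lam - 2|.
pose K := (K1 * (1 + (sin theta)^-1) + K2 / sin theta) ^+ 2.
have inv0 : (n.+1%:R^-1 : R) @[n --> \oo] --> (0 : R) by exact: cvg_harmonic.
have h0 : K * (n.+1%:R^-1 * n.+1%:R^-1) @[n --> \oo] --> (0 : R).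
  rewrite [X in _ --> X](_ : 0 = K * (0 * 0)); last by rewrite !mulr0.
  by apply: cvgMr; exact: (cvgM inv0 inv0).
apply: (@squeeze_cvgr _ _ _ _ (cst 0) _ _ _ _ _ h0); last exact: cvg_cst.
apply: nearW => n; rewrite nrm2_ge0/= nrm2M nrm2V ler_pdivrMr ?nrm2_gt0//.
set r := Num.sqrt (nrm2 (Y1 n.+1)).
have r0 : 0 <= r by exact: sqrtr_ge0.
have rr : nrm2 (Y1 n.+1) = r ^+ 2 by rewrite sqr_sqrtr// nrm2_ge0.
have Pn : `|P n| <= r / sin theta.
  rewrite ler_pdivlMr// mulrC -(gtr0_norm sin0) -normrM.
  by have := normr_Im_le (Y1 n.+1); rewrite -/r Y1P.
have Pn1 : `|P n.+1| <= r * (1 + (sin theta)^-1).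
  have h : `|P n.+1 - x * P n| <= r by have := normr_Re_le (Y1 n.+1); rewrite -/r Y1P.
  rewrite mulrDr mulr1 -[P n.+1](subrK (x * P n)) (le_trans (ler_normD _ _))// lerD//.
  rewrite normrM (le_trans _ Pn)// ler_piMl// ler_norml cos_geN1 cos_le1//.
rewrite rr /del nrm2_real -real_normK ?num_real//.
have -> : K * (n.+1%:R^-1 * n.+1%:R^-1) * r ^+ 2 =
  ((K1 * (1 + (sin theta)^-1) + K2 / sin theta) * r * n.+1%:R^-1) ^+ 2 by rewrite /K; ring.
rewrite lerXn2r ?nnegrE ?mulr_ge0 ?addr_ge0 ?mulr_ge0 ?addr_ge0 ?invr_ge0 ?ler0n ?(ltW sin0) ?normr_ge0//.
rewrite normrM normfV [`|n.+2%:R|]ger0_norm//.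
rewrite ler_pM ?invr_ge0// ?lef_pV2 ?posrE// ?ler_nat//.
rewrite (le_trans (ler_normB _ _))// [leRHS]mulrDl lerD//.
  by rewrite normrM -/K1 -mulrA [_ * r]mulrC ler_wpM2l ?normr_ge0.
by rewrite normrM -/K2 -mulrA [_ * r]mulrC ler_wpM2l ?normr_ge0.
Qed.

Let Y1ratio : ccvg (fun n => Y1 n / Y1 n.+1) zb.
Proof.
apply: (ccvg_shiftn 1 (fun n => Y1 n / Y1 n.+1) zb).1.
have z0 : z != 0 by exact: expc_neq0.
have -> : zb = z^-1 by apply: (mulfI z0); rewrite zzb mulfV.
have h : ccvg (fun n => z + del n / Y1 n.+1) z.
  apply: ccvg_nrm2_0; apply: rcvg_ext del_small => n /=.
  by rewrite addrC addKr.
apply: (ccvg_ext _ (ccvgV z0 h)) => n; rewrite addn1 Y1S.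
by rewrite -[z](mulfK (Y1_neq0 n)) -mulrDl invf_div mulfK.
Qed.

Let w := 1 - zb * zb.
Let wE : w = expc L Ar.
Proof.
rewrite /w zbE /expc /L lnK ?posrE ?mulr_gt0// /Ar cosB sinB sin_pihalf cos_pihalf.
rewrite !mul0r !mul1r subr0 add0r; apply: ReIm_eq; rewrite /=; last by ring.
have := cos2Dsin2 theta; move: (cos theta) (sin theta) => C0 S0 e.
by move: e; rewrite !expr2; lra.
Qed.

(** Raising the shift by one subtracts [zb] times the preceding coefficient, which is asymptotically
    [zb] times the current one; each step multiplies the limit by [w = 1 - zb * zb]. *)
Let Yratio j : ccvg (fun n => Y j.+1 n / Y1 n) (w ^+ j).
Proof.
have hY1 n : Y1 n != 0 by case: n => [|n]; [rewrite /Y1 Y_0 oner_eq0|exact: Y1_neq0].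
elim: j => [|j IH].
  by apply: (ccvg_ext _ (ccvg_cst 1)) => n; rewrite divff.
apply: (ccvg_shiftn 1 (fun n => Y j.+2 n / Y1 n) _).1.
have IH1 := (ccvg_shiftn 1 (fun n => Y j.+1 n / Y1 n) _).2 IH.
have := ccvgB IH1 (ccvgM (ccvg_cst zb) (ccvgM IH Y1ratio)).
have -> : w ^+ j - zb * (w ^+ j * zb) = w ^+ j.+1 by rewrite exprS {3}/w; ring.
apply: ccvg_ext => n; rewrite addn1 [in RHS]Y1E mulrBl; congr (_ - _).
by rewrite -[RHS]mulrA; congr (zb * _); rewrite mulrA divfK.
Qed.

Let bigm : {m : nat | lam - m.+1%:R <= -5}.
Proof.
exists (Num.Def.trunc lam + 5)%N.
have := truncnS_gt lam => h.
rewrite (_ : (_ + 5).+1 = ((Num.Def.trunc lam).+1 + 5)%N)// natrD; lra.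
Qed.

(** Dividing the limit for a large shift by that of [Yratio] brings the shift down to 1. Shift 0 is
    out of reach by ratios, because the real sequence [P] oscillates; at shift 1 the complex
    coefficient contains [P n] and [P n.+1] as a nonvanishing pair. *)
Lemma darboux : ccvg (fun n => Complex (P n.+1 - x * P n) (sin theta * P n) / c n.+1)
  (expc ((1 - lam) * L + phi * Ar) ((1 - lam) * Ar - phi * L)).
Proof.
have [m hm] := bigm.
have h1 := darboux_shifted hm.
have h2 := ccvgV _ (Yratio m).
have w0 : w ^+ m != 0 by rewrite expf_neq0// wE expc_neq0.
have {h2} := ccvgM h1 (h2 w0).
rewrite wE expcX expcV -expcD.
have -> : (m.+1%:R - lam) * L + phi * Ar - m%:R * L = (1 - lam) * L + phi * Ar.
  by rewrite -natr1; ring.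
have -> : (m.+1%:R - lam) * Ar - phi * L - m%:R * Ar = (1 - lam) * Ar - phi * L.
  by rewrite -natr1; ring.
have nz0 : \forall n \near \oo, Y m.+1 n != 0.
  have := cvg_nrm2 (Yratio m) => /(cvgr_gt _).
  move=> /(_ 0 (nrm2_gt0 w0)); apply: filterS => n; apply: contraTneq => ->.
  by rewrite mul0r /nrm2 /= expr0n addr0 ltxx.
move=> h3; have {}h3 : ccvg (fun n => Y1 n / c n) (expc ((1 - lam) * L + phi * Ar) ((1 - lam) * Ar - phi * L)).
  have e : \forall n \near \oo, Y m.+1 n / c n / (Y m.+1 n / Y1 n) = Y1 n / c n.
    by apply: filterS nz0 => n n0; rewrite invf_div mulrC mulrA divfK.
  have [b1 b2] := h3; split.
    by apply: cvg_trans b1; apply: near_eq_cvg; apply: filterS e => n ->.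
  by apply: cvg_trans b2; apply: near_eq_cvg; apply: filterS e => n ->.
have := (ccvg_shiftn 1 (fun n => Y1 n / c n) _).2 h3.
by apply: ccvg_ext => n; rewrite addn1 Y1P.
Qed.

(* Modulus and argument of [c n]. *)
Definition dmod n : R := \prod_(k < n) (Num.sqrt ((lam + k%:R) ^+ 2 + phi ^+ 2) / k.+1%:R).
Definition darg n : R := n%:R * theta - \sum_(k < n) atan (phi / (lam + k%:R)).

Lemma dmod_gt0 n : 0 < dmod n.
Proof.
apply: prodr_gt0 => k _; rewrite divr_gt0// sqrtr_gt0 ltr_pwDl ?sqr_ge0// exprn_gt0//.
by rewrite ltr_wpDr// (lt_le_trans _ hl).
Qed.

Let c_polar n : c n = Complex (dmod n) 0 * expc 0 (darg n).
Proof.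
elim: n => [|n IH].
  rewrite /c bcoef0 /dmod /darg !big_ord0 mul0r subr0.
  by apply: ReIm_eq; rewrite /= expR0 ?cos0 ?trigo.sin0; ring.
have sin_at (t : R) : sin (atan t) = t / Num.sqrt (1 + t ^+ 2).
  have h : cos (atan t) != 0 by rewrite cos_atan invr_eq0 sqrtr_eq0 -ltNge ltr_pwDl ?sqr_ge0.
  by rewrite -cos_atan -[X in X * _](atanK t) /tan divfK.
have N0 := natC_neq0 R n.
apply: (mulfI N0); rewrite /c bcoefS -/(c n) IH.
have l0 : 0 < lam + n%:R by rewrite ltr_wpDr// (lt_le_trans _ hl).
set r := Num.sqrt ((lam + n%:R) ^+ 2 + phi ^+ 2).
have t0 : 0 < 1 + (phi / (lam + n%:R)) ^+ 2 by rewrite ltr_pwDl// sqr_ge0.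
have sr : r = (lam + n%:R) * Num.sqrt (1 + (phi / (lam + n%:R)) ^+ 2).
  rewrite -{1}(gtr0_norm l0) -sqrtr_sqr -sqrtrM ?sqr_ge0//; congr Num.sqrt.
  by field; rewrite lt0r_neq0.
have st0 := lt0r_neq0 (etrans (sqrtr_gt0 _) t0).
have e : s + n%:R = Complex r 0 * expc 0 (- atan (phi / (lam + n%:R))).
  rewrite natrC /s sr; apply: ReIm_eq; rewrite /= expR0 ?cosN ?sinN ?sin_at ?cos_atan.
    by rewrite mul1r mul0r subr0 mulfK.
  rewrite mul0r !addr0 mul1r mulrN; congr (- _); have l1 := lt0r_neq0 l0.
  by move: (lam + n%:R) l1 (Num.sqrt _) st0 => l l1 S S0; field; rewrite l1 S0.
rewrite e.
have -> : darg n.+1 = theta + (- atan (phi / (lam + n%:R))) + darg n.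
  by rewrite /darg big_ord_recr/= -natr1; ring.
rewrite (_ : expc 0 (theta + _ + _) = z * expc 0 (- atan (phi / (lam + n%:R))) * expc 0 (darg n)); last first.
  by rewrite /z -!expcD !addr0.
have -> : Complex (dmod n.+1) 0 = Complex (dmod n) 0 * Complex r 0 / n.+1%:R :> C.
  apply: (mulIf N0); rewrite divfK// natrC /dmod big_ord_recr /=.
  by apply: ReIm_eq; rewrite /= ?mul0r ?mulr0 ?subr0 ?addr0 ?add0r -/r ?mulrA ?divfK.
by field.
Qed.

(** Squared modulus of [darboux]; its numerator is the quadratic form to which [turan] tends after
    rescaling. *)
Lemma darboux_norm :
  (P n.+1 ^+ 2 - 2 * x * P n.+1 * P n + P n ^+ 2) / dmod n.+1 ^+ 2 @[n --> \oo] -->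
  expR (2 * ((1 - lam) * L + phi * Ar)).
Proof.
have h := cvg_nrm2 darboux; rewrite nrm2_expc -mulr_natl in h; apply: rcvg_ext h => n /=.
rewrite nrm2M nrm2V c_polar nrm2M nrm2_real nrm2_expc mul0rn expR0 mulr1; congr (_ / _).
rewrite /nrm2 /=; have := cos2Dsin2 theta; move: (cos theta) (sin theta) => C0 S0 e.
apply/eqP; rewrite -subr_eq0; apply/eqP.
by transitivity (P n ^+ 2 * (C0 ^+ 2 + S0 ^+ 2 - 1)); [ring|rewrite e subrr mulr0].
Qed.

(** Multiplying the error in [darboux] by the unit factor of [c n.+1] preserves its modulus; the
    imaginary part is then the assertion. *)
Lemma darboux_arg :
  P n * sin theta / dmod n.+1 - expR ((1 - lam) * L + phi * Ar) *
     sin (darg n.+1 + ((1 - lam) * Ar - phi * L)) @[n --> \oo] --> (0 : R).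
Proof.
set E := expc ((1 - lam) * L + phi * Ar) ((1 - lam) * Ar - phi * L).
pose u n := Complex (P n.+1 - x * P n) (sin theta * P n) / c n.+1.
have uE : nrm2 (u n - E) @[n --> \oo] --> (0 : R).
  have h := cvg_nrm2 (ccvgB darboux (ccvg_cst E)); rewrite subrr in h.
  by move: h; rewrite {2}/nrm2 /= expr0n addr0.
have h0 : Num.sqrt (nrm2 (u n - E)) @[n --> \oo] --> (0 : R).
  by rewrite -(sqrtr0 R); apply: continuous_cvg uE; exact: sqrt_continuous.
apply: norm_cvg0.
apply: (@squeeze_cvgr _ _ _ _ (cst 0) _ _ _ _ _ h0); last exact: cvg_cst.
apply: nearW => n; rewrite normr_ge0/=.
have -> : Num.sqrt (nrm2 (u n - E)) = Num.sqrt (nrm2 ((u n - E) * expc 0 (darg n.+1))).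
  by rewrite nrm2M nrm2_expc mul0rn expR0 mulr1.
apply: le_trans (normr_Im_le _); rewrite le_eqVlt; apply/orP; left; apply/eqP; congr (`|_|).
rewrite [in RHS]mulrBl -expcD addr0 /u c_polar.
have d0 := lt0r_neq0 (dmod_gt0 n.+1).
have -> : (Complex (P n.+1 - x * P n) (sin theta * P n) / (Complex (dmod n.+1) 0 * expc 0 (darg n.+1))) * expc 0 (darg n.+1) =
  Complex ((P n.+1 - x * P n) / dmod n.+1) (sin theta * P n / dmod n.+1).
  have D0 : Complex (dmod n.+1) 0 != 0 :> C by rewrite eq_complex /= negb_and d0.
  rewrite invfM mulrA divfK ?expc_neq0//; apply: (mulIf D0); rewrite divfK//.
  by apply: ReIm_eq; rewrite /=; field.
rewrite /expc /=; congr (_ - _ * _).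
  by congr (_ / _); rewrite mulrC.
by rewrite addrC.
Qed.

End Darboux.

(** * Pollaczek coefficients *)

Section RealSequences.
Variable R : realType.
Implicit Types (u v : nat -> R) (l m : R).

Lemma rcvgD u v l m : u n @[n --> \oo] --> l -> v n @[n --> \oo] --> m ->
  u n + v n @[n --> \oo] --> l + m.
Proof. by move=> h1 h2; exact: (cvgD h1 h2). Qed.

Lemma rcvgB u v l m : u n @[n --> \oo] --> l -> v n @[n --> \oo] --> m ->
  u n - v n @[n --> \oo] --> l - m.
Proof. by move=> h1 h2; exact: (cvgB h1 h2). Qed.

Lemma rcvgM u v l m : u n @[n --> \oo] --> l -> v n @[n --> \oo] --> m ->
  u n * v n @[n --> \oo] --> l * m.
Proof. by move=> h1 h2; exact: (cvgM h1 h2). Qed.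

Lemma rcvgZ (c : R) u l : u n @[n --> \oo] --> l -> c * u n @[n --> \oo] --> c * l.
Proof. by move=> h; apply: cvgMr. Qed.

Lemma rcvgV u l : l != 0 -> u n @[n --> \oo] --> l -> (u n)^-1 @[n --> \oo] --> l^-1.
Proof. by move=> l0 h; exact: (cvgV l0 h). Qed.

Lemma rcvgS u l : u n @[n --> \oo] --> l -> u n.+1 @[n --> \oo] --> l.
Proof. by move=> h; rewrite (cvg_shiftS u (nbhs l)). Qed.

Lemma rcvg0_bounded u v M : u n @[n --> \oo] --> (0 : R) -> (forall n, `|v n| <= M) ->
  u n * v n @[n --> \oo] --> (0 : R).
Proof.
move=> u0 vM; apply: norm_cvg0.
have h : `|u n| * M @[n --> \oo] --> (0 : R).
  by rewrite -(mul0r M); apply: cvgMl; rewrite -(normr0 R); exact: cvg_norm.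
apply: (@squeeze_cvgr _ _ _ _ (cst 0) _ _ _ _ _ h); last exact: cvg_cst.
by apply: nearW => n; rewrite normr_ge0/= normrM ler_wpM2l.
Qed.

End RealSequences.

Section Coefficients.
Variables (R : realType) (lam a : R).
Hypotheses (hl : 1 <= lam) (ha : 0 <= a).

Definition pu n : R := n%:R + lam + a.
(* The recurrence coefficient of index [n + 1] in the paper, [a_(n+1)]. *)
Definition pA n : R := Num.sqrt (n.+1%:R * (n%:R + 2 * lam) / (pu n * (pu n + 1))) / 2.

Lemma pu_ge n : n.+1%:R <= pu n.
Proof. by rewrite /pu -natr1; move: hl ha; lra. Qed.
Let pu0 n : 0 < pu n. Proof. by apply: lt_le_trans (pu_ge n). Qed.

Lemma pA_sqr n : 4 * pA n ^+ 2 = n.+1%:R * (n%:R + 2 * lam) / (pu n * (pu n + 1)).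
Proof.
have u0 := pu0 n; have n0 : 0 <= n%:R :> R by [].
have u1 : pu n + 1 != 0 by rewrite lt0r_neq0// addr_gt0.
rewrite /pA expr_div_n sqr_sqrtr; first by field; rewrite u1 (lt0r_neq0 u0).
rewrite divr_ge0// ?mulr_ge0// ?addr_ge0//; move: hl u0; lra.
Qed.

Lemma pA_gt0 n : 0 < pA n.
Proof.
have u0 := pu0 n; have n0 : 0 <= n%:R :> R by [].
rewrite /pA divr_gt0// sqrtr_gt0 divr_gt0//; last by rewrite mulr_gt0// addr_gt0.
by rewrite mulr_gt0//; move: hl; lra.
Qed.

Definition pD n : R := 1 - 4 * pA n ^+ 2.

Lemma pDE n : pD n = (2 * a * n%:R + lam * (lam - 1) + 2 * lam * a + a ^+ 2 + a) / (pu n * (pu n + 1)).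
Proof.
have := pu0 n; rewrite /pD pA_sqr -natr1 /pu => h; field.
by rewrite !gt_eqF//; move: hl ha (ler0n R n); lra.
Qed.

Lemma pDeltaE n : 4 * pA n.+1 ^+ 2 - 4 * pA n ^+ 2 =
  2 * (a * (n.+1%:R + lam) + lam * (lam - 1)) / (pu n * (pu n + 1) * (pu n + 2)).
Proof.
have := pu0 n; rewrite !pA_sqr /pu -[n.+2%:R]natr1 -natr1 => h; field.
by rewrite !gt_eqF//; move: hl ha (ler0n R n); lra.
Qed.

Lemma pD_ge0 n : 0 <= pD n.
Proof.
have u0 := pu0 n; have n0 : 0 <= n%:R :> R by [].
rewrite pDE divr_ge0 ?mulr_ge0 ?addr_ge0 ?(ltW u0)// ?mulr_ge0// ?sqr_ge0//; move: hl; lra.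
Qed.

(** Monotonicity of the coefficients rests on [0 <= lam * (lam - 1)], hence on [1 <= lam]. *)
Lemma pDelta_ge0 n : 0 <= 4 * pA n.+1 ^+ 2 - 4 * pA n ^+ 2.
Proof.
have u0 := pu0 n.
have h1 : 0 <= a * (n.+1%:R + lam) by rewrite mulr_ge0// addr_ge0//; move: hl; lra.
have h2 : 0 <= lam * (lam - 1) by rewrite mulr_ge0//; move: hl; lra.
rewrite pDeltaE divr_ge0//; first by rewrite mulr_ge0// addr_ge0.
by rewrite ltW// !mulr_gt0// addr_gt0.
Qed.

Lemma pA_half n : pA n <= 2^-1.
Proof. have := pD_ge0 n; have := pA_gt0 n; rewrite /pD; nra. Qed.

Lemma pA_nd n : pA n <= pA n.+1.
Proof. by have := pDelta_ge0 n; have := pA_gt0 n; have := pA_gt0 n.+1; nra. Qed.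

Lemma pA_ndW m n : (m <= n)%N -> pA m <= pA n.
Proof.
elim: n => [|n IH]; first by rewrite leqn0 => /eqP ->.
by rewrite leq_eqVlt => /predU1P[->//|/IH h]; apply: le_trans h (pA_nd n).
Qed.

Lemma pD_le : exists2 C, 0 <= C & forall n, pD n <= C / n.+1%:R.
Proof.
exists (2 * a + lam * (lam - 1) + 2 * lam * a + a ^+ 2 + a).
  by rewrite !addr_ge0 ?mulr_ge0 ?sqr_ge0//; move: hl; lra.
move=> n; have u1 := pu_ge n; have u0 := pu0 n; have n0 : 0 <= n%:R :> R by [].
have n1 : n.+1%:R = n%:R + 1 :> R by rewrite natr1.
have m0 : 0 < pu n * (pu n + 1) by rewrite mulr_gt0// addr_gt0.
rewrite pDE ler_pdivrMr// [leRHS]mulrAC ler_pdivlMr//.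
rewrite n1 in u1 *; move: (n%:R : R) (pu n) n0 u1 u0 m0 => N u N0 u1 u0 _.
have k0 : 0 <= lam * (lam - 1) + 2 * lam * a + a ^+ 2 + a.
  by rewrite !addr_ge0 ?mulr_ge0 ?sqr_ge0//; move: hl; lra.
set k := lam * _ + _ + _ + _ in k0 *.
have -> : 2 * a * N + lam * (lam - 1) + 2 * lam * a + a ^+ 2 + a = 2 * a * N + k by rewrite /k; ring.
have -> : 2 * a + lam * (lam - 1) + 2 * lam * a + a ^+ 2 + a = 2 * a + k by rewrite /k; ring.
have h1 : 2 * a * N * (N + 1) <= 2 * a * (u * (u + 1)).
  by rewrite -mulrA ler_wpM2l ?mulr_ge0//; nra.
have h2 : k * (N + 1) <= k * (u * (u + 1)) by rewrite ler_wpM2l//; nra.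
lra.
Qed.

Lemma pD_cvg : pD n @[n --> \oo] --> (0 : R).
Proof.
have [C C0 hC] := pD_le.
have h : C * n.+1%:R^-1 @[n --> \oo] --> (0 : R).
  by rewrite -(mulr0 C); apply: cvgMr; exact: cvg_harmonic.
apply: (@squeeze_cvgr _ _ _ _ (cst 0) _ _ _ _ _ h); last exact: cvg_cst.
by apply: nearW => n; rewrite pD_ge0 hC.
Qed.

Lemma pA_cvg : pA n @[n --> \oo] --> (2^-1 : R).
Proof.
apply/subr_cvg0; apply: norm_cvg0.
apply: (@squeeze_cvgr _ _ _ _ (cst 0) _ _ _ _ _ pD_cvg); last exact: cvg_cst.
apply: nearW => n; rewrite normr_ge0/= distrC ger0_norm ?subr_ge0 ?pA_half//.
by rewrite /pD; have := pA_gt0 n; have := pA_half n; nra.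
Qed.

Local Notation q := (tt_poly pA).

(* [ph n * q n] is the Pollaczek polynomial [P_n] with the generating function
   [(1 - z t) ^ (- lam + i phi) * (1 - z^-1 t) ^ (- lam - i phi)]. *)
Definition ph n : R := \prod_(k < n) (2 * pu k * pA k / k.+1%:R).

Lemma ph_gt0 n : 0 < ph n.
Proof. by apply: prodr_gt0 => k _; rewrite divr_gt0// mulr_gt0 ?pA_gt0// mulr_gt0. Qed.

Lemma phS n : n.+1%:R * ph n.+1 = 2 * pu n * pA n * ph n.
Proof. by rewrite /ph big_ord_recr/= mulrCA [X in _ * X]mulrC divfK// mulrC. Qed.

Definition pP x n : R := ph n * (q n).[x].

Lemma horner_ttSS x n : pA n.+1 * (q n.+2).[x] = x * (q n.+1).[x] - pA n * (q n).[x].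
Proof.
have := tt_polySS pA_gt0 n; move: (q n.+2) (q n.+1) (q n) => u v w /(congr1 (horner^~ x)).
by rewrite !(hornerZ, hornerD, hornerN, hornerM, hornerX).
Qed.

Lemma pP0 x : pP x 0 = 1.
Proof. by rewrite /pP /ph big_ord0 mul1r hornerC. Qed.

Lemma pP1 x : pP x 1 = 2 * (lam + a) * x.
Proof.
have h := congr1 (fun p : {poly R} => p.[x]) (tt_poly1 pA_gt0).
rewrite /= hornerZ hornerX in h.
have := phS 0; rewrite mul1r /pP => ->; rewrite /ph big_ord0 mulr1 -mulrA h /pu.
by rewrite add0r.
Qed.

Lemma pPS x n : n.+2%:R * pP x n.+2 =
  2 * (n.+1%:R + lam + a) * x * pP x n.+1 - (n%:R + 2 * lam) * pP x n.
Proof.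
have h := horner_ttSS x n.
rewrite /pP mulrA (phS n.+1) -/(pu n.+1).
have -> : 2 * pu n.+1 * pA n.+1 * ph n.+1 * (q n.+2).[x] =
  2 * pu n.+1 * ph n.+1 * (pA n.+1 * (q n.+2).[x]) by ring.
rewrite h.
have e : n.+1%:R * (2 * pu n.+1 * ph n.+1 * pA n) = n.+1%:R * ((n%:R + 2 * lam) * ph n).
  have -> : n.+1%:R * (2 * pu n.+1 * ph n.+1 * pA n) = 2 * pu n.+1 * pA n * (n.+1%:R * ph n.+1) by ring.
  have -> : pu n.+1 = pu n + 1 by rewrite /pu -natr1; ring.
  have u0 := pu0 n.
  rewrite phS; transitivity (pu n * (pu n + 1) * (4 * pA n ^+ 2) * ph n); first by ring.
  have u1 : pu n + 1 != 0 by rewrite lt0r_neq0// addr_gt0.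
  by rewrite pA_sqr; field; rewrite u1 (lt0r_neq0 u0).
have n1 : n.+1%:R != 0 :> R by [].
have {n1} e := mulfI n1 e.
transitivity (2 * pu n.+1 * x * (ph n.+1 * (q n.+1).[x]) - (2 * pu n.+1 * ph n.+1 * pA n) * (q n).[x]); first by ring.
rewrite e; ring.
Qed.


Section Limit.
Variable theta : R.
Hypothesis ht : 0 < theta < pi.
Let x := cos theta.
Let phi := a * cos theta / sin theta.
Let sn0 : 0 < sin theta. Proof. exact: sin_gt0_pi. Qed.
Let hax : a * cos theta = phi * sin theta. Proof. by rewrite /phi divfK// gt_eqF. Qed.
Let L := ln (2 * sin theta).
Let Aa := (1 - lam) * L + phi * (pi / 2 - theta).
Let d n := dmod lam phi n.+1.
Let d0 n : 0 < d n. Proof. exact: dmod_gt0. Qed.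

Let X n := (pP x n.+1 ^+ 2 - 2 * x * pP x n.+1 * pP x n + pP x n ^+ 2) / d n ^+ 2.

Let Xcvg : X n @[n --> \oo] --> expR (2 * Aa).
Proof. exact: (darboux_norm hl ht hax (pP0 x) (pP1 x) (pPS x)). Qed.

(** [X n] is a convergent sequence and a sum of two squares, one in [P n] and one in
    [P n.+1 - x * P n], so it bounds both scaled values. *)
Let P_bounded : exists M, forall n, `|pP x n / d n| <= M /\ `|pP x n.+1 / d n| <= M.
Proof.
have [B hB] : exists B, forall n, X n <= B.
  have /cvg_seq_bounded[B [_ hB]] : cvgn X by apply/cvg_ex; exists (expR (2 * Aa)); exact: Xcvg.
  exists (B + 1) => n; apply: le_trans (ler_norm _) _; apply: hB => //; rewrite ltrDl//.
have X0 n : sin theta ^+ 2 * (pP x n / d n) ^+ 2 <= X n /\ (pP x n.+1 / d n - x * (pP x n / d n)) ^+ 2 <= X n.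
  have e : X n = (pP x n.+1 / d n - x * (pP x n / d n)) ^+ 2 + sin theta ^+ 2 * (pP x n / d n) ^+ 2.
    have -> : sin theta ^+ 2 = 1 - x ^+ 2 by rewrite sin2cos2.
    by rewrite /X; field; rewrite gt_eqF.
  by rewrite e; split; [rewrite lerDr sqr_ge0|rewrite lerDl mulr_ge0 ?sqr_ge0].
have B0 : 0 <= B by apply: le_trans (hB 0); apply: le_trans (X0 0).2; exact: sqr_ge0.
pose M0 := Num.sqrt B / sin theta.
have bnd n : `|pP x n / d n| <= M0.
  rewrite ler_pdivlMr// -[X in _ * X](gtr0_norm sn0) -normrM -sqrtr_sqr ler_wsqrtr// exprMn mulrC.
  exact: le_trans (X0 n).1 (hB n).
exists (M0 + Num.sqrt B) => n; split; first by rewrite (le_trans (bnd n))// lerDl sqrtr_ge0.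
rewrite -[_ / _](subrK (x * (pP x n / d n))) addrC (le_trans (ler_normD _ _))// lerD//.
  rewrite normrM (le_trans _ (bnd n))// ler_piMl// ler_norml cos_geN1 cos_le1//.
by rewrite -sqrtr_sqr ler_wsqrtr// (le_trans (X0 n).2).
Qed.

Let r n : R := n.+1%:R / pu n.

Let r_cvg : r n @[n --> \oo] --> (1 : R).
Proof.
apply/subr_cvg0; apply: norm_cvg0.
have h : (lam + a) * n.+1%:R^-1 @[n --> \oo] --> (0 : R).
  by rewrite -(mulr0 (lam + a)); apply: cvgMr; exact: cvg_harmonic.
apply: (@squeeze_cvgr _ _ _ _ (cst 0) _ _ _ _ _ h); last exact: cvg_cst.
apply: nearW => n; rewrite normr_ge0/= /r.
have u0 := pu0 n; have u1 := pu_ge n; have n1 : 0 < n.+1%:R :> R by [].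
have -> : n.+1%:R / pu n - 1 = - ((pu n - n.+1%:R) / pu n) by field; rewrite gt_eqF.
rewrite normrN ger0_norm; last by rewrite divr_ge0 ?subr_ge0// ltW.
rewrite ler_pM ?subr_ge0 ?invr_ge0 ?(ltW u0)//; last by rewrite lef_pV2.
by rewrite /pu -natr1; lra.
Qed.

(** In terms of [P], the rescaled [turan] is [r ^ 2 P_(n+1) ^ 2 - 2 x r P_(n+1) P_n + 4 A ^ 2 P_n ^
    2]. As [r] and [4 A ^ 2] tend to 1, it differs from the form in [darboux_norm] by three products
    of a null and a bounded sequence. *)
Lemma turan_ratio : 4 * (turan pA n).[x] * ph n ^+ 2 / dmod lam phi n.+1 ^+ 2 @[n --> \oo] -->
  expR (2 * ((1 - lam) * ln (2 * sin theta) + phi * (pi / 2 - theta))).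
Proof.
have [M hM] := P_bounded.
pose p1 n := pP x n / d n; pose p2 n := pP x n.+1 / d n.
have M0 : 0 <= M by apply: le_trans (hM 0).1.
have hMM n : (`|p1 n * p1 n| <= M * M) * (`|p2 n * p2 n| <= M * M) * (`|p1 n * p2 n| <= M * M).
  by have [h1 h2] := hM n; do !split; rewrite normrM ler_pM.
have z1 : 4 * pA n ^+ 2 - 1 @[n --> \oo] --> (0 : R).
  rewrite -oppr0; apply: (rcvg_ext _ (cvgN pD_cvg)) => n; rewrite /pD /=; ring.
have z2 : r n ^+ 2 - 1 @[n --> \oo] --> (0 : R).
  rewrite -(subrr 1); apply: cvgB; last exact: cvg_cst.
  by rewrite -[X in _ --> X](mulr1 1); under eq_fun do rewrite expr2; exact: (cvgM r_cvg r_cvg).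
have z3 : 2 * x * (1 - r n) @[n --> \oo] --> (0 : R).
  rewrite -(mulr0 (2 * x)) -(subrr 1); apply: cvgMr; apply: cvgB; [exact: cvg_cst|exact: r_cvg].
have c1 := rcvg0_bounded z1 (fun n => (hMM n).1.1).
have c2 := rcvg0_bounded z2 (fun n => (hMM n).1.2).
have c3 := rcvg0_bounded z3 (fun n => (hMM n).2).
have := rcvgD (rcvgD (rcvgD Xcvg c1) c2) c3; rewrite !addr0.
move=> h; apply: rcvg_ext h => n; rewrite /p1 /p2 -/(d n) /X.
have e : pA n * ph n * (q n.+1).[x] = r n / 2 * pP x n.+1.
  have u0 := pu0 n; rewrite /r /pP.
  rewrite [RHS](_ : _ = (n.+1%:R * ph n.+1) * (q n.+1).[x] / (2 * pu n)); last by field; rewrite gt_eqF.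
  by rewrite phS; field; rewrite gt_eqF.
have -> : 4 * (turan pA n).[x] * ph n ^+ 2 =
   4 * ((pA n * ph n * (q n.+1).[x]) ^+ 2 - x * (pA n * ph n * (q n.+1).[x]) * (ph n * (q n).[x])
   + pA n ^+ 2 * (ph n * (q n).[x]) ^+ 2).
  by rewrite horner_turan; field.
rewrite e -/(pP x n); have dn := d0 n; move: (pP x n.+1) (pP x n) (r n) (pA n) (d n) dn => u v w A D D0.
by field; rewrite gt_eqF.
Qed.

End Limit.

(** The part of [dmod ^ 2 / ph ^ 2] that does not depend on the angle; the other part is the Euler
    product [gprod] (see [dmod_sqr]). *)
Definition pb n : R := (\prod_(k < n.+1) ((lam + k%:R) / k.+1%:R)) ^+ 2 / ph n ^+ 2.

Lemma dmod_sqr phi n : dmod lam phi n.+1 ^+ 2 / ph n ^+ 2 = pb n * gprod lam phi n.+1.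
Proof.
have l0 k : 0 < lam + k%:R :> R by rewrite ltr_wpDr// (lt_le_trans ltr01).
rewrite /pb [RHS]mulrAC; congr (_ / _).
rewrite /dmod /gprod -!prodrXl -big_split/=; apply: eq_bigr => k _.
rewrite expr_div_n sqr_sqrtr ?addr_ge0 ?sqr_ge0//.
by field; rewrite gt_eqF//= nat1r.
Qed.

Let pihalf_itv : 0 < (pi / 2 : R) < pi.
Proof. by have := pi_gt0 R; move: (pi : R) => p p0; apply/andP; split; lra. Qed.

Let q0S n : pA n.+1 * (q n.+2).[0] = - (pA n * (q n).[0]).
Proof. by rewrite horner_ttSS mul0r add0r. Qed.

(** At [x = 0] the recurrence reads [A_(n+1) q_(n+2) = - A_n q_n], so increasing coefficients make
    [q_n ^ 2] decrease along each parity. *)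
Let e_le n : (q n).[0] ^+ 2 + (q n.+1).[0] ^+ 2 <= 1.
Proof.
elim: n => [|n IH].
  have h := pP1 0; rewrite mulr0 /pP in h.
  have /eqP := h; rewrite mulf_eq0 gt_eqF ?ph_gt0//= => /eqP ->.
  by rewrite tt_poly0 hornerC expr1n expr0n addr0.
apply: le_trans IH; rewrite addrC lerD2r.
have A1 := pA_gt0 n; have A2 := pA_gt0 n.+1; have A3 := pA_nd n.
have h := q0S n; rewrite -(ler_pM2l (exprn_gt0 2 A2)) -exprMn h sqrrN exprMn.
by rewrite ler_wpM2r ?sqr_ge0// lerXn2r ?nnegrE// ltW.
Qed.

Let S0_cvg : exists2 s : R, 0 < s & (turan pA n).[0] @[n --> \oo] --> s.
Proof.
have nd : nondecreasing_seq (fun n => (turan pA n).[0]).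
  apply/nondecreasing_seqP => n; rewrite turanS//; last exact: pA_gt0.
  rewrite hornerD hornerZ horner_exp lerDl mulr_ge0 ?sqr_ge0// subr_ge0.
  by rewrite lerXn2r ?nnegrE ?(ltW (pA_gt0 _))// pA_nd.
have ub n : (turan pA n).[0] <= 4^-1.
  rewrite horner_turan mul0r mul0r subr0 expr0n mul0r subr0 exprMn -mulrDr addrC.
  have h1 := e_le n; have h2 := pA_half n; have h3 := pA_gt0 n.
  have h4 : pA n ^+ 2 <= 4^-1 by nra.
  by rewrite -[leRHS]mulr1 ler_pM ?addr_ge0 ?sqr_ge0.
have c : cvgn (fun n => (turan pA n).[0]).
  by apply: nondecreasing_is_cvgn => //; exists 4^-1 => _ [n _ <-].
exists (limn (fun n => (turan pA n).[0])) => //.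
apply: (@lt_le_trans _ _ (turan pA 0).[0]); last by apply: nondecreasing_cvgn_le.
by rewrite turan0// ?hornerC ?exprn_gt0 ?pA_gt0//; exact: pA_gt0.
Qed.

Let pb_cvg : exists2 b : R, 0 < b & pb n @[n --> \oo] --> b.
Proof.
have [s s0 hs] := S0_cvg.
have := turan_ratio pihalf_itv; rewrite cos_pihalf mulr0 mul0r.
set E := expR _ => h; have E0 : 0 < E by exact: expR_gt0.
exists (4 * s / E); first by rewrite divr_gt0// mulr_gt0.
have h2 := rcvgM (rcvgZ (c := 4) hs) (rcvgV (lt0r_neq0 E0) h).
apply: rcvg_ext h2 => n.
have g1 : gprod lam 0 n.+1 = 1 by rewrite /gprod big1// => k _; rewrite mul0r expr0n addr0.
have := dmod_sqr 0 n; rewrite g1 mulr1 => <-.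
have t0 : 0 < (turan pA n).[0].
  by apply: (turan_gt0 pA_gt0 pA_nd).
have p0 := ph_gt0 n; have d0 := dmod_gt0 0 hl n.+1.
move: (dmod lam 0 n.+1) (turan pA n).[0] (ph n) d0 t0 p0 => D t p D0 t0 p0.
by field; rewrite !gt_eqF.
Qed.

(* The limit of [pb] does not depend on [theta]; that it is positive is seen at
   [theta = pi / 2], where [turan] is bounded because [q_n ^ 2 + q_(n+1) ^ 2] decreases. *)
Definition pkap : R := limn pb / 4.

Let pbk : pb n @[n --> \oo] --> 4 * pkap.
Proof.
have [b b0 hb] := pb_cvg; rewrite /pkap (cvg_lim _ hb)// mulrC divfK//.
Qed.

Lemma pkap_gt0 : 0 < pkap.
Proof. by have [b b0 hb] := pb_cvg; rewrite /pkap (cvg_lim _ hb)// divr_gt0. Qed.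

Definition pphi theta : R := a * cos theta / sin theta.
(** The limit of [turan] at [cos theta]. Its reciprocal carries the Gamma factor and the exponential
    of the weight; compare [pollaczek_weightE]. *)
Definition pSt theta : R := pkap * (gam lam ^+ 2 / gnorm2 lam (pphi theta)) *
  expR (2 * ((1 - lam) * ln (2 * sin theta) + pphi theta * (pi / 2 - theta))).

Lemma pSt_gt0 theta : 0 < pSt theta.
Proof. by rewrite mulr_gt0 ?expR_gt0// mulr_gt0 ?pkap_gt0// divr_gt0 ?gnorm2_gt0// exprn_gt0// gam_gt0. Qed.

Lemma pSt_cvg theta : 0 < theta < pi -> (turan pA n).[cos theta] @[n --> \oo] --> pSt theta.
Proof.
move=> ht; have h1 := turan_ratio ht; rewrite -/(pphi theta) in h1.
have h3 : gprod lam (pphi theta) n.+1 @[n --> \oo] --> gam lam ^+ 2 / gnorm2 lam (pphi theta).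
  exact: (rcvgS (u := gprod lam (pphi theta)) (@gprod_cvg R lam (pphi theta) hl)).
have := rcvgZ (c := 4^-1) (rcvgM (rcvgM pbk h3) h1).
have -> : 4^-1 * (4 * pkap * (gam lam ^+ 2 / gnorm2 lam (pphi theta)) *
  expR (2 * ((1 - lam) * ln (2 * sin theta) + pphi theta * (pi / 2 - theta)))) = pSt theta.
  by rewrite /pSt; set g := gam lam ^+ 2 / _; field.
move=> h; apply: rcvg_ext h => n; rewrite -dmod_sqr.
have := dmod_gt0 (pphi theta) hl n.+1; have := ph_gt0 n.
by move: (dmod _ _ _) (ph n) => D p p0 D0; field; rewrite !gt_eqF.
Qed.

(** The argument of [c n.+1] plus the argument of the limit in [darboux]. *)
Definition pPsi n theta : R := darg lam (pphi theta) theta n.+1 +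
  ((1 - lam) * (pi / 2 - theta) - pphi theta * ln (2 * sin theta)).

(** The additive error [u] and the convergent amplitude [c] are kept separate, so that both
    boundedness ([pq_bounded]) and the asymptotics ([pf_cvg]) follow from one identity. *)
Let pq_cvg theta : 0 < theta < pi ->
  exists2 u : nat -> R, u n @[n --> \oo] --> (0 : R) &
  exists2 c : nat -> R, c n @[n --> \oo] --> 4 * pSt theta & forall n,
  ((q n).[cos theta] * sin theta) ^+ 2 = (sin (pPsi n theta) + u n) ^+ 2 * c n.
Proof.
move=> ht; have s0 : 0 < sin theta by exact: sin_gt0_pi.
have hax : a * cos theta = pphi theta * sin theta by rewrite /pphi divfK// gt_eqF.
have := darboux_arg hl ht hax (pP0 _) (pP1 _) (pPS _).
set E := expR _; have E0 : 0 < E by exact: expR_gt0.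
set v := (fun n => _) => hv.
exists (fun n => v n / E); first by rewrite -(mul0r E^-1); apply: cvgMl.
have h3 : gprod lam (pphi theta) n.+1 @[n --> \oo] --> gam lam ^+ 2 / gnorm2 lam (pphi theta).
  exact: (rcvgS (u := gprod lam (pphi theta)) (@gprod_cvg R lam (pphi theta) hl)).
exists (fun n => E ^+ 2 * (pb n * gprod lam (pphi theta) n.+1)).
  have -> : 4 * pSt theta = E ^+ 2 * (4 * pkap * (gam lam ^+ 2 / gnorm2 lam (pphi theta))).
    rewrite /pSt (_ : expR (2 * _) = E ^+ 2); first by ring.
    by rewrite expr2 -expRD; congr expR; ring.
  by apply: rcvgZ; apply: rcvgM.
move=> n; rewrite -dmod_sqr /v /pPsi.
have := dmod_gt0 (pphi theta) hl n.+1; have := ph_gt0 n; rewrite /pP.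
by move: (dmod _ _ _) (ph n) => D p p0 D0; field; rewrite !gt_eqF.
Qed.

Lemma pq_bounded theta : 0 < theta < pi -> exists M, forall n, `|(q n).[cos theta]| <= M.
Proof.
move=> ht; have s0 : 0 < sin theta by exact: sin_gt0_pi.
have [u u0 [c hc e]] := pq_cvg ht.
have /cvg_seq_bounded[B [_ hB]] : cvgn u by apply/cvg_ex; exists 0; exact: u0.
have /cvg_seq_bounded[C [_ hC]] : cvgn c by apply/cvg_ex; exists (4 * pSt theta); exact: hc.
have B1 n : `|u n| <= B + 1 by apply: hB => //; rewrite ltrDl.
have C1 n : `|c n| <= C + 1 by apply: hC => //; rewrite ltrDl.
exists (Num.sqrt ((1 + (B + 1)) ^+ 2 * (C + 1)) / sin theta) => n.
have B0 : 0 <= B + 1 by apply: le_trans (B1 0).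
rewrite ler_pdivlMr// -[X in _ * X](gtr0_norm s0) -normrM -sqrtr_sqr ler_wsqrtr// e.
apply: le_trans (ler_norm _) _; rewrite normrM ler_pM// normrX lerXn2r ?nnegrE//; first by rewrite addr_ge0.
by rewrite (le_trans (ler_normD _ _))// lerD// sin_max.
Qed.

(* [pi sin theta] times the density [q_n ^ 2 w] at [cos theta], see [pg_cos]. *)
Definition pf n theta : R := (q n).[cos theta] ^+ 2 * sin theta ^+ 2 / (2 * pSt theta).

Lemma pf_cvg theta : 0 < theta < pi ->
  pf n theta - 2 * sin (pPsi n theta) ^+ 2 @[n --> \oo] --> (0 : R).
Proof.
move=> ht; have s0 : 0 < sin theta by exact: sin_gt0_pi.
have [u u0 [c hc e]] := pq_cvg ht; have S0 := pSt_gt0 theta.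
pose c' n := c n / (4 * pSt theta).
have c1 : c' n - 1 @[n --> \oo] --> (0 : R).
  rewrite -(subrr 1); apply: cvgB; last exact: cvg_cst.
  have S4 : 4 * pSt theta != 0 by rewrite lt0r_neq0// mulr_gt0.
  have := rcvgZ (c := (4 * pSt theta)^-1) hc; rewrite mulVf// => h.
  by apply: rcvg_ext h => n; rewrite mulrC.
have b1 (w : nat -> R) : w n @[n --> \oo] --> (0 : R) ->
   w n * sin (pPsi n theta) @[n --> \oo] --> (0 : R).
  by move=> w0; apply: (rcvg0_bounded (M := 1) w0) => n; exact: sin_max.
have h1 := b1 _ (b1 _ c1).
have u1 : (2 * sin (pPsi n theta) * u n) + u n * u n @[n --> \oo] --> (0 : R).
  have h := rcvgD (rcvgZ (c := 2) (b1 _ u0)) (rcvgM u0 u0); rewrite !mulr0 addr0 in h.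
  by apply: rcvg_ext h => n /=; ring.
have c2 : c' n @[n --> \oo] --> (1 : R).
  apply: (@rcvg_ext _ (fun n => (c' n - 1) + 1)) => [n|]; first by rewrite subrK.
  by rewrite -[X in _ --> X]add0r; apply: rcvgD c1 _; exact: cvg_cst.
have := rcvgZ (c := 2) (rcvgD h1 (rcvgM u1 c2)); rewrite mul0r addr0 mulr0 => h; apply: rcvg_ext h => n.
rewrite /pf -exprMn e /c'; move: (sin _) (u n) (c n) (pSt theta) S0 => s v d S SS.
by field; rewrite gt_eqF.
Qed.

Lemma turan_lt_pSt theta n : 0 < theta < pi -> (turan pA n).[cos theta] <= pSt theta.
Proof.
move=> ht; have h := pSt_cvg ht.
have nd : nondecreasing_seq (fun n => (turan pA n).[cos theta]).
  apply/nondecreasing_seqP => k; rewrite turanS//; last exact: pA_gt0.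
  rewrite hornerD hornerZ horner_exp lerDl mulr_ge0 ?sqr_ge0// subr_ge0.
  by rewrite lerXn2r ?nnegrE ?(ltW (pA_gt0 _))// pA_nd.
rewrite -(cvg_lim _ h)//; apply: nondecreasing_cvgn_le => //.
by apply/cvg_ex; exists (pSt theta).
Qed.

End Coefficients.

(** * Log-sine integrals *)

Section EntropyFunction.
Variable R : realType.
Implicit Types t : R.

(* Since [ln] vanishes on nonpositive reals, [xlnx] is continuous on the whole line. *)
Definition xlnx t : R := t * ln t.

Lemma ln_le_sub1 t : 0 < t -> ln t <= t - 1.
Proof. by move=> t0; rewrite lerBrDl -[leRHS]lnK ?posrE// expR_ge1Dx. Qed.

Lemma xlnx_ge t : 0 <= t -> -1 <= xlnx t.
Proof.
rewrite le_eqVlt /xlnx => /predU1P[<-|t0]; first by rewrite mul0r lerN10.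
have h : ln t^-1 <= t^-1 - 1 by apply: ln_le_sub1; rewrite invr_gt0.
rewrite lnV ?posrE// in h.
have tt : t * t^-1 = 1 by rewrite divff// gt_eqF.
have := ler_wpM2l (ltW t0) h; rewrite mulrBr tt mulr1 mulrN; lra.
Qed.

Lemma xlnx_le t : 0 <= t -> xlnx t <= t ^+ 2.
Proof.
rewrite le_eqVlt /xlnx => /predU1P[<-|t0]; first by rewrite mul0r expr0n.
have h : ln t <= t - 1 by exact: ln_le_sub1.
by rewrite expr2 ler_wpM2l ?ltW//; lra.
Qed.

Lemma continuous_xlnx : continuous xlnx.
Proof.
move=> t; have [t0|t0|->] := ltgtP t 0.
- have h : \forall x \near t, 0 = xlnx x.
    near=> x; rewrite /xlnx ln0 ?mulr0// ltW//; near: x; exact: lt_nbhsl.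
  rewrite /xlnx /continuous_at ln0 ?mulr0 ?ltW//.
  by apply: cvg_trans; [exact: near_eq_cvg h|exact: cvg_cst].
- by apply: cvgM; [exact: cvg_id|exact: continuous_ln].
- rewrite /continuous_at {2}/xlnx mul0r.
  (* [sqr_ln_le] gives [x ^ 2 * ln x ^ 2 <= 4 * (x ^ 3 - 2 x ^ 2 + x)] for positive [x], which
     settles continuity at 0. *)
  have bd x : `|xlnx x| <= Num.sqrt (4 * (`|x| ^+ 3 + `|x|)).
    have [x0|x0] := leP x 0; first by rewrite /xlnx ln0// mulr0 normr0 sqrtr_ge0.
    rewrite -sqrtr_sqr ler_wsqrtr// gtr0_norm// /xlnx exprMn.
    apply: le_trans (ler_wpM2l (sqr_ge0 x) (sqr_ln_le x0)) _.
    rewrite (_ : x ^+ 2 * _ = 4 * (x ^+ 3 + x) - 8 * x ^+ 2); last by field; rewrite gt_eqF.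
    by rewrite gerBl mulr_ge0 ?sqr_ge0.
  apply: norm_cvg0.
  have h : Num.sqrt (4 * (`|x| ^+ 3 + `|x|)) @[x --> (0:R)] --> (0 : R).
    have n0 : `|x| @[x --> (0:R)] --> (0 : R) by have := @norm_continuous _ R (0 : R); rewrite /continuous_at normr0.
    have h1 : 4 * (`|x| ^+ 3 + `|x|) @[x --> (0:R)] --> 4 * (0 * (0 * 0) + 0 : R).
      apply: cvgMr; apply: cvgD; last exact: n0.
      rewrite (_ : (fun x : R => `|x| ^+ 3) = fun x => `|x| * (`|x| * `|x|)); first exact: (cvgM n0 (cvgM n0 n0)).
      by apply/funext => x; rewrite exprS expr2.
    rewrite !mulr0 addr0 mulr0 in h1.
    have h2 := @sqrt_continuous R 0; rewrite /continuous_at sqrtr0 in h2.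
    exact: (cvg_comp _ _ h1 h2).
  apply: (@squeeze_cvgr _ _ _ _ (cst 0) _ _ _ _ _ h); last exact: cvg_cst.
  by apply: nearW => x; rewrite normr_ge0/= bd.
Unshelve. all: by end_near. Qed.

End EntropyFunction.

Section LogSine.
Variable R : realType.
Local Notation mu := (@lebesgue_measure R).

Lemma integrable_oo_cc (f : R -> R) (a b : R) : measurable_fun `[a, b] f ->
  mu.-integrable `]a, b[ (EFin \o f) -> mu.-integrable `[a, b] (EFin \o f).
Proof.
move=> mf /integrableP[mf1 fi]; apply/integrableP; split; first exact/measurable_EFinP.
rewrite integral_itv_bndoo//; apply: measurableT_comp => //.
Qed.

Lemma integrable_cst_oo (a b c : R) : mu.-integrable `]a, b[ (EFin \o (fun _ : R => c)).
Proof.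
have h : mu.-integrable `[a, b] (EFin \o (fun _ : R => c)) by apply: integrable_cc => x _; exact: cvg_cst.
by apply: (integrableS _ _ _ h) => //; exact: subset_itv_oo_cc.
Qed.

Lemma Rintegral_bndoo (f : R -> R) (a b : R) (b0 b1 : bool) : measurable_fun `]a, b[ f ->
  \int[mu]_(x in [set` Interval (BSide b0 a) (BSide b1 b)]) f x = \int[mu]_(x in `]a, b[) f x.
Proof. by move=> mf; rewrite /Rintegral integral_itv_bndoo//; exact/measurable_EFinP. Qed.

Local Notation D := (`]0, pi[%classic : set R).
Let mD : measurable D. Proof. exact: measurable_itv. Qed.
Let p0 : 0 < (pi : R). Proof. exact: pi_gt0. Qed.
Let p2 : 2 <= (pi : R). Proof. exact: pi_ge2. Qed.

Let tcos_le_sin (t : R) : 0 <= t -> t <= pi -> t * cos t <= sin t.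
Proof.
move=> t0 tp; rewrite -subr_ge0.
have [||z zi e] := @MVT_segment R (fun x => sin x - x * cos x) (fun x => x * sin x) 0 t t0.
- by move=> x _; apply: is_derive_eq; rewrite !scale_oE; ring.
- apply: continuous_subspaceT => x; apply: cvgB; first exact: continuous_sin.
  by apply: cvgM; [exact: cvg_id|exact: continuous_cos].
move: zi e; rewrite in_itv/= => /andP[z0 zt]; rewrite sin0 mul0r !subr0 => ->.
have zp := le_trans zt tp.
by rewrite !mulr_ge0// sin_ge0_pi// z0.
Qed.

(** With [u = t / 2], the inequality [u * cos u <= sin u] gives
    [sin t >= 2 u cos^2 u = u (1 + cos t)], which is at least [u] while the cosine is
    nonnegative. *)
Lemma half_le_sin (t : R) : 0 <= t -> t <= pi / 2 -> t / 2 <= sin t.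
Proof.
move=> t0 tp; pose u := t / 2.
have u0 : 0 <= u by rewrite divr_ge0.
have up : u <= pi by rewrite /u; move: p0 tp t0; move: (pi : R) => P; lra.
have e : t = u *+ 2 by rewrite /u -mulr_natr divfK.
have c0 : 0 <= cos t by apply: cos_ge0_pihalf; rewrite tp andbT; move: t0 p0; move: (pi : R) => P; lra.
have cu : 0 <= cos u by apply: cos_ge0_pihalf; move: t0 tp p0; rewrite /u; move: (pi : R) => P ? ? ?; apply/andP; split; lra.
have h := tcos_le_sin u0 up.
have h2 : cos t = 2 * cos u ^+ 2 - 1 by rewrite e cos_mulr2n -mulr_natl.
have h3 : u * cos u * cos u <= sin u * cos u by rewrite ler_wpM2r.
rewrite -/u [X in sin X]e sin_mulr2n -mulr_natr; nra.
Qed.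

(** A lower bound that is a product of linear factors: its logarithm splits into [ln t] and
    [ln (pi - t)], which have explicit primitives. *)
Lemma sin_ge_parabola (t : R) : 0 < t < pi -> t * (pi - t) / (2 * pi) <= sin t.
Proof.
move=> /andP[t0 tp].
have key (x : R) : 0 < x -> x <= pi / 2 -> x * (pi - x) / (2 * pi) <= sin x.
  move=> x0 xp; apply: le_trans (half_le_sin (ltW x0) xp).
  rewrite ler_pdivrMr ?mulr_gt0// mulrAC ler_pdivlMr//.
  by move: x0 xp p0; move: (pi : R) => P x0 xp P0; nra.
have [h|h] := leP t (pi / 2); first exact: key.
have := key (pi - t); rewrite sinB sinpi cospi mul0r sub0r mulN1r opprK subKr [(pi - t) * t]mulrC; apply.
  by rewrite subr_gt0.
by move: h; move: (pi : R) => P; lra.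
Qed.

(** Majorant of [|ln (sin t)|] given by [sin_ge_parabola]; its primitive [G] is written with [xlnx]
    and so stays bounded up to the endpoints. *)
Let g (t : R) : R := ln (2 * pi) - ln t - ln (pi - t).

Let lnsin_le (t : R) : D t -> `|ln (sin t)| <= g t.
Proof.
rewrite /= in_itv/= => /andP[t0 tp]; have tt : 0 < t < pi by rewrite t0.
have s0 := sin_gt0_pi tt.
have l0 : ln (sin t) <= 0 by rewrite ln_le0// sin_le1.
rewrite ler0_norm// /g (_ : _ - _ - _ = - (ln t + ln (pi - t) - ln (2 * pi))); last by ring.
rewrite lerN2 -lnM ?posrE ?subr_gt0//.
rewrite -ln_div ?posrE ?mulr_gt0 ?subr_gt0//.
by rewrite ler_ln ?posrE ?divr_gt0 ?mulr_gt0 ?subr_gt0// sin_ge_parabola.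
Qed.

Let u (n : nat) : R := n.+2%:R^-1.
Let v (n : nat) : R := pi - n.+2%:R^-1.

Let u01 n : 0 < u n <= 2^-1.
Proof. by rewrite /u invr_gt0 ltr0n lef_pV2 ?posrE// ler_nat. Qed.

Let u_cvg : u n @[n --> \oo] --> (0 : R).
Proof. by have h := @cvg_harmonic R; rewrite (cvg_shiftS (@harmonic R) (nbhs (0:R))). Qed.

Let v_cvg : v n @[n --> \oo] --> (pi : R).
Proof. by rewrite -[X in _ --> X](subr0 pi); apply: cvgB; [exact: cvg_cst|exact: u_cvg]. Qed.

Let uv n : u n <= v n.
Proof. by have := u01 n; move: p2; rewrite /v -/(u n); move: (pi : R) (u n) => P U P2 /andP[? ?]; lra. Qed.

Let uvD n (x : R) : u n <= x <= v n -> D x.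
Proof.
move=> /andP[h1 h2]; have /andP[h3 _] := u01 n; rewrite /= in_itv/= (lt_le_trans h3 h1)/=.
by apply: le_lt_trans h2 _; rewrite /v gtrBl.
Qed.

Let Duv (x : R) : D x -> \forall n \near \oo, u n <= x <= v n.
Proof.
rewrite /= in_itv/= => /andP[x0 xp].
near=> n; apply/andP; split; apply: ltW.
  by near: n; apply: cvgr_lt x0; exact: u_cvg.
by near: n; apply: cvgr_gt xp; exact: v_cvg.
Unshelve. all: by end_near. Qed.

Let dxlnx (x : R) : 0 < x -> is_derive x 1 (@xlnx R) (ln x + 1).
Proof.
move=> x0; have h := is_derive1_ln x0; rewrite /xlnx.
by apply: is_derive_eq; rewrite !scale_oE; field; rewrite gt_eqF.
Qed.

Let G (t : R) : R := ln (2 * pi) * t + (t - xlnx t) + (xlnx (pi - t) - (pi - t)).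

Let dG (x : R) : D x -> is_derive x 1 G (g x).
Proof.
rewrite /= in_itv/= => /andP[x0 xp]; have h1 := dxlnx x0.
have y0 : 0 < pi - x by rewrite subr_gt0.
have dy : is_derive x 1 (fun t : R => pi - t) (-1) by apply: is_derive_eq; rewrite ?scale_oE; ring.
have h2 : is_derive x 1 (fun t : R => xlnx (pi - t)) ((ln (pi - x) + 1) * -1).
  exact: (@is_derive1_comp R (@xlnx R) (fun t => pi - t) x _ _ (dxlnx y0) dy).
by rewrite /G /g; apply: is_derive_eq; rewrite !scale_oE; ring.
Qed.

Let cg (x : R) : D x -> {for x, continuous g}.
Proof.
rewrite /= in_itv/= => /andP[x0 xp].
apply: cvgB; first by apply: cvgB; [exact: cvg_cst|exact: continuous_ln].
apply: continuous_comp; last by apply: continuous_ln; rewrite subr_gt0.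
by apply: cvgB; [exact: cvg_cst|exact: cvg_id].
Qed.

Let ig : mu.-integrable D (EFin \o g).
Proof.
apply: (@integrable_FTC_improper R D g G u v uv uvD Duv dG cg (4 * (ln (2 * pi) * pi + pi + 1 + pi ^+ 2 + pi))).
- by move=> n m nm; rewrite /u lef_pV2 ?posrE ?ltr0n// ler_nat.
- by move=> n m nm; rewrite /v lerD2l lerN2 lef_pV2 ?posrE ?ltr0n// ler_nat.
- by move=> x /lnsin_le; apply: le_trans.
have L0 : 0 <= ln (2 * pi : R).
  by apply: ln_ge0; move: p2; move: (pi : R) => P; lra.
have key (t : R) : 0 <= t -> t <= pi -> `|G t| <= 2 * (ln (2 * pi) * pi + pi + 1 + pi ^+ 2 + pi).
  move=> t0 tp; have s0 : 0 <= pi - t by rewrite subr_ge0.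
  have a1 := xlnx_ge t0; have a2 := xlnx_le t0; have a3 := xlnx_ge s0; have a4 := xlnx_le s0.
  have b1 : t ^+ 2 <= pi ^+ 2 by rewrite lerXn2r ?nnegrE ?(ltW p0).
  have b2 : (pi - t) ^+ 2 <= pi ^+ 2 by rewrite lerXn2r ?nnegrE ?(ltW p0)// lerBlDr lerDl.
  have b3 : 0 <= ln (2 * pi) * t by rewrite mulr_ge0.
  have b4 : ln (2 * pi) * t <= ln (2 * pi) * pi by rewrite ler_wpM2l.
  rewrite /G ler_norml; move: (sqr_ge0 (pi : R)) a1 a2 a3 a4 b1 b2 b3 b4 p0.
  move: (ln (2 * pi) * t) (ln (2 * pi) * pi) (xlnx t) (xlnx (pi - t)) (t ^+ 2) ((pi - t) ^+ 2) (pi ^+ 2).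
  move: t0 tp s0; move: (pi : R) => P *; apply/andP; split; lra.
move=> n; have /andP[n0 n1] := u01 n.
have h1 : `|G (v n)| <= _ := key _ _ _.
have h2 : `|G (u n)| <= _ := key _ _ _.
apply: le_trans (ler_norm _) _; apply: le_trans (ler_normB _ _) _.
have v0 : 0 <= v n by apply: le_trans (uv n); exact: ltW.
have vp : v n <= pi by rewrite /v gerBl ltW.
have up : u n <= pi by apply: le_trans (uv n) vp.
have := lerD (key _ v0 vp) (key _ (ltW n0) up); lra.
Qed.

Lemma measurable_ln_sin (E : set R) : measurable_fun E (fun t : R => ln (sin t)).
Proof.
apply: measurable_funTS; apply: measurableT_comp; first exact: measurable_ln.
by apply: continuous_measurable_fun; exact: continuous_sin.
Qed.

Lemma integrable_ln_sin : mu.-integrable D (EFin \o (fun t : R => ln (sin t))).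
Proof. apply: (integrable_dom mD _ lnsin_le ig); exact: measurable_ln_sin. Qed.

Let isin : mu.-integrable `[0, pi] (EFin \o (fun t : R => ln (sin t))).
Proof. by apply: integrable_oo_cc integrable_ln_sin; exact: measurable_ln_sin. Qed.

Let F (x : R) : R := \int[mu]_(t in `[0, x]) ln (sin t).

Let dF (x : R) : D x -> is_derive x 1 F (ln (sin x)).
Proof.
move=> Dx; move: (Dx); rewrite /= in_itv/= => /andP[x0 xp].
have c : {for x, continuous (fun t : R => ln (sin t))}.
  apply: continuous_comp; first exact: continuous_sin.
  by apply: continuous_ln; rewrite sin_gt0_pi// x0.
have [d1 d2] := continuous_FTC1_closed xp isin x0 c.
by apply: (DeriveDef d1); rewrite -derive1E; exact: d2.
Qed.

Let F_cvg : [/\ F (u n) @[n --> \oo] --> (0 : R), F (2 * u n) @[n --> \oo] --> (0 : R),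
   F (pi / 2 - u n) @[n --> \oo] --> F (pi / 2) & F (pi - 2 * u n) @[n --> \oo] --> F pi].
Proof.
have := parameterized_integral_continuous (ltW p0) isin.
move=> /(continuous_within_itvP _ p0)[h1 h2 h3].
have F0 : F 0 = 0 by rewrite /F set_itv1 Rintegral_set1.
have u2 : 2 * u n @[n --> \oo] --> (0 : R) by rewrite -(mulr0 2); apply: cvgMr; exact: u_cvg.
move/cvg_at_rightP : h2 => h2; move/cvg_at_leftP : h3 => h3.
split.
- rewrite -F0; apply: h2; split => [n|]; last exact: u_cvg.
  by have /andP[] := u01 n.
- rewrite -F0; apply: h2; split => [n|]; last exact: u2.
  by have /andP[h _] := u01 n; rewrite mulr_gt0.
- apply: continuous_cvg.
    apply: (is_derive_continuous (dF _)).
    by rewrite /= in_itv/= divr_gt0//=; move: p0; move: (pi : R) => P; lra.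
  by rewrite -[X in _ --> X](subr0 (pi / 2)); apply: cvgB; [exact: cvg_cst|exact: u_cvg].
- apply: h3; split => [n|].
    by have /andP[h _] := u01 n; rewrite gtrBl mulr_gt0.
  by rewrite -[X in _ --> X](subr0 pi); apply: cvgB; [exact: cvg_cst|exact: u2].
Qed.

(** Reflection [t -> pi - t] makes [F x + F (pi - x)] constant. The derivative exists only in the
    open interval, so the endpoint values are reached along [2 * u n]. *)
Let F_sym : F pi = 2 * F (pi / 2).
Proof.
have [c1 c2 c3 c4] := F_cvg.
pose K (x : R) : R := F x + F (pi - x).
have dK n x : 2 * u n <= x <= pi / 2 -> is_derive x 1 K 0.
  move=> /andP[h1 h2]; have /andP[n0 n1] := u01 n.
  have x0 : 0 < x by apply: lt_le_trans h1; rewrite mulr_gt0.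
  have xp : x < pi by move: h2 p0; move: (pi : R) => P; lra.
  have Dx : D x by rewrite /= in_itv/= x0.
  have Dy : D (pi - x) by rewrite /= in_itv/= subr_gt0 xp gtrBl.
  have d1 := dF Dx; have d2 := dF Dy.
  have dy : is_derive x 1 (fun t : R => pi - t) (-1) by apply: is_derive_eq; rewrite ?scale_oE; ring.
  have d3 : is_derive x 1 (fun t : R => F (pi - t)) (ln (sin (pi - x)) * -1).
    exact: (@is_derive1_comp R F (fun t => pi - t) x _ _ d2 dy).
  rewrite /K; apply: is_derive_eq; rewrite sinB sinpi cospi; set s := sin x.
  by rewrite mul0r sub0r mulN1r opprK; ring.
have u2 : 2 * u n @[n --> \oo] --> (0 : R) by rewrite -(mulr0 2); apply: cvgMr; exact: u_cvg.
have near_le : \forall n \near \oo, K (2 * u n) = K (pi / 2).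
  have h : \forall n \near \oo, 2 * u n <= pi / 2 by apply: (cvgr_le _ u2); rewrite divr_gt0.
  by apply: filterS h => n h; apply/esym/is_derive0_eq => // x; exact: dK.
have k1 : K (2 * u n) @[n --> \oo] --> 0 + F pi by apply: cvgD.
have k2 : K (2 * u n) @[n --> \oo] --> K (pi / 2).
  by apply: cvg_near_cst; apply: filterS near_le => n ->.
have e : 0 + F pi = K (pi / 2) by exact: (cvg_unique _ k1 k2).
rewrite add0r in e; rewrite e.
rewrite /K (_ : pi - pi / 2 = pi / 2); last by field.
by rewrite mulr_natl mulr2n.
Qed.

(* With [F] a primitive of [ln (sin t)], the duplication formula for the sine makes [K]
   constant, and [F_sym] then gives [F pi = - pi ln 2]. *)
Lemma Rintegral_ln_sin : \int[mu]_(t in D) ln (sin t) = - (pi * ln 2).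
Proof.
have [c1 c2 c3 c4] := F_cvg.
pose K (x : R) : R := F (2 * x) - 2 * ln 2 * x - 2 * F x + 2 * F (pi / 2 - x).
have dK n x : u n <= x <= pi / 2 - u n -> is_derive x 1 K 0.
  move=> /andP[h1 h2]; have /andP[n0 n1] := u01 n.
  have x0 : 0 < x by apply: lt_le_trans h1.
  have xp : x < pi / 2 by apply: le_lt_trans h2 _; rewrite gtrBl.
  have x2p : 2 * x < pi by move: xp; move: (pi : R) => P; lra.
  have Dx : D x by rewrite /= in_itv/= x0; move: x2p x0; move: (pi : R) => P; lra.
  have D2 : D (2 * x) by rewrite /= in_itv/= mulr_gt0.
  have Dy : D (pi / 2 - x) by rewrite /= in_itv/= subr_gt0 xp; move: x0 p0; move: (pi : R) => P; lra.
  have d1 := dF Dx; have d2 := dF D2; have d3 := dF Dy.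
  have dy : is_derive x 1 (fun t : R => pi / 2 - t) (-1) by apply: is_derive_eq; rewrite ?scale_oE; ring.
  have dz : is_derive x 1 (fun t : R => 2 * t) 2 by apply: is_derive_eq; rewrite ?scale_oE; ring.
  have d4 : is_derive x 1 (fun t : R => F (pi / 2 - t)) (ln (sin (pi / 2 - x)) * -1).
    exact: (@is_derive1_comp R F (fun t => pi / 2 - t) x _ _ d3 dy).
  have d5 : is_derive x 1 (fun t : R => F (2 * t)) (ln (sin (2 * x)) * 2).
    exact: (@is_derive1_comp R F (fun t => 2 * t) x _ _ d2 dz).
  have s0 : 0 < sin x by apply: sin_gt0_pi; move: Dx; rewrite /= in_itv.
  have c0 : 0 < cos x by apply: cos_gt0_pihalf; rewrite xp andbT; move: x0 p0; move: (pi : R) => P; lra.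
  have e1 : ln (sin (2 * x)) = ln 2 + ln (sin x) + ln (cos x).
    rewrite mulr_natl sin_mulr2n -mulr_natl -lnM ?posrE// -lnM ?posrE ?mulr_gt0//; congr ln; ring.
  have e2 : sin (pi / 2 - x) = cos x by rewrite sinB sin_pihalf cos_pihalf mul1r mul0r subr0.
  by rewrite /K; apply: is_derive_eq; rewrite !scale_oE e1 e2; ring.
have near_le : \forall n \near \oo, K (u n) = K (pi / 2 - u n).
  have h : \forall n \near \oo, u n <= pi / 4 by apply: (cvgr_le _ u_cvg); rewrite divr_gt0.
  apply: filterS h => n h; apply/esym; apply: (is_derive0_eq _ (dK n)).
  by move: h; move: (pi : R) => P; lra.
have k1 : K (u n) @[n --> \oo] --> 0 - 2 * ln 2 * 0 - 2 * 0 + 2 * F (pi / 2).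
  apply: cvgD; last exact: cvgMr.
  apply: cvgB; last exact: cvgMr.
  by apply: cvgB => //; apply: cvgMr; exact: u_cvg.
have hu : pi / 2 - u n @[n --> \oo] --> (pi / 2 - 0 : R).
  by apply: cvgB; [exact: cvg_cst|exact: u_cvg].
have k2 : K (pi / 2 - u n) @[n --> \oo] --> F pi - 2 * ln 2 * (pi / 2 - 0) - 2 * F (pi / 2) + 2 * 0.
  apply: cvgD.
    apply: cvgB; last exact: cvgMr.
    apply: cvgB; last exact: cvgMr.
    have -> : (fun n => F (2 * (pi / 2 - u n))) = fun n => F (pi - 2 * u n).
      by apply/funext => n; congr F; field.
    exact: c4.
  apply: cvgMr.
  have -> : (fun n => F (pi / 2 - (pi / 2 - u n))) = fun n => F (u n).
    by apply/funext => n; congr F; ring.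
  exact: c1.
have k3 : K (u n) @[n --> \oo] --> F pi - 2 * ln 2 * (pi / 2 - 0) - 2 * F (pi / 2) + 2 * 0.
  by apply: cvg_trans k2; apply: near_eq_cvg; apply: filterS near_le => n ->.
have e : 0 - 2 * ln 2 * 0 - 2 * 0 + 2 * F (pi / 2) =
  F pi - 2 * ln 2 * (pi / 2 - 0) - 2 * F (pi / 2) + 2 * 0 by exact: (cvg_unique _ k1 k3).
have <- : F pi = \int[mu]_(t in D) ln (sin t).
  by rewrite /F Rintegral_bndoo//; exact: measurable_ln_sin.
by move: e F_sym; move: (F pi) (F (pi / 2)) => A B; move: (ln 2 : R) (pi : R) => l P; lra.
Qed.

(** Primitive of [cos (2 t) * ln (sin t)] found by parts; writing [sin t * ln (sin t)] as
    [xlnx (sin t)] makes it continuous at both endpoints. *)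
Let H (t : R) : R := cos t * xlnx (sin t) - t / 2 - sin t * cos t / 2.

Lemma Rintegral_cos2_ln_sin :
  mu.-integrable D (EFin \o (fun t : R => cos (t *+ 2) * ln (sin t))) /\
  \int[mu]_(t in D) (cos (t *+ 2) * ln (sin t)) = - (pi / 2).
Proof.
have ci (x : R) : D x -> {for x, continuous (fun t : R => cos (t *+ 2) * ln (sin t))}.
  rewrite /= in_itv/= => hx; apply: cvgM.
    apply: (continuous_comp (f := fun t : R => t *+ 2)); last exact: continuous_cos.
    rewrite (_ : (fun t : R => t *+ 2) = fun t => t + t); last by apply/funext => t; rewrite mulr2n.
    by apply: cvgD; exact: cvg_id.
  apply: continuous_comp; first exact: continuous_sin.
  by apply: continuous_ln; rewrite sin_gt0_pi.
have ii : mu.-integrable D (EFin \o (fun t : R => cos (t *+ 2) * ln (sin t))).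
  apply: (integrable_dom mD (g := fun t => `|ln (sin t)|)).
  - by apply: continuous_on_measurable => //; exact: interval_open.
  - by move=> x Dx; rewrite normrM ler_piMl// cos_max.
  - exact: (integrable_norm integrable_ln_sin).
split => //.
have dH (x : R) : D x -> is_derive x 1 H (cos (x *+ 2) * ln (sin x)).
  rewrite /= in_itv/= => hx; have s0 := sin_gt0_pi hx.
  have h1 : is_derive x 1 (fun t : R => xlnx (sin t)) ((ln (sin x) + 1) * cos x).
    exact: (@is_derive1_comp R (@xlnx R) (@sin R) x _ _ (dxlnx s0) (is_derive_sin x)).
  rewrite /H; apply: is_derive_eq; rewrite !scale_oE cos_mulr2n /xlnx -mulr_natl.
  have := cos2Dsin2 x; move: (cos x) (sin x) (ln _) => c s l e.
  have es : s * s = 1 - c * c by rewrite -e; ring.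
  apply/eqP; rewrite -subr_eq0; apply/eqP.
  transitivity ((1 - c ^+ 2 - s ^+ 2) * (l - 1 / 2)); last by rewrite -addrA -opprD e subrr mul0r.
  by field.
apply: (@Rintegral_FTC_improper R D _ H u v mD uv uvD Duv dH ci) => //.
have cH : continuous H.
  move=> x; apply: cvgB; last first.
    apply: cvgMl; apply: cvgM; [exact: continuous_sin|exact: continuous_cos].
  apply: cvgB; last by apply: cvgMl; exact: cvg_id.
  apply: cvgM; first exact: continuous_cos.
  by apply: continuous_comp; [exact: continuous_sin|exact: continuous_xlnx].
have -> : - (pi / 2) = H pi - H 0.
  by rewrite /H sinpi sin0 cospi /xlnx !mul0r !mulr0 !subr0; ring.
by apply: cvgB; [apply: (continuous_cvg _ (cH pi)); exact: v_cvg|apply: (continuous_cvg _ (cH 0)); exact: u_cvg].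
Qed.

Lemma Rintegral_sin2 : \int[mu]_(t in `[0, pi]) (2 * sin t ^+ 2) = pi.
Proof.
pose K (t : R) : R := t - sin t * cos t.
have dK (x : R) : 0 <= x <= pi -> is_derive x 1 K (2 * sin x ^+ 2).
  move=> _; rewrite /K; apply: is_derive_eq; rewrite !scale_oE.
  have := cos2Dsin2 x; move: (cos x) (sin x) => c s e.
  apply/eqP; rewrite -subr_eq0; apply/eqP.
  transitivity (1 - (c ^+ 2 + s ^+ 2)); last by rewrite e subrr.
  by ring.
rewrite (Rintegral_FTC (ltW p0) dK); first by rewrite /K sinpi sin0 !mul0r !subr0.
move=> x _; apply: cvgMr; rewrite expr2; under eq_fun do rewrite expr2.
by apply: cvgM; exact: continuous_sin.
Qed.

(** By [2 sin^2 t = 1 - cos (2 t)], the integrand is [ln 2 * 2 sin^2 t + 2 ln (sin t) - 2 cos (2 t)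
    ln (sin t)], with integrals [pi ln 2], [- 2 pi ln 2] and [pi]. *)
Lemma Rintegral_xlnx_sin2 : \int[mu]_(t in `[0, pi]) xlnx (2 * sin t ^+ 2) = pi * (1 - ln 2).
Proof.
have c2 : continuous (fun t : R => 2 * sin t ^+ 2).
  move=> x; apply: cvgMr; rewrite expr2; under eq_fun do rewrite expr2.
  by apply: cvgM; exact: continuous_sin.
have cm : continuous (fun t : R => xlnx (2 * sin t ^+ 2)).
  by move=> x; apply: (continuous_comp (f := fun t : R => 2 * sin t ^+ 2)); [exact: c2|exact: continuous_xlnx].
rewrite Rintegral_bndoo; last by apply: measurable_funTS; exact: continuous_measurable_fun.
have [i3 e3] := Rintegral_cos2_ln_sin.
have i1 : mu.-integrable D (EFin \o (fun t : R => ln 2 * (2 * sin t ^+ 2))).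
  apply: integrable_scale => //.
  have h : mu.-integrable `[0, pi] (EFin \o (fun t : R => 2 * sin t ^+ 2)) by apply: integrable_cc => x _; exact: c2.
  by apply: (integrableS _ _ _ h) => //; exact: subset_itv_oo_cc.
have i2 : mu.-integrable D (EFin \o (fun t : R => 2 * ln (sin t))).
  by apply: integrable_scale => //; exact: integrable_ln_sin.
have i3' : mu.-integrable D (EFin \o (fun t : R => 2 * (cos (t *+ 2) * ln (sin t)))).
  exact: integrable_scale.
rewrite (_ : \int[mu]_(x in _) _ = \int[mu]_(t in D) ((ln 2 * (2 * sin t ^+ 2) + 2 * ln (sin t)) - 2 * (cos (t *+ 2) * ln (sin t)))); last first.
  apply: eq_Rintegral => t; rewrite inE/= in_itv/= => ht; have s0 := sin_gt0_pi ht.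
  rewrite /xlnx lnM ?posrE ?exprn_gt0// lnXn// cos_mulr2n.
  have := cos2Dsin2 t; move: (cos t) (sin t) (ln (sin t)) (ln 2) => c s l l2 e.
  have -> : c ^+ 2 = 1 - s ^+ 2 by rewrite -e; ring.
  by ring.
rewrite (@RintegralB _ _ R mu D _ _ mD (integrable_add mD i1 i2) i3').
rewrite (@RintegralD _ _ R mu D _ _ mD i1 i2).
have is2 : mu.-integrable D (EFin \o (fun t : R => 2 * sin t ^+ 2)).
  have h : mu.-integrable `[0, pi] (EFin \o (fun t : R => 2 * sin t ^+ 2)) by apply: integrable_cc => x _; exact: c2.
  by apply: (integrableS _ _ _ h) => //; exact: subset_itv_oo_cc.
rewrite (@RintegralZl _ _ R mu D _ (ln 2) mD is2) (@RintegralZl _ _ R mu D _ 2 mD integrable_ln_sin).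
rewrite (@RintegralZl _ _ R mu D _ 2 mD i3).
rewrite e3 Rintegral_ln_sin -(@Rintegral_bndoo _ _ _ true false) ?Rintegral_sin2; last first.
  by apply: measurable_funTS; exact: continuous_measurable_fun.
by field.
Qed.

End LogSine.

(** * Equidistribution of the phase *)

Section Equidistribution.
Variable R : realType.
Local Notation mu := (@lebesgue_measure R).
Let p0 : 0 < (pi : R). Proof. exact: pi_gt0. Qed.

Lemma fine_measure_cc (a b : R) : a <= b -> fine (mu `[a, b]) = b - a.
Proof.
move=> ab; rewrite [X in fine X]lebesgue_measure_itv/= lte_fin.
by case: ltgtP ab => // -> _; rewrite subrr.
Qed.

Lemma Rintegral_bound (f : R -> R) (a b M : R) : a <= b ->
  (forall x, a <= x <= b -> {for x, continuous f}) ->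
  (forall x, a <= x <= b -> `|f x| <= M) ->
  `|\int[mu]_(x in `[a, b]) f x| <= M * (b - a).
Proof.
move=> ab cf fM; have mI : measurable (`[a, b]%classic : set R) by exact: measurable_itv.
have fi := integrable_cc cf.
have h0 := @le_normr_Rintegral _ _ R mu _ _ mI fi.
apply: le_trans h0 _.
have ci : mu.-integrable `[a, b] (EFin \o (fun _ : R => M)) by apply: integrable_cc => x _; exact: cvg_cst.
have h1 : \int[mu]_(x in `[a, b]) `|f x| <= \int[mu]_(x in `[a, b]) M.
  apply: (@le_Rintegral _ _ R mu _ _ _ mI (integrable_norm fi) ci) => x.
  by rewrite /= in_itv/=; exact: fM.
apply: le_trans h1 _.
by rewrite Rintegral_cst// fine_measure_cc.
Qed.

Section Primitive.
Variables (G : R -> R) (m : R).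
Hypothesis cG : continuous G.
Hypothesis perG : forall u, G (u + pi) = G u.
Hypothesis meanG : \int[mu]_(u in `[0, pi]) G u = pi * m.

Let g u := G u - m.
Let cg (u : R) : {for u, continuous g}. Proof. by apply: cvgB; [exact: cG|exact: cvg_cst]. Qed.
(** The base point [-1] makes [H] differentiable at 0 as well, so that the period [[0, pi]] can be
    treated as a closed interval. *)
Let H (u : R) : R := \int[mu]_(t in `[-1, u]) g t.

Let dH (u : R) : -1 < u -> is_derive u 1 H (g u).
Proof.
move=> u1; have uu : u < u + 1 by rewrite ltrDl.
have i : mu.-integrable `[-1, u + 1] (EFin \o g) by apply: integrable_cc => x _; exact: cg.
have [d1 d2] := continuous_FTC1_closed uu i u1 (@cg u).
by apply: (DeriveDef d1); rewrite -derive1E; exact: d2.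
Qed.

(** Periodicity of the primitive is the vanishing of the mean of [G - m] over one period. *)
Let H_per (u : R) : 0 <= u -> H (u + pi) = H u.
Proof.
move=> u0; pose K (x : R) := H (x + pi) - H x.
have dK (x : R) : 0 <= x <= u -> is_derive x 1 K 0.
  move=> /andP[x0 _].
  have x1 : -1 < x by apply: lt_le_trans x0.
  have y1 : -1 < x + pi by apply: lt_trans x1 _; rewrite ltrDl.
  have dy : is_derive x 1 (fun t : R => t + pi) 1 by apply: is_derive_eq; rewrite addr0.
  have d1 := @is_derive1_comp R H (fun t => t + pi) x _ _ (dH y1) dy.
  have d2 := dH x1; rewrite /K.
  have -> : (fun x => H (x + pi) - H x) = ((H \o (fun t => t + pi)) - H) by [].
  by apply: is_derive_eq; rewrite /g perG; ring.
have := is_derive0_eq u0 dK; rewrite /K => h.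
have {h} : H (u + pi) - H u = 0.
  rewrite h add0r.
  have dH' (x : R) : 0 <= x <= pi -> is_derive x 1 H (g x).
    by move=> /andP[x0 _]; apply: dH; apply: lt_le_trans x0.
  rewrite -(Rintegral_FTC (ltW p0) dH') => [|x _]; last exact: cg.
  have mI : measurable (`[0, pi]%classic : set R) by exact: measurable_itv.
  have i1 : mu.-integrable `[0, pi] (EFin \o G) by apply: integrable_cc => x _; exact: cG.
  have i2 : mu.-integrable `[0, pi] (EFin \o (fun _ : R => m)) by apply: integrable_cc => x _; exact: cvg_cst.
  rewrite /g (@RintegralB _ _ R mu _ _ _ mI i1 i2) meanG Rintegral_cst//.
  by rewrite fine_measure_cc ?ltW// subr0 mulrC subrr.
by move/eqP; rewrite subr_eq0 => /eqP.
Qed.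

Let H_bounded : exists B, forall u, 0 <= u -> `|H u| <= B.
Proof.
have cH (u : R) : 0 <= u <= pi -> {for u, continuous H}.
  by move=> /andP[u0 _]; apply: is_derive_continuous (dH (lt_le_trans _ u0)).
have cH' : {within `[0, pi], continuous H}.
  by apply: continuous_in_subspaceT => x; rewrite inE/= in_itv/= => /cH.
have [c1 _ h1] := EVT_max (ltW p0) cH'.
have [c2 _ h2] := EVT_min (ltW p0) cH'.
exists (`|H c1| + `|H c2|) => u u0.
have [n hn] : exists n : nat, u <= n%:R * pi.
  exists (Num.Def.trunc (u / pi)).+1.
  by rewrite -ler_pdivrMr// ltW// truncnS_gt.
elim: n u u0 hn => [|n IH] u u0 hn.
  have u00 : u = 0 by apply/eqP; rewrite eq_le u0 andbT; move: hn; rewrite mul0r.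
  have z : 0 \in `[0, pi : R] by rewrite in_itv/= lexx ltW.
  have := h1 _ z; have := h2 _ z; rewrite u00 => a1 a2; rewrite ler_norml.
  apply/andP; split.
    by apply: le_trans a1; have := ler_norm (- H c2); rewrite normrN; have := normr_ge0 (H c1); lra.
  by apply: (le_trans a2); have := ler_norm (H c1); have := normr_ge0 (H c2); lra.
have [up|up] := leP u pi.
  have z : u \in `[0, pi : R] by rewrite in_itv/= u0 up.
  have := h1 _ z; have := h2 _ z => a1 a2; rewrite ler_norml.
  apply/andP; split.
    by apply: le_trans a1; have := ler_norm (- H c2); rewrite normrN; have := normr_ge0 (H c1); lra.
  by apply: (le_trans a2); have := ler_norm (H c1); have := normr_ge0 (H c2); lra.
have v0 : 0 <= u - pi by rewrite subr_ge0 ltW.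
have := H_per v0; rewrite subrK => ->; apply: IH => //.
by rewrite lerBlDr; move: hn; rewrite -natr1 mulrDl mul1r.
Qed.

Let G_nat (u : R) (N : nat) : G (u + N%:R * pi) = G u.
Proof.
elim: N => [|N IH]; first by rewrite mul0r addr0.
by rewrite -natr1 mulrDl mul1r addrA perG.
Qed.

Let G_bounded : exists B, forall u, `|g u| <= B.
Proof.
have cg' : {within `[0, pi], continuous g} by apply: continuous_subspaceT => x; exact: cg.
have [c1 _ h1] := EVT_max (ltW p0) cg'.
have [c2 _ h2] := EVT_min (ltW p0) cg'.
exists (`|g c1| + `|g c2|).
have base (u : R) : 0 <= u <= pi -> `|g u| <= `|g c1| + `|g c2|.
  move=> hu; have z : u \in `[0, pi : R] by rewrite in_itv.
  have := h1 _ z; have := h2 _ z => a1 a2; rewrite ler_norml.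
  apply/andP; split.
    by apply: le_trans a1; have := ler_norm (- g c2); rewrite normrN; have := normr_ge0 (g c1); lra.
  by apply: (le_trans a2); have := ler_norm (g c1); have := normr_ge0 (g c2); lra.
have pos (u : R) : 0 <= u -> `|g u| <= `|g c1| + `|g c2|.
  move=> u0; pose N := Num.Def.trunc (u / pi).
  have up : 0 <= u / pi by rewrite divr_ge0// ltW.
  have /andP[n1 n2] := truncn_itv up; rewrite -/N in n1 n2.
  have e : u = (u - N%:R * pi) + N%:R * pi by rewrite subrK.
  have -> : g u = g (u - N%:R * pi) by rewrite /g {1}e G_nat.
  apply: base; rewrite subr_ge0 -ler_pdivlMr// n1/=.
  rewrite lerBlDr ltW//; move: n2; rewrite ltr_pdivrMr// -natr1 mulrDl mul1r addrC; exact.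
move=> u; have [N hN] : exists N : nat, 0 <= u + N%:R * pi.
  exists (Num.Def.trunc (`|u| / pi)).+1.
  have := truncnS_gt (`|u| / pi); rewrite ltr_pdivrMr// => h.
  by have := ler_norm (- u); rewrite normrN; lra.
by have := pos _ hN; rewrite /g G_nat.
Qed.

(* Integrate [H (Psi n) * h] by parts, [H] being the bounded primitive of [G - m]; the
   phase is shifted by a multiple of [pi] because [H] is periodic only on [u >= 0]. *)
Lemma equidistribution_cc (a b C : R) (Psi dPsi : nat -> R -> R) (h dh : R -> R) : a <= b ->
  (forall n x, a <= x <= b -> is_derive x 1 (Psi n) (dPsi n x)) ->
  (forall n x, a <= x <= b -> {for x, continuous (dPsi n)}) ->
  (forall n x, a <= x <= b -> `|dPsi n x - n.+1%:R| <= C * Num.sqrt n.+1%:R) ->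
  (forall x, a <= x <= b -> is_derive x 1 h (dh x)) ->
  (forall x, a <= x <= b -> {for x, continuous dh}) ->
  \int[mu]_(x in `[a, b]) ((G (Psi n x) - m) * h x) @[n --> \oo] --> (0 : R).
Proof.
move=> ab dP cdP bP dh' cdh.
have [B hB] := H_bounded; have [B2 hB2] := G_bounded.
have bounded (f : R -> R) : (forall x, a <= x <= b -> {for x, continuous f}) ->
    exists M, forall x, a <= x <= b -> `|f x| <= M.
  move=> cf; have cf' : {within `[a, b], continuous (fun x => `|f x|)}.
    by apply: continuous_in_subspaceT => x; rewrite inE/= in_itv/= => /cf h'; apply: cvg_norm.
  have [c _ hc] := EVT_max ab cf'; exists `|f c| => x hx; apply: hc.
  by rewrite in_itv.
have ch x : a <= x <= b -> {for x, continuous h} by move=> /dh' /is_derive_continuous.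
have [Mh hMh] := bounded _ ch; have [Md hMd] := bounded _ cdh.
have aab : a <= a <= b by rewrite lexx.
have bab : a <= b <= b by rewrite lexx andbT.
have B0 : 0 <= B by apply: le_trans (hB 0 (lexx 0)).
have B20 : 0 <= B2 by apply: le_trans (hB2 0).
have Mh0 : 0 <= Mh by apply: le_trans (hMh a aab).
have Md0 : 0 <= Md by apply: le_trans (hMd a aab).
have C0 : 0 <= C by have := le_trans (normr_ge0 _) (bP 0%N a aab); rewrite sqrtr1 mulr1.
have ba0 : 0 <= b - a by rewrite subr_ge0.
pose K := 2 * B * Mh + B * Md * (b - a) + B2 * Mh * C * (b - a).
have cP n x : a <= x <= b -> {for x, continuous (Psi n)} by move=> /dP /is_derive_continuous.
have key n : `|\int[mu]_(x in `[a, b]) ((G (Psi n x) - m) * h x)| <= K / Num.sqrt n.+1%:R.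
  have [N hN] : exists N : nat, forall x, a <= x <= b -> 0 <= Psi n x + N%:R * pi.
    have [M hM] := bounded _ (cP n).
    exists (Num.Def.trunc (M / pi)).+1 => x /hM hx.
    have := truncnS_gt (M / pi); rewrite ltr_pdivrMr// => h1.
    by have := ler_norm (- Psi n x); rewrite normrN; lra.
  pose Q x := Psi n x + N%:R * pi.
  have dQ x : a <= x <= b -> is_derive x 1 Q (dPsi n x).
    by move=> /dP dx; rewrite /Q; apply: is_derive_eq; rewrite addr0.
  have gQ x : g (Q x) = g (Psi n x) by rewrite /g /Q G_nat.
  pose E x := H (Q x) * h x.
  have cQ x : a <= x <= b -> {for x, continuous Q} by move=> /dQ /is_derive_continuous.
  have Q1 x : a <= x <= b -> -1 < Q x by move=> /hN; apply: lt_le_trans.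
  have dHQ x : a <= x <= b -> is_derive x 1 (fun t => H (Q t)) (g (Psi n x) * dPsi n x).
    move=> hx; rewrite -gQ; exact: (@is_derive1_comp R H Q x _ _ (dH (Q1 x hx)) (dQ x hx)).
  have cHQ x : a <= x <= b -> {for x, continuous (fun t => H (Q t))}.
    by move=> /dHQ /is_derive_continuous.
  have cgP x : a <= x <= b -> {for x, continuous (fun t => g (Psi n t))}.
    by move=> hx; apply: continuous_comp; [exact: cP|exact: cg].
  have dE x : a <= x <= b -> is_derive x 1 E (g (Psi n x) * dPsi n x * h x + H (Q x) * dh x).
    move=> hx; have d1 := dHQ x hx; have d2 := dh' x hx; rewrite /E.
    by apply: is_derive_eq; rewrite !scale_oE; ring.
  have c1 x : a <= x <= b -> {for x, continuous (fun t => g (Psi n t) * dPsi n t * h t)}.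
    by move=> hx; apply: cvgM; [apply: cvgM; [exact: cgP|exact: cdP]|exact: ch].
  have c2 x : a <= x <= b -> {for x, continuous (fun t => H (Q t) * dh t)}.
    by move=> hx; apply: cvgM; [exact: cHQ|exact: cdh].
  have c3 x : a <= x <= b -> {for x, continuous (fun t => g (Psi n t) * (dPsi n t - n.+1%:R) * h t)}.
    move=> hx; apply: cvgM; last exact: ch.
    by apply: cvgM; [exact: cgP|apply: cvgB; [exact: cdP|exact: cvg_cst]].
  have c4 x : a <= x <= b -> {for x, continuous (fun t => g (Psi n t) * h t)}.
    by move=> hx; apply: cvgM; [exact: cgP|exact: ch].
  have mI : measurable (`[a, b]%classic : set R) by exact: measurable_itv.
  have i1 := integrable_cc c1; have i2 := integrable_cc c2; have i3 := integrable_cc c3; have i4 := integrable_cc c4.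
  have e1 : \int[mu]_(x in `[a, b]) (g (Psi n x) * dPsi n x * h x) = E b - E a - \int[mu]_(x in `[a, b]) (H (Q x) * dh x).
    have := Rintegral_FTC ab dE; rewrite (@RintegralD _ _ R mu _ _ _ mI i1 i2) => <-; first by rewrite addrK.
    by move=> x hx; apply: cvgD; [exact: c1|exact: c2].
  (* The factor [n.+1] is written as [dPsi n] minus the deviation [dPsi n - n.+1]: the first part is
     integrated by parts and stays bounded, the second is [O(sqrt (n + 1))]. Division by [n.+1]
     leaves [O(1 / sqrt (n + 1))]. *)
  have e2 : n.+1%:R * \int[mu]_(x in `[a, b]) (g (Psi n x) * h x) =
      \int[mu]_(x in `[a, b]) (g (Psi n x) * dPsi n x * h x) - \int[mu]_(x in `[a, b]) (g (Psi n x) * (dPsi n x - n.+1%:R) * h x).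
    rewrite -(@RintegralB _ _ R mu _ _ _ mI i1 i3) -(@RintegralZl _ _ R mu _ _ _ mI i4).
    by apply: eq_Rintegral => x _; ring.
  have s0 : 0 < Num.sqrt (n.+1%:R : R) by rewrite sqrtr_gt0.
  have s1 : 1 <= Num.sqrt (n.+1%:R : R) by rewrite -[leLHS]sqrtr1 ler_wsqrtr// ler1n.
  have b1 : `|E b - E a| <= 2 * B * Mh.
    have bE x : a <= x <= b -> `|E x| <= B * Mh.
      by move=> hx; rewrite /E normrM ler_pM// ?hMh// hB// hN.
    rewrite (_ : 2 * B * Mh = B * Mh + B * Mh); last by ring.
    by apply: le_trans (ler_normB _ _) _; exact: lerD (bE b bab) (bE a aab).
  have b2 : `|\int[mu]_(x in `[a, b]) (H (Q x) * dh x)| <= B * Md * (b - a).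
    by apply: Rintegral_bound => // x hx; rewrite normrM ler_pM ?hMd// hB// hN.
  have b3 : `|\int[mu]_(x in `[a, b]) (g (Psi n x) * (dPsi n x - n.+1%:R) * h x)| <= B2 * (C * Num.sqrt n.+1%:R) * Mh * (b - a).
    by apply: Rintegral_bound => // x hx; rewrite normrM ler_pM ?hMh// normrM ler_pM ?hB2 ?bP.
  have n1 : n.+1%:R = Num.sqrt (n.+1%:R : R) * Num.sqrt n.+1%:R by rewrite -expr2 sqr_sqrtr.
  rewrite ler_pdivlMr//; rewrite -(ler_pM2r s0) -mulrA -n1 -[X in _ * X](@ger0_norm _ n.+1%:R)// -normrM mulrC.
  rewrite e2 e1.
  apply: le_trans (ler_normB _ _) _; apply: le_trans (lerD (ler_normB _ _) (lexx _)) _.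
  apply: le_trans (lerD (lerD b1 b2) b3) _; rewrite /K.
  set s := Num.sqrt _ in s0 s1 *.
  have k1 : 0 <= 2 * B * Mh by rewrite !mulr_ge0.
  have k2 : 0 <= B * Md * (b - a) by rewrite !mulr_ge0.
  have := ler_wpM2l k1 s1; have := ler_wpM2l k2 s1; rewrite !mulr1.
  move: (B * Md * (b - a)) (2 * B * Mh) => X1 X2 h1 h2.
  rewrite !mulrDl; have -> : B2 * (C * s) * Mh * (b - a) = B2 * Mh * C * (b - a) * s by ring.
  by rewrite lerD2r; lra.
apply: norm_cvg0.
have hc : K / Num.sqrt n.+1%:R @[n --> \oo] --> (0 : R).
  have h1 : Num.sqrt ((n.+1%:R : R)^-1) @[n --> \oo] --> (0 : R).
    have h2 := @sqrt_continuous R 0; rewrite /continuous_at sqrtr0 in h2.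
    exact: (cvg_comp _ _ (@cvg_harmonic R) h2).
  have := rcvgZ (c := K) h1; rewrite mulr0 => h3; apply: rcvg_ext h3 => n.
  by rewrite sqrtrV.
apply: (@squeeze_cvgr _ _ _ _ (cst 0) _ _ _ _ _ hc); last exact: cvg_cst.
by apply: nearW => n; rewrite normr_ge0/= key.
Qed.

End Primitive.

(** * Derivative of the Pollaczek phase *)

Section PollaczekPhase.
Variables (lam a : R).
Hypotheses (hl : 1 <= lam) (ha : 0 <= a).
Local Notation Psi := (pPsi lam a).
Local Notation phi := (pphi a).

Definition dPsi n (x : R) : R := n.+1%:R +
  \sum_(k < n.+1) (a / sin x ^+ 2 / (lam + k%:R) / (1 + (phi x / (lam + k%:R)) ^+ 2))
  - (1 - lam) + a / sin x ^+ 2 * ln (2 * sin x) - phi x * (cos x / sin x).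

Let dphi (x : R) : 0 < x < pi -> is_derive x 1 phi (- (a / sin x ^+ 2)).
Proof.
move=> /sin_gt0_pi s0; have sn := lt0r_neq0 s0.
have dV : is_derive x 1 (fun y : R => (sin y)^-1) (- (sin x ^- 2) * cos x).
  by have := is_deriveV sn (is_derive_sin x); rewrite !scale_oE.
rewrite /pphi; apply: is_derive_eq; rewrite !scale_oE.
have := cos2Dsin2 x; move: (cos x) (sin x) sn => c s s0' e.
have -> : a / s ^+ 2 = a * (c ^+ 2 + s ^+ 2) / s ^+ 2 by rewrite e mulr1.
by field.
Qed.

Let sum_derive n (F : nat -> R -> R) (f : nat -> R) (x : R) :
  (forall k, is_derive x 1 (F k) (f k)) ->
  is_derive x 1 (fun y => \sum_(k < n) F k y) (\sum_(k < n) f k).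
Proof.
move=> h; elim: n => [|n IH].
  rewrite big_ord0 (_ : (fun y => _) = cst 0); last by apply/funext => y; rewrite big_ord0.
  exact: is_derive_cst.
rewrite big_ord_recr/= (_ : (fun y => _) = (fun y => \sum_(k < n) F k y) + F n); last first.
  by apply/funext => y; rewrite big_ord_recr.
exact: is_deriveD.
Qed.

Lemma is_derive_pPsi n (x : R) : 0 < x < pi -> is_derive x 1 (Psi n) (dPsi n x).
Proof.
move=> hx; have s0 := sin_gt0_pi hx; have sn := lt0r_neq0 s0.
have dp := dphi hx.
have l0 k : 0 < lam + k%:R :> R by rewrite ltr_wpDr// (lt_le_trans ltr01).
have dat k : is_derive x 1 (fun y => atan (phi y / (lam + k%:R)))
   (- (a / sin x ^+ 2 / (lam + k%:R) / (1 + (phi x / (lam + k%:R)) ^+ 2))).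
  have d1 : is_derive x 1 (fun y => phi y / (lam + k%:R)) (- (a / sin x ^+ 2) / (lam + k%:R)).
    by apply: is_derive_eq; rewrite !scale_oE; ring.
  have d2 := @is_derive1_comp R (@atan R) (fun y => phi y / (lam + k%:R)) x _ _ (is_derive1_atan _) d1.
  apply: (is_derive_eq d2); ring.
have dsum := sum_derive n.+1 dat.
have dln : is_derive x 1 (fun y : R => ln (2 * sin y)) (cos x / sin x).
  have d1 : is_derive x 1 (fun y : R => 2 * sin y) (2 * cos x).
    by apply: is_derive_eq; rewrite !scale_oE; ring.
  have s2 : 0 < 2 * sin x by rewrite mulr_gt0.
  have d2 := @is_derive1_comp R (@ln R) (fun y => 2 * sin y) x _ _ (is_derive1_ln s2) d1.
  by apply: (is_derive_eq d2); field.
rewrite /pPsi /darg; apply: is_derive_eq; rewrite !scale_oE /dPsi sumrN; ring.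
Qed.

Lemma continuous_dPsi n (x : R) : 0 < x < pi -> {for x, continuous (dPsi n)}.
Proof.
move=> hx; have s0 := sin_gt0_pi hx; have sn := lt0r_neq0 s0.
have cp := is_derive_continuous (dphi hx).
have l0 k : 0 < lam + k%:R :> R by rewrite ltr_wpDr// (lt_le_trans ltr01).
have c1 : {for x, continuous (fun y : R => a / sin y ^+ 2)}.
  apply: cvgMr; apply: cvgV; first by rewrite expf_neq0.
  rewrite expr2; under eq_fun do rewrite expr2.
  by apply: cvgM; exact: continuous_sin.
have csum : {for x, continuous (fun y : R => \sum_(k < n.+1) (a / sin y ^+ 2 / (lam + k%:R) / (1 + (phi y / (lam + k%:R)) ^+ 2)))}.
  elim: (n.+1) => [|m IH].
    by rewrite (_ : (fun y => _) = cst 0); [exact: cvg_cst|apply/funext => y; rewrite big_ord0].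
  rewrite (_ : (fun y => _) = (fun y => \sum_(k < m) (a / sin y ^+ 2 / (lam + k%:R) / (1 + (phi y / (lam + k%:R)) ^+ 2)) + (a / sin y ^+ 2 / (lam + m%:R) / (1 + (phi y / (lam + m%:R)) ^+ 2)))); last first.
    by apply/funext => y; rewrite big_ord_recr.
  apply: cvgD; first exact: IH.
  apply: cvgM; first exact: cvgMl.
  apply: cvgV; first by rewrite lt0r_neq0// ltr_pwDl// sqr_ge0.
  apply: cvgD; first exact: cvg_cst.
  have cq : {for x, continuous (fun y => phi y / (lam + m%:R))} by exact: cvgMl.
  rewrite expr2; under eq_fun do rewrite expr2.
  exact: (cvgM cq cq).
have cs := @continuous_sin R x.
have cc := @continuous_cos R x.
rewrite /dPsi; apply: cvgB; last by apply: cvgM => //; apply: cvgM => //; exact: cvgV.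
apply: cvgD; last first.
  apply: cvgM => //; apply: (continuous_comp (f := fun y : R => 2 * sin y)); first exact: cvgMr.
  by apply: continuous_ln; rewrite mulr_gt0.
apply: cvgB; last exact: cvg_cst.
by apply: cvgD => //; exact: cvg_cst.
Qed.

(** The sum is logarithmic, but the bound [1 / (n + 1) <= 2 * (sqrt (n + 1) - sqrt n)] telescopes
    and is sufficient. It is the source of the square root in [equidistribution_cc]. *)
Let inv_sum_le n : \sum_(k < n) (lam + k%:R)^-1 <= 2 * Num.sqrt n%:R.
Proof.
elim: n => [|n IH]; first by rewrite big_ord0 sqrtr0 mulr0.
rewrite big_ord_recr/=; apply: le_trans (lerD IH (lexx _)) _.
have l0 : 0 < lam + n%:R :> R by rewrite ltr_wpDr// (lt_le_trans ltr01).
have h : (lam + n%:R)^-1 <= (n.+1%:R : R)^-1 by rewrite lef_pV2 ?posrE// -nat1r lerD2r.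
apply: le_trans (lerD (lexx _) h) _.
set s := Num.sqrt n%:R; set t := Num.sqrt n.+1%:R.
have s0 : 0 <= s by exact: sqrtr_ge0.
have t0 : 0 < t by rewrite sqrtr_gt0.
have st : s <= t by rewrite ler_wsqrtr// ler_nat.
have e1 : s ^+ 2 = n%:R by rewrite sqr_sqrtr.
have e2 : t ^+ 2 = n.+1%:R by rewrite sqr_sqrtr.
have e3 : t ^+ 2 = s ^+ 2 + 1 by rewrite e1 e2 natr1.
rewrite -e2 -(ler_pM2r (exprn_gt0 2 t0)) mulrDl mulVf ?expf_neq0 ?lt0r_neq0//.
have h1 : (t - s) * (t + s) = 1 by rewrite -subr_sqr e3; ring.
have : (t - s) * (t + s) <= (t - s) * (2 * t ^+ 2).
  have t1 : 1 <= t by rewrite /t -[leLHS]sqrtr1 ler_wsqrtr// ler1n.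
  by apply: ler_wpM2l; [rewrite subr_ge0|nra].
rewrite h1; move: (t ^+ 2) => T; lra.
Qed.

Lemma dPsi_le (al : R) : 0 < al -> al <= pi / 2 -> exists C, forall n x, al <= x <= pi - al ->
  `|dPsi n x - n.+1%:R| <= C * Num.sqrt n.+1%:R.
Proof.
(* [sg] is the lower bound for the sine on [[al, pi - al]] supplied by [sin_ge_parabola], both
   factors of the parabola being at least [al]. *)
move=> al0 alp; pose sg := al ^+ 2 / (2 * pi).
have sg0 : 0 < sg by rewrite divr_gt0 ?mulr_gt0// exprn_gt0.
pose A := a / sg ^+ 2.
have A0 : 0 <= A by rewrite divr_ge0// sqr_ge0.
pose lb := `|ln (2 * sg)| + ln 2.
have lb0 : 0 <= lb by rewrite addr_ge0// ln_ge0// ler1n.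
pose K := `|1 - lam| + A * lb + A.
have K0 : 0 <= K by rewrite !addr_ge0// mulr_ge0.
exists (A * 2 + K) => n x /andP[h1 h2].
have x0 : 0 < x by apply: lt_le_trans h1.
have xp : x < pi by apply: le_lt_trans h2 _; rewrite gtrBl.
have hx : 0 < x < pi by rewrite x0.
have s0 := sin_gt0_pi hx.
have l0 k : 0 < lam + k%:R :> R by rewrite ltr_wpDr// (lt_le_trans ltr01).
have ss : sg <= sin x.
  apply: le_trans (sin_ge_parabola hx); rewrite /sg ler_pM2r ?invr_gt0 ?mulr_gt0// expr2.
  by rewrite ler_pM ?(ltW al0)//; move: h2; move: (pi : R) => P; lra.
have aA : 0 <= a / sin x ^+ 2 <= A.
  rewrite divr_ge0 ?sqr_ge0//= /A ler_wpM2l// lef_pV2 ?posrE ?exprn_gt0//.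
  by rewrite lerXn2r ?nnegrE// ltW.
have /andP[a0 a1] := aA.
have s1 : 1 <= Num.sqrt (n.+1%:R : R) by rewrite -[leLHS]sqrtr1 ler_wsqrtr// ler1n.
have b1 : `|\sum_(k < n.+1) (a / sin x ^+ 2 / (lam + k%:R) / (1 + (phi x / (lam + k%:R)) ^+ 2))| <= A * 2 * Num.sqrt n.+1%:R.
  rewrite -mulrA; apply: le_trans (ler_wpM2l A0 (inv_sum_le n.+1)).
  rewrite mulr_sumr; apply: le_trans (ler_norm_sum _ _ _) _; apply: ler_sum => k _.
  have d0 : 0 < 1 + (phi x / (lam + k%:R)) ^+ 2 by rewrite ltr_pwDl// sqr_ge0.
  rewrite ger0_norm; last by rewrite divr_ge0 ?(ltW d0)// divr_ge0// ltW.
  rewrite ler_pdivrMr//; apply: le_trans (_ : A / (lam + k%:R) <= _).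
    by rewrite ler_wpM2r// invr_ge0 ltW.
  by rewrite ler_peMr ?lerDl ?sqr_ge0// divr_ge0// ltW.
have b2 : `|a / sin x ^+ 2 * ln (2 * sin x)| <= A * lb.
  rewrite normrM ler_pM//; first by rewrite ger0_norm.
  rewrite ler_norml /lb; apply/andP; split.
    have sg2 : 0 < 2 * sg by rewrite mulr_gt0.
    have s2 : 0 < 2 * sin x by rewrite mulr_gt0.
    have h : ln (2 * sg) <= ln (2 * sin x) by rewrite ler_ln ?posrE//; lra.
    have := ler_norm (- ln (2 * sg)); rewrite normrN => h'.
    have : 0 <= ln (2 : R) by rewrite ln_ge0// ler1n.
    by lra.
  have h : ln (2 * sin x) <= ln 2.
    by rewrite ler_ln ?posrE ?mulr_gt0//; have := sin_le1 x; lra.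
  by rewrite (le_trans h)// lerDr.
have b3 : `|phi x * (cos x / sin x)| <= A.
  have -> : phi x * (cos x / sin x) = a / sin x ^+ 2 * cos x ^+ 2.
    by rewrite /pphi; field; rewrite gt_eqF.
  rewrite normrM -[leRHS]mulr1 ler_pM//; first by rewrite ger0_norm.
  by rewrite ger0_norm ?sqr_ge0// -(cos2Dsin2 x) lerDl sqr_ge0.
rewrite /dPsi; set S := \sum_(k < _) _ in b1 *; set T := _ * ln _ in b2 *; set U := phi x * _ in b3 *.
have -> : n.+1%:R + S - (1 - lam) + T - U - n.+1%:R = S - (1 - lam) + T - U by ring.
apply: le_trans (ler_normB _ _) _; apply: le_trans (lerD (ler_normD _ _) (lexx _)) _.
apply: le_trans (lerD (lerD (ler_normB _ _) (lexx _)) (lexx _)) _.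
rewrite mulrDl; have := ler_wpM2l K0 s1; rewrite mulr1.
move: b1 b2 b3; move: (Num.sqrt _) (`|S|) (`|T|) (`|U|) => sq s t u b1 b2 b3 hK.
have : `|1 - lam| + A * lb + A <= K * sq by exact: hK.
move: (A * 2 * sq) (A * lb) (K * sq) b1 b2 => *; lra.
Qed.

End PollaczekPhase.
End Equidistribution.

(** * The bulk *)

Section XlnxModulus.
Variable R : realType.

(** With [s <= t] and [d = t - s], the difference is [d * ln t + s * ln (t / s)]. The second term is
    at most [d]; the first is at most [4 d] for [1 <= t] and at most [|d ln d|] otherwise. *)
Lemma xlnx_modulus (s t : R) : 0 <= s <= 4 -> 0 <= t <= 4 ->
  `|xlnx s - xlnx t| <= 5 * `|s - t| + `|xlnx `|s - t| |.
Proof.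
wlog st : s t / s <= t => [hw hs ht|].
  have [st|/ltW ts] := leP s t; first exact: hw.
  by rewrite distrC [`|s - t|]distrC; exact: hw.
move=> /andP[s0 _] /andP[_ t4].
rewrite distrC [`|s - t|]distrC [`|t - s|]ger0_norm ?subr_ge0//.
set d := t - s; have d0 : 0 <= d by rewrite subr_ge0.
have dt : d <= t by rewrite gerBl.
have [t0|t0] := leP t 0.
  have ez : t = 0 by apply/eqP; rewrite eq_le t0 (le_trans s0 st).
  have es : s = 0 by apply/eqP; rewrite eq_le s0 andbT -ez.
  by rewrite /d ez es subrr normr0 addr_ge0// mulr_ge0// subrr.
have b1 : `|s * (ln t - ln s)| <= d.
  have [s1|s1] := leP s 0.
    have -> : s = 0 by apply/eqP; rewrite eq_le s1 s0.
    by rewrite mul0r normr0.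
  rewrite -ln_div ?posrE// ger0_norm; last first.
    by rewrite mulr_ge0// ln_ge0// ler_pdivlMr// mul1r.
  have h : ln (t / s) <= t / s - 1 by apply: ln_le_sub1; rewrite divr_gt0.
  apply: le_trans (ler_wpM2l s0 h) _.
  by rewrite mulrBr mulr1 mulrC divfK ?gt_eqF.
have b2 : `|d * ln t| <= 4 * d + `|xlnx d|.
  have [t1|t1] := leP 1 t.
    rewrite ger0_norm ?mulr_ge0 ?ln_ge0//.
    apply: le_trans (_ : 4 * d <= _); last by rewrite lerDl.
    by rewrite mulrC ler_wpM2r//; have := ln_le_sub1 t0; lra.
  have [dz|dz] := leP d 0.
    have -> : d = 0 by apply/eqP; rewrite eq_le d0 dz.
    by rewrite mul0r normr0 mulr0 add0r.
  apply: le_trans (_ : `|xlnx d| <= _); last by rewrite lerDr mulr_ge0.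
  rewrite /xlnx !normrM ler_wpM2l// ler0_norm; last by rewrite ln_le0// ltW.
  by rewrite ler0_norm ?lerN2 ?ler_ln ?posrE// ln_le0// (le_trans dt)// ltW.
have -> : xlnx t - xlnx s = d * ln t + s * (ln t - ln s) by rewrite /xlnx /d; ring.
apply: le_trans (ler_normD _ _) _; move: b1 b2; lra.
Qed.

Lemma xlnx_abs_le (t : R) : 0 <= t <= 4 -> `|xlnx t| <= 16.
Proof.
move=> /andP[t0 t4]; rewrite ler_norml; have h1 := xlnx_ge t0; have h2 := xlnx_le t0.
by apply/andP; split; [lra|apply: le_trans h2 _; nra].
Qed.

End XlnxModulus.

Section Bulk.
Variables (R : realType) (lam a : R).
Hypotheses (hl : 1 <= lam) (ha : 0 <= a).
Local Notation mu := (@lebesgue_measure R).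
Local Notation D := (`]0, pi[%classic : set R).
Local Notation Psi := (pPsi lam a).
Let mD : measurable D. Proof. exact: measurable_itv. Qed.
Let oD : open D. Proof. exact: interval_open. Qed.
Let p0 : 0 < (pi : R). Proof. exact: pi_gt0. Qed.
Let p2 : 2 <= (pi : R). Proof. exact: pi_ge2. Qed.
Let DE (x : R) : D x -> 0 < x < pi. Proof. by rewrite /= in_itv. Qed.

Let al (k : nat) : R := k.+2%:R^-1.
Let al_cvg : al n @[n --> \oo] --> (0 : R).
Proof. by have h := @cvg_harmonic R; rewrite (cvg_shiftS (@harmonic R) (nbhs (0:R))). Qed.
Let al01 k : 0 < al k <= 2^-1.
Proof. by rewrite /al invr_gt0 ltr0n lef_pV2 ?posrE// ler_nat. Qed.

Let Dal (x : R) : D x -> \forall n \near \oo, al n <= x <= pi - al n.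
Proof.
move=> /DE /andP[x0 xp]; have y0 : 0 < pi - x by rewrite subr_gt0.
have h1 : \forall n \near \oo, al n < x by apply: (cvgr_lt _ al_cvg).
have h2 : \forall n \near \oo, al n < pi - x by apply: (cvgr_lt _ al_cvg).
apply: filterS2 h1 h2 => n h1 h2; rewrite (ltW h1)/=.
by move: h2; move: (pi : R) => P; lra.
Qed.

Lemma cPsi n (x : R) : D x -> {for x, continuous (Psi n)}.
Proof. by move=> /DE hx; have h := is_derive_pPsi a hl n hx; exact: (is_derive_continuous h). Qed.

(** The phase derivative is controlled only away from 0 and [pi]. Given a tolerance, [k] is fixed
    first so that [B * |h|] has small integral outside [[al k, pi - al k]]; then [n] grows on that
    segment. *)
Lemma equidistribution (G : R -> R) (m B : R) (h dh : R -> R) :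
  continuous G -> (forall u, G (u + pi) = G u) ->
  \int[mu]_(u in `[0, pi]) G u = pi * m -> (forall u, `|G u - m| <= B) ->
  (forall x, D x -> is_derive x 1 h (dh x)) ->
  (forall x, D x -> {for x, continuous dh}) ->
  mu.-integrable D (EFin \o h) ->
  \int[mu]_(x in D) ((G (Psi n x) - m) * h x) @[n --> \oo] --> (0 : R).
Proof.
move=> cG perG mG GB dh' cdh ih.
have B0 : 0 <= B by apply: le_trans (GB 0).
have ch x : D x -> {for x, continuous h} by move=> /dh' /is_derive_continuous.
pose f n x := (G (Psi n x) - m) * h x.
have cf n x : D x -> {for x, continuous (f n)}.
  move=> Dx; apply: cvgM; last exact: ch.
  apply: cvgB; last exact: cvg_cst.
  by apply: continuous_comp; [exact: cPsi|exact: cG].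
have iBh : mu.-integrable D (EFin \o (fun x => B * `|h x|)).
  by apply: integrable_scale => //; exact: (integrable_norm ih).
have fi n : mu.-integrable D (EFin \o f n).
  apply: (integrable_dom mD _ _ iBh); first by apply: continuous_on_measurable; [|exact: oD|exact: cf].
  by move=> x _; rewrite normrM ler_wpM2r.
pose I k : set R := `[al k, pi - al k]%classic.
have mI k : measurable (I k) by exact: measurable_itv.
have ID k : I k `<=` D.
  move=> x; rewrite /I /= !in_itv/= => /andP[h1 h2]; have /andP[k0 _] := al01 k.
  by rewrite (lt_le_trans k0 h1)/= (le_lt_trans h2)// gtrBl.
have DI k : D `&` I k = I k by apply/seteqP; split => [x []//|x hx]; split => //; exact: (ID k).
pose r k x := B * `|h x| - (fun x => B * `|h x|) \_ (I k) x.
have r_cvg : \int[mu]_(x in D) r k x @[k --> \oo] --> (0 : R).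
  have [||||_] := @Rdominated_cvg R D r (cst 0) (fun x => B * `|h x|) mD.
  - move=> k; apply: measurable_funB.
      apply: continuous_on_measurable => // x Dx; apply: cvgMr; apply: cvg_norm; exact: ch.
    apply: measurable_funTS; apply/(measurable_restrictT _ _).1 => //.
    apply: (measurable_funS mD (ID k)); apply: continuous_on_measurable => // x Dx.
    by apply: cvgMr; apply: cvg_norm; exact: ch.
  - move=> x Dx; apply: cvg_near_cst; apply: filterS (Dal Dx) => k hk.
    by rewrite /r patchE mem_set ?subrr//= in_itv.
  - exact: iBh.
  - move=> k x Dx; rewrite /r patchE; case: ifPn => _; last by rewrite subr0 ger0_norm// mulr_ge0.
    by rewrite subrr normr0 mulr_ge0.
  by rewrite Rintegral_cst// mul0r.
have split n k : `|\int[mu]_(x in D) f n x| <= `|\int[mu]_(x in I k) f n x| + \int[mu]_(x in D) r k x.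
  have ifk : mu.-integrable D (EFin \o (f n \_ (I k))).
    apply: (integrable_dom mD _ _ (integrable_norm (fi n))).
      apply: measurable_funTS; apply/(measurable_restrictT _ _).1 => //.
      by apply: (measurable_funS mD (ID k)); apply: continuous_on_measurable; [|exact: oD|exact: cf].
    by move=> x _; rewrite patchE; case: ifPn => //= _; rewrite normr0.
  have ird : mu.-integrable D (EFin \o r k).
    apply: (integrable_dom mD _ _ iBh) => [|x Dx].
      apply: measurable_funB.
        apply: continuous_on_measurable => // x Dx; apply: cvgMr; apply: cvg_norm; exact: ch.
      apply: measurable_funTS; apply/(measurable_restrictT _ _).1 => //.
      apply: (measurable_funS mD (ID k)); apply: continuous_on_measurable => // x Dx.
      by apply: cvgMr; apply: cvg_norm; exact: ch.
    rewrite /r patchE; case: ifPn => _; last by rewrite subr0 ger0_norm// mulr_ge0.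
    by rewrite subrr normr0 mulr_ge0.
  have -> : \int[mu]_(x in I k) f n x = \int[mu]_(x in D) (f n \_ (I k)) x.
    by rewrite -Rintegral_mkcondr DI.
  have e : \int[mu]_(x in D) f n x = \int[mu]_(x in D) (f n \_ (I k)) x + \int[mu]_(x in D) (f n x - (f n \_ (I k)) x).
    by rewrite (@RintegralB _ _ R mu _ _ _ mD (fi n) ifk); ring.
  rewrite e; apply: le_trans (ler_normD _ _) _; rewrite lerD2l.
  have ibb := integrable_sub mD (fi n) ifk.
  apply: le_trans (@le_normr_Rintegral _ _ R mu _ _ mD ibb) _.
  apply: (@le_Rintegral _ _ R mu _ _ _ mD (integrable_norm ibb) ird) => x _.
  rewrite /= /r !patchE; case: ifPn => _; first by rewrite !subrr normr0.
  by rewrite !subr0 normrM ler_wpM2r.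
apply/cvgr0Pnorm_le => e e0.
have e2 : 0 < e / 2 by rewrite divr_gt0.
have := r_cvg => /cvgr0Pnorm_le /(_ _ e2)[k _ hk].
have /andP[k0 k1] := al01 k.
have kp : al k <= pi / 2 by move: p2 k1; move: (pi : R) (al k) => P A; lra.
have kk : al k <= pi - al k by move: kp; move: (pi : R) (al k) => P A; lra.
have [C hC] := dPsi_le hl ha k0 kp.
have inD x : al k <= x <= pi - al k -> D x by move=> hx; apply: (ID k); rewrite /I /= in_itv.
have := @equidistribution_cc R G m cG perG mG (al k) (pi - al k) C Psi (dPsi lam a) h dh kk
  (fun n x hx => is_derive_pPsi a hl n (DE (inD x hx)))
  (fun n x hx => continuous_dPsi hl (DE (inD x hx))) hC
  (fun x hx => dh' x (inD x hx)) (fun x hx => cdh x (inD x hx)).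
move=> /cvgr0Pnorm_le /(_ _ e2); apply: filterS => n hn.
apply: le_trans (split n k) _; have := hk k (leqnn k); have := ler_norm (\int[mu]_(x in D) r k x).
by move: hn; rewrite -/(I k) -/(f n); move: (`|\int[mu]_(x in I k) _|) (\int[mu]_(x in D) r k x) (`|\int[mu]_(x in D) r k x|) => *; lra.
Qed.


Let sqr2 (u : R) : R := 2 * sin u ^+ 2.
Let csqr2 : continuous sqr2.
Proof.
move=> u; apply: cvgMr; rewrite expr2; under eq_fun do rewrite expr2.
by apply: cvgM; exact: continuous_sin.
Qed.
Let per_sqr2 u : sqr2 (u + pi) = sqr2 u.
Proof. by rewrite /sqr2 sinD cospi sinpi mulr0 addr0 mulrN1 sqrrN. Qed.
Let sqr2_itv u : 0 <= sqr2 u <= 2.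
Proof.
rewrite /sqr2 mulr_ge0 ?sqr_ge0//=.
by have := cos2Dsin2 u; have := sqr_ge0 (cos u); lra.
Qed.
Let sqr2_itv4 u : 0 <= sqr2 u <= 4.
Proof. by have /andP[-> h] := sqr2_itv u; rewrite (le_trans h)// ler_nat. Qed.

(** Logarithm of [pi * sin x], the factor between the density at [cos x] and [pf]. *)
Let w (x : R) : R := ln pi + ln (sin x).
Let dw (x : R) : D x -> is_derive x 1 w (cos x / sin x).
Proof.
move=> /DE /sin_gt0_pi s0.
have d := @is_derive1_comp R (@ln R) (@sin R) x _ _ (is_derive1_ln s0) (is_derive_sin x).
have {d} : is_derive x 1 (fun x : R => ln (sin x)) ((sin x)^-1 * cos x) by [].
move=> d; rewrite /w; apply: is_derive_eq; ring.
Qed.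
Let cdw (x : R) : D x -> {for x, continuous (fun x : R => cos x / sin x)}.
Proof.
move=> /DE /sin_gt0_pi s0; apply: cvgM; first exact: continuous_cos.
by apply: cvgV; [exact: lt0r_neq0|exact: continuous_sin].
Qed.
Let i1 (c : R) : mu.-integrable D (EFin \o (fun _ : R => c)).
Proof.
exact: integrable_cst_oo.
Qed.
Let iw : mu.-integrable D (EFin \o w).
Proof. by apply: integrable_add => //; exact: integrable_ln_sin. Qed.
Let muD : fine (mu D) = pi.
Proof. by rewrite [X in fine X]lebesgue_measure_itv/= lte_fin p0/= subr0. Qed.
Let Iw : \int[mu]_(x in D) w x = pi * ln pi - pi * ln 2.
Proof.
rewrite /w (@RintegralD _ _ R mu _ _ _ mD (i1 (ln pi)) (integrable_ln_sin R)).
by rewrite Rintegral_cst// Rintegral_ln_sin mulrC muD.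
Qed.

(** Two applications of equidistribution: [xlnx (2 sin^2)] has mean [1 - ln 2] and is tested against
    1; [2 sin^2] has mean 1 and is tested against [w], whose integral is [pi ln pi - pi ln 2]. *)
Let model_cvg : \int[mu]_(x in D) (xlnx (sqr2 (Psi n x)) - sqr2 (Psi n x) * w x) @[n --> \oo] -->
  pi * (1 - ln pi).
Proof.
have cG1 : continuous (fun u => xlnx (sqr2 u)).
  by move=> u; apply: continuous_comp; [exact: csqr2|exact: continuous_xlnx].
have cpsi n x : D x -> {for x, continuous (Psi n)} by exact: cPsi.
have B1 u : `|xlnx (sqr2 u) - (1 - ln 2)| <= 16 + `|1 - ln 2|.
  by rewrite (le_trans (ler_normB _ _))// lerD2r xlnx_abs_le.
have B2 u : `|sqr2 u - 1| <= 1.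
  by have /andP[h1 h2] := sqr2_itv u; rewrite ler_norml; apply/andP; split; lra.
have e1 := @equidistribution (fun u => xlnx (sqr2 u)) (1 - ln 2) _ (cst 1) (cst 0) cG1 _ (@Rintegral_xlnx_sin2 R) B1 _ _ (i1 1).
have {}e1 : \int[mu]_(x in D) ((xlnx (sqr2 (Psi n x)) - (1 - ln 2)) * 1) @[n --> \oo] --> (0 : R).
  apply: e1 => [u|x _]; [by rewrite per_sqr2|exact: cvg_cst].
have m2 : \int[mu]_(u in `[0, pi]) sqr2 u = pi * 1 by rewrite mulr1; exact: Rintegral_sin2.
have e2 := @equidistribution sqr2 1 1 w _ csqr2 per_sqr2 m2 B2 dw cdw iw.
have h := rcvgB e1 e2; rewrite subr0 in h.
have c0 : (pi : R) * (1 - ln 2) - (pi * ln pi - pi * ln 2) = pi * (1 - ln pi) by ring.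
have hc : (pi : R) * (1 - ln pi) @[_ --> \oo] --> (pi : R) * (1 - ln pi) by exact: cvg_cst.
have {}h := rcvgD h hc; rewrite add0r in h.
apply: rcvg_ext h => n /=.
have ig (g B : R -> R) : (forall x, D x -> {for x, continuous g}) -> (forall x, D x -> `|g x| <= B x) ->
    mu.-integrable D (EFin \o B) -> mu.-integrable D (EFin \o g).
  by move=> cg gB iB; apply: (integrable_dom mD _ gB iB); apply: continuous_on_measurable.
have cw x : D x -> {for x, continuous w} by move=> /dw; exact: is_derive_continuous.
have cx x : D x -> {for x, continuous (fun x => xlnx (sqr2 (Psi n x)))}.
  by move=> Dx; apply: (@continuous_comp _ _ _ (Psi n) (fun u => xlnx (sqr2 u))); [exact: cpsi|exact: cG1].
have cs x : D x -> {for x, continuous (fun x => sqr2 (Psi n x))}.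
  by move=> Dx; apply: (continuous_comp (f := Psi n)); [exact: cpsi|exact: csqr2].
have k1 : mu.-integrable D (EFin \o (fun x => xlnx (sqr2 (Psi n x)))).
  by apply: (ig _ (fun _ => 16)) => // x _; exact: xlnx_abs_le.
have k2 : mu.-integrable D (EFin \o (fun x => sqr2 (Psi n x) * w x)).
  apply: (ig _ (fun x => 2 * `|w x|)).
  - by move=> x Dx; apply: cvgM; [exact: cs|exact: cw].
  - by move=> x _; have /andP[h1 h2] := sqr2_itv (Psi n x); rewrite normrM ler_wpM2r// ger0_norm.
  - by apply: integrable_scale => //; exact: (integrable_norm iw).
have k3 : mu.-integrable D (EFin \o (fun x => (xlnx (sqr2 (Psi n x)) - (1 - ln 2)) * 1)).
  rewrite (_ : (fun x => _) = (fun x => xlnx (sqr2 (Psi n x)) - (1 - ln 2))); last by apply/funext => x; rewrite mulr1.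
  exact: integrable_sub.
have k4 : mu.-integrable D (EFin \o (fun x => (sqr2 (Psi n x) - 1) * w x)).
  rewrite (_ : (fun x => _) = (fun x => sqr2 (Psi n x) * w x - w x)); last by apply/funext => x; ring.
  exact: integrable_sub.
have -> : \int[mu]_(x in D) ((xlnx (sqr2 (Psi n x)) - (1 - ln 2)) * 1) = \int[mu]_(x in D) xlnx (sqr2 (Psi n x)) - (1 - ln 2) * pi.
  rewrite (_ : (fun x => _) = (fun x => xlnx (sqr2 (Psi n x)) - (1 - ln 2))); last by apply/funext => x; rewrite mulr1.
  by rewrite (@RintegralB _ _ R mu _ _ _ mD k1 (i1 _)) Rintegral_cst// muD.
have -> : \int[mu]_(x in D) ((sqr2 (Psi n x) - 1) * w x) = \int[mu]_(x in D) (sqr2 (Psi n x) * w x) - (pi * ln pi - pi * ln 2).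
  rewrite (_ : (fun x => _) = (fun x => sqr2 (Psi n x) * w x - w x)); last by apply/funext => x; ring.
  by rewrite (@RintegralB _ _ R mu _ _ _ mD k2 iw) Iw.
by rewrite (@RintegralB _ _ R mu _ _ _ mD k1 k2); ring.
Qed.

(* Where [F n <= 4], [F n] may be replaced by [2 sin^2 (Psi n)] up to a dominated error,
   and the phase [Psi n] equidistributes modulo [pi]. *)
Lemma bulk_cvg (F : nat -> R -> R) (be : nat -> R) :
  (forall n x, D x -> {for x, continuous (F n)}) ->
  (forall n, 0 < be n) -> be n @[n --> \oo] --> (0 : R) ->
  (forall n x, be n <= x <= pi - be n -> 0 <= F n x <= 4) ->
  (forall x, D x -> F n x - 2 * sin (Psi n x) ^+ 2 @[n --> \oo] --> (0 : R)) ->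
  \int[mu]_(x in `[be n, pi - be n]) (xlnx (F n x) - F n x * (ln pi + ln (sin x))) @[n --> \oo] -->
  pi * (1 - ln pi).
Proof.
move=> cF be0 be_cvg F4 Fcvg.
pose I n : set R := `[be n, pi - be n]%classic.
have mI n : measurable (I n) by exact: measurable_itv.
have ID n : I n `<=` D.
  move=> x; rewrite /I /= !in_itv/= => /andP[h1 h2]; have k0 := be0 n.
  by rewrite (lt_le_trans k0 h1)/= (le_lt_trans h2)// gtrBl.
have DI n : D `&` I n = I n by apply/seteqP; split => [x []//|x hx]; split => //; exact: (ID n).
pose f n x := xlnx (F n x) - F n x * w x.
pose v n x := xlnx (sqr2 (Psi n x)) - sqr2 (Psi n x) * w x.
pose d n x := (f n \_ (I n)) x - v n x.
have cw x : D x -> {for x, continuous w} by move=> /dw; exact: is_derive_continuous.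
have cf n x : D x -> {for x, continuous (f n)}.
  move=> Dx; apply: cvgB; last by apply: cvgM; [exact: cF|exact: cw].
  by apply: (continuous_comp (f := F n)); [exact: cF|exact: continuous_xlnx].
have cv n x : D x -> {for x, continuous (v n)}.
  move=> Dx; have cp := cPsi (n := n) Dx; apply: cvgB.
    apply: (continuous_comp (f := fun x => sqr2 (Psi n x))); last exact: continuous_xlnx.
    by apply: (continuous_comp (f := Psi n)); [exact: cp|exact: csqr2].
  apply: cvgM; last exact: cw.
  by apply: (continuous_comp (f := Psi n)); [exact: cp|exact: csqr2].
pose g x := 16 + 4 * `|w x| + (16 + 4 * `|w x|).
have ig : mu.-integrable D (EFin \o g).
  have h : mu.-integrable D (EFin \o (fun x => 16 + 4 * `|w x|)).
    apply: integrable_add => //; apply: integrable_scale => //; exact: (integrable_norm iw).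
  exact: integrable_add.
have bnd (y x : R) : 0 <= y <= 4 -> `|xlnx y - y * w x| <= 16 + 4 * `|w x|.
  move=> hy; rewrite (le_trans (ler_normB _ _))// lerD ?xlnx_abs_le//.
  by have /andP[y0 y4] := hy; rewrite normrM ler_wpM2r// ger0_norm.
have bf n x : D x -> `|(f n \_ (I n)) x| <= 16 + 4 * `|w x|.
  move=> Dx; rewrite patchE; case: ifPn => [/set_mem|_]; last by rewrite normr0 addr_ge0// mulr_ge0.
  by rewrite /I /= in_itv/= => hx; apply: bnd; exact: F4.
have bv n x : `|v n x| <= 16 + 4 * `|w x| by apply: bnd; exact: sqr2_itv4.
have mf n : measurable_fun D (f n \_ (I n)).
  apply: measurable_funTS; apply/(measurable_restrictT _ _).1 => //.
  by apply: (measurable_funS mD (ID n)); apply: continuous_on_measurable; [|exact: oD|exact: cf].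
have mv n : measurable_fun D (v n) by apply: continuous_on_measurable; [|exact: oD|exact: cv].
have ifn n : mu.-integrable D (EFin \o (f n \_ (I n))).
  apply: (integrable_dom mD (mf n) (bf n)); apply: integrable_add => //.
  by apply: integrable_scale => //; exact: (integrable_norm iw).
have iv n : mu.-integrable D (EFin \o v n).
  apply: (integrable_dom mD (mv n) (fun x _ => bv n x)); apply: integrable_add => //.
  by apply: integrable_scale => //; exact: (integrable_norm iw).
have [||||_ hd] := @Rdominated_cvg R D d (cst 0) g mD.
- by move=> n; apply: measurable_funB.
- move=> x Dx; move/DE : (Dx) => /andP[x0 xp].
  have inI : \forall n \near \oo, I n x.
    have y0 : 0 < pi - x by rewrite subr_gt0.
    have h1 : \forall n \near \oo, be n < x by apply: (cvgr_lt _ be_cvg).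
    have h2 : \forall n \near \oo, be n < pi - x by apply: (cvgr_lt _ be_cvg).
    apply: filterS2 h1 h2 => n h1 h2; rewrite /I /= in_itv/= (ltW h1)/=.
    by move: h2; move: (pi : R) => P; lra.
  have dl : `|F n x - sqr2 (Psi n x)| @[n --> \oo] --> (0 : R).
    have h : `|F n x - sqr2 (Psi n x)| @[n --> \oo] --> `|0 : R| by apply: cvg_norm; exact: Fcvg.
    by rewrite normr0 in h.
  have xl : `|xlnx `|F n x - sqr2 (Psi n x)| | @[n --> \oo] --> (0 : R).
    have h := @continuous_xlnx R 0; rewrite /continuous_at {2}/xlnx mul0r in h.
    have h2 := cvg_comp _ _ dl h.
    have h3 : `|xlnx `|F n x - sqr2 (Psi n x)| | @[n --> \oo] --> `|0 : R| by apply: cvg_norm; exact: h2.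
    by rewrite normr0 in h3.
  have hh := rcvgD (rcvgD (rcvgZ (c := 5) dl) xl) (rcvgZ (c := `|w x|) dl).
  rewrite !mulr0 !addr0 in hh.
  apply: norm_cvg0; apply: (@squeeze_cvgr _ _ _ _ (cst 0) _ _ _ _ _ hh); last exact: cvg_cst.
  apply: filterS inI => n hn; rewrite normr_ge0/= /d patchE mem_set// /f /v.
  move: (hn); rewrite /I /= in_itv/= => /F4 hF.
  rewrite (_ : _ - _ = (xlnx (F n x) - xlnx (sqr2 (Psi n x))) - w x * (F n x - sqr2 (Psi n x))); last by ring.
  apply: le_trans (ler_normB _ _) _; apply: lerD; last by rewrite normrM.
  by apply: xlnx_modulus => //; exact: sqr2_itv4.
- exact: ig.
- by move=> n x Dx; rewrite /d (le_trans (ler_normB _ _))// lerD ?bf ?bv.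
rewrite Rintegral_cst// mul0r in hd.
have h := rcvgD hd model_cvg; rewrite add0r in h.
apply: rcvg_ext h => n.
by rewrite /d (@RintegralB _ _ R mu _ _ _ mD (ifn n) (iv n)) subrK -Rintegral_mkcondr DI.
Qed.

End Bulk.

(** * The turning point and the tails *)

Section Tail.
Variables (R : realType) (lam a : R).
Hypotheses (hl : 1 <= lam) (ha : 0 <= a).
Local Notation mu := (@lebesgue_measure R).
Local Notation A := (pA lam a).
Local Notation q := (tt_poly A).
Local Notation S := (pSt lam a).
Local Notation F := (pf lam a).
Let A0 n : 0 < A n. Proof. exact: pA_gt0. Qed.
Let A_nd n : A n <= A n.+1. Proof. exact: pA_nd. Qed.
Let S0 theta : 0 < S theta. Proof. exact: pSt_gt0. Qed.

Lemma pf_ge0 n theta : 0 <= F n theta.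
Proof.
have S2 : 0 < 2 * S theta by rewrite pmulr_rgt0.
by rewrite /pf divr_ge0 ?(ltW S2)// -exprMn sqr_ge0.
Qed.

(** Turns a bound relative to the limit of [turan] into one for [pf] from which that limit has
    disappeared; [pf_bulk], [pf_gap] and [pf_outer] all pass through it. *)
Lemma pf_of_turan n theta (c : R) : (q n).[cos theta] ^+ 2 * c <= 4 * S theta ->
  F n theta * c <= 2 * sin theta ^+ 2.
Proof.
have S2 : 0 < 2 * S theta by rewrite pmulr_rgt0.
move=> h; rewrite /pf mulrAC ler_pdivrMr//.
rewrite [X in X <= _](_ : _ = sin theta ^+ 2 * ((q n).[cos theta] ^+ 2 * c)); last by ring.
apply: le_trans (ler_wpM2l (sqr_ge0 _) h) _.
by rewrite le_eqVlt; apply/orP; left; apply/eqP; ring.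
Qed.

(** The square in [horner_turan] is dropped and [turan] is replaced by its larger limit. *)
Lemma pf_bulk n theta : 0 < theta < pi ->
  F n theta * (4 * A n ^+ 2 - cos theta ^+ 2) <= 2 * sin theta ^+ 2.
Proof.
move=> ht; apply: pf_of_turan; have := turan_lt_pSt hl ha n ht; rewrite horner_turan => h.
have := sqr_ge0 (A n * (q n.+1).[cos theta] - cos theta / 2 * (q n).[cos theta]).
move: h; set X := (_ - _) ^+ 2; move: (q n).[cos theta] (cos theta) (A n) (S theta) => Q c B s; lra.
Qed.

Let turanSx x n : (turan A n.+1).[x] = (turan A n).[x] + (A n.+1 ^+ 2 - A n ^+ 2) * (q n.+1).[x] ^+ 2.
Proof. by rewrite (turanS A0 n) hornerD hornerZ horner_exp. Qed.

(** Only the last increment of [turan] is kept. This bound survives at the turning point, where that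
    of [pf_bulk] degenerates. *)
Lemma pf_gap n theta : 0 < theta < pi ->
  F n.+1 theta * (4 * A n.+1 ^+ 2 - 4 * A n ^+ 2) <= 2 * sin theta ^+ 2.
Proof.
move=> ht; apply: pf_of_turan; have := turan_lt_pSt hl ha n.+1 ht.
rewrite turanSx => h.
have := turan_gt0 A0 A_nd (cos theta) n; move: h.
move: (turan A n).[cos theta] (q n.+1).[cos theta] => t Q; lra.
Qed.

(** For [2 * A n.+1 <= |x|] the recurrence gives [A n.+1 * |q n.+2| >= 2 * A n.+1 * |q n.+1| - A n *
    |q n|], and the induction hypothesis with increasing [A] bounds the subtracted term by
    [A n.+1 * |q n.+1|]. *)
Let q_growth x n : 4 * A n ^+ 2 <= x ^+ 2 -> `|(q n).[x]| <= `|(q n.+1).[x]|.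
Proof.
have AA k : 4 * A k ^+ 2 <= x ^+ 2 -> 2 * A k <= `|x|.
  have k2 : 0 < 2 * A k by rewrite pmulr_rgt0.
  move=> h; rewrite -(gtr0_norm k2) -!sqrtr_sqr ler_wsqrtr//.
  by rewrite (_ : (2 * A k) ^+ 2 = 4 * A k ^+ 2)//; ring.
elim: n => [|n IH] h.
  have h1 := congr1 (fun p : {poly R} => p.[x]) (tt_poly1 A0); rewrite hornerZ hornerX in h1.
  rewrite tt_poly0 hornerC normr1 -(ler_pM2l (A0 0)) -{2}(gtr0_norm (A0 0)) -normrM h1 mulr1.
  by have := AA 0%N h; have := A0 0; lra.
have hn : 4 * A n ^+ 2 <= x ^+ 2.
  apply: le_trans h; rewrite ler_pM2l// lerXn2r ?nnegrE ?(ltW (A0 _))//.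
have h1 := horner_ttSS hl ha x n.
rewrite -(ler_pM2l (A0 n.+1)) -{2}(gtr0_norm (A0 n.+1)) -normrM h1.
have h2 : `|x| * `|(q n.+1).[x]| - A n * `|(q n).[x]| <= `|x * (q n.+1).[x] - A n * (q n).[x]|.
  by rewrite -normrM -{1}(gtr0_norm (A0 n)) -normrM lerB_dist.
apply: le_trans h2.
have h3 := ler_wpM2r (normr_ge0 (q n.+1).[x]) (AA _ h).
have h4 : A n * `|(q n).[x]| <= A n.+1 * `|(q n.+1).[x]|.
  by rewrite ler_pM// ?IH// ltW.
by move: h3 h4; move: (A n.+1) (`|(q n.+1).[x]|) (`|x| * _) (A n * _) => *; lra.
Qed.

Let turan_growth x n j : (n <= j)%N -> 4 * A n.+1 ^+ 2 <= x ^+ 2 -> 4 * A j ^+ 2 <= x ^+ 2 ->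
  (A j.+1 ^+ 2 - A n ^+ 2) * (q n.+1).[x] ^+ 2 <= (turan A j.+1).[x] /\ `|(q n.+1).[x]| <= `|(q j.+1).[x]|.
Proof.
move=> nj hn; elim: j nj => [|j IH].
  rewrite leqn0 => /eqP -> _; split => //; rewrite turanSx lerDr ltW//.
  exact: (turan_gt0 A0 A_nd).
rewrite leq_eqVlt => /predU1P[-> _|nj hj].
  split => //; rewrite turanSx lerDr ltW//.
  exact: (turan_gt0 A0 A_nd).
have hj' : 4 * A j ^+ 2 <= x ^+ 2.
  apply: le_trans hj; rewrite ler_pM2l// lerXn2r ?nnegrE ?(ltW (A0 _))//.
have [h1 h2] := IH nj hj'.
have h3 := le_trans h2 (q_growth hj).
split => //; rewrite turanSx.
rewrite (_ : _ - A n ^+ 2 = (A j.+1 ^+ 2 - A n ^+ 2) + (A j.+2 ^+ 2 - A j.+1 ^+ 2)); last by ring.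
rewrite mulrDl lerD// ler_wpM2l//.
  by rewrite subr_ge0 lerXn2r ?nnegrE ?(ltW (A0 _)).
by rewrite -[leLHS]real_normK ?num_real// -[leRHS]real_normK ?num_real// lerXn2r ?nnegrE.
Qed.

(* Beyond the turning point [4 A_n^2 = x^2] the values [|q_k x|] increase, so all later
   increments of [turan] are at least the corresponding multiples of [q_n x ^ 2]. *)
Lemma pf_outer n theta : 0 < theta < pi -> 4 * A n.+1 ^+ 2 <= cos theta ^+ 2 ->
  F n.+1 theta * (cos theta ^+ 2 - 4 * A n ^+ 2) <= 2 * sin theta ^+ 2.
Proof.
move=> ht hn; apply: pf_of_turan; set x := cos theta in hn *.
have x1 : x ^+ 2 < 1.
  by have s0 := sin_gt0_pi ht; rewrite /x -(cos2Dsin2 theta) ltrDl exprn_gt0.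
(* Because [4 * A k ^+ 2] tends to 1 and [x ^+ 2 < 1], the growth regime ends; the least [k] at
   which it has ended collects increments of [turan] of total weight exceeding
   [x ^+ 2 / 4 - A n ^+ 2]. *)
have exK : exists k, x ^+ 2 < 4 * A k ^+ 2.
  have h : 4 * A n ^+ 2 @[n --> \oo] --> (1 : R).
    have hc : (1 : R) @[_ --> \oo] --> (1 : R) by exact: cvg_cst.
    have h1 := rcvgB hc (pD_cvg hl ha); rewrite subr0 in h1.
    by apply: rcvg_ext h1 => k; rewrite /pD; ring.
  by have [k _ hk] := cvgr_gt _ h _ x1; exists k; apply: (hk k (leqnn k)).
have [k hk kmin] := ex_minnP exK.
have nk : (n.+1 < k)%N.
  rewrite ltnNge; apply/negP => kn; move: hk; rewrite ltNge => /negP; apply.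
  apply: le_trans hn; rewrite ler_pM2l// lerXn2r ?nnegrE ?(ltW (A0 _))//; exact: pA_ndW.
case: k hk kmin nk => // j hj jmin nj.
have hjj : 4 * A j ^+ 2 <= x ^+ 2.
  by rewrite leNgt; apply/negP => /jmin; rewrite ltnn.
have [h1 _] := turan_growth (ltnW (nj : (n < j)%N)) hn hjj.
have h2 := le_trans h1 (turan_lt_pSt hl ha j.+1 ht).
have h3 : (x ^+ 2 - 4 * A n ^+ 2) * (q n.+1).[x] ^+ 2 <= (4 * (A j.+1 ^+ 2 - A n ^+ 2)) * (q n.+1).[x] ^+ 2.
  by rewrite ler_wpM2r ?sqr_ge0//; move: hj; lra.
by rewrite mulrC; apply: le_trans h3 _; rewrite -mulrA ler_pM2l.
Qed.

Definition gap n : R := 4 * A n.+1 ^+ 2 - 4 * A n ^+ 2.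

(** Below the turning point [pf_bulk] and [pf_gap] are added. Above it the sum of the two terms
    collapses to [cos theta ^+ 2 - 4 * A n ^+ 2], which is the factor in [pf_outer]. *)
Lemma pf_tail n theta : 0 < theta < pi ->
  F n.+1 theta * (`|cos theta ^+ 2 - 4 * A n.+1 ^+ 2| + gap n) <= 4 * sin theta ^+ 2.
Proof.
move=> ht; have h1 := pf_bulk n.+1 ht; have h2 := pf_gap n ht; rewrite -/(gap n) in h2.
have s0 := sqr_ge0 (sin theta).
have [hx|hx] := leP (4 * A n.+1 ^+ 2) (cos theta ^+ 2).
  have h3 := pf_outer ht hx; rewrite ger0_norm ?subr_ge0// /gap.
  rewrite [X in _ * X](_ : _ = cos theta ^+ 2 - 4 * A n ^+ 2); last by ring.
  by apply: le_trans h3 _; rewrite ler_wpM2r// ler_nat.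
rewrite ltr0_norm ?subr_lt0// opprB mulrDr.
by move: h1 h2; move: (F n.+1 theta * _) (F n.+1 theta * _) => *; lra.
Qed.

Lemma pf_le4 n theta : 0 < theta < pi -> 2 * pD lam a n <= sin theta ^+ 2 -> F n theta <= 4.
Proof.
move=> ht hD; have s0 := sin_gt0_pi ht; have ss : 0 < sin theta ^+ 2 by rewrite exprn_gt0.
have h := pf_bulk n ht; have f0 := pf_ge0 n theta.
have e : 4 * A n ^+ 2 - cos theta ^+ 2 = sin theta ^+ 2 - pD lam a n.
  by rewrite /pD -(cos2Dsin2 theta); ring.
rewrite e in h.
have h2 : F n theta * (sin theta ^+ 2 / 2) <= F n theta * (sin theta ^+ 2 - pD lam a n).
  by rewrite ler_wpM2l//; move: hD; move: (sin theta ^+ 2) (pD _ _ _) => *; lra.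
have h3 := le_trans h2 h.
rewrite -(ler_pM2r ss); move: h3; move: (sin theta ^+ 2) => *; lra.
Qed.

(** The excluded value of [pD] at 0 corresponds to [lam = 1] and [a = 0], where [gap] is identically
    zero. Otherwise the numerator in [pDeltaE] is bounded below and the denominator is cubic; a
    polynomial bound is enough since only the logarithm of [gap] is used. *)
Lemma gap_ge : pD lam a 0 != 0 -> exists2 K, 0 < K & forall n, 2 / gap n <= K * n.+1%:R ^+ 3 /\ 0 < gap n.
Proof.
move=> hD.
pose de := a + lam * (lam - 1).
have ll : 0 <= lam * (lam - 1) by rewrite mulr_ge0//; move: hl; lra.
have de0 : 0 < de.
  rewrite lt_neqAle addr_ge0// andbT eq_sym paddr_eq0//; apply/negP => /andP[/eqP az /eqP lz].
  have e : 2 * a * 0%:R + lam * (lam - 1) + 2 * lam * a + a ^+ 2 + a = 0 by rewrite lz az; ring.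
  by move: hD; rewrite (pDE hl ha) e mul0r eqxx.
pose k := lam + a + 3.
have k0 : 0 < k by rewrite /k; move: hl ha; lra.
exists (k ^+ 3 / de); first by rewrite divr_gt0// exprn_gt0.
move=> n; have u1 := pu_ge hl ha n.
have n1 : 1 <= n.+1%:R :> R by rewrite ler1n.
have n0 : 0 < n.+1%:R :> R by [].
have u0 : 0 < pu lam a n by apply: lt_le_trans u1.
have num : 2 * de <= 2 * (a * (n.+1%:R + lam) + lam * (lam - 1)).
  rewrite ler_pM2l// /de lerD2r ler_peMr//; move: hl n1; lra.
have den0 : 0 < pu lam a n * (pu lam a n + 1) * (pu lam a n + 2) by rewrite !mulr_gt0// addr_gt0.
have uk : pu lam a n + 2 <= k * n.+1%:R.
  rewrite /pu /k -[n.+1%:R]natr1; have := ler0n R n; move: (n%:R : R) => N N0.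
  have h1 : 0 <= lam * N by rewrite mulr_ge0// (le_trans ler01).
  have h2 : 0 <= a * N by rewrite mulr_ge0.
  by move: h1 h2 N0 hl ha; nra.
have den : pu lam a n * (pu lam a n + 1) * (pu lam a n + 2) <= (k * n.+1%:R) ^+ 3.
  have h1 : pu lam a n <= k * n.+1%:R by move: uk; lra.
  have h2 : pu lam a n + 1 <= k * n.+1%:R by move: uk; lra.
  move: (pu lam a n) (k * n.+1%:R) u0 h1 h2 uk => u M u00 h1 h2 h3.
  have e1 : 0 <= u by exact: ltW.
  have e2 : 0 <= u + 1 by lra.
  have e3 : 0 <= u + 2 by lra.
  have e4 := ler_pM e1 e2 h1 h2.
  have e5 := ler_pM (mulr_ge0 e1 e2) e3 e4 h3.
  by rewrite (_ : M ^+ 3 = M * M * M)//; ring.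
have num0 : 0 < 2 * (a * (n.+1%:R + lam) + lam * (lam - 1)) by apply: lt_le_trans num; rewrite mulr_gt0.
have g0 : 0 < gap n by rewrite /gap (pDeltaE hl ha) divr_gt0.
split => //; rewrite ler_pdivrMr// /gap (pDeltaE hl ha) mulrA ler_pdivlMr//.
have -> : k ^+ 3 / de * n.+1%:R ^+ 3 * (2 * (a * (n.+1%:R + lam) + lam * (lam - 1))) =
  (k * n.+1%:R) ^+ 3 * ((2 * (a * (n.+1%:R + lam) + lam * (lam - 1))) / de) by rewrite exprMn; ring.
apply: le_trans (ler_wpM2l _ den) _ => //.
by rewrite mulrC ler_wpM2l ?exprn_ge0 ?mulr_ge0 ?(ltW k0)// ler_pdivlMr.
Qed.

Lemma gap_le1 n : gap n <= 1.
Proof.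
rewrite /gap; have := pD_ge0 hl ha n.+1; rewrite /pD => h.
by have := sqr_ge0 (A n); lra.
Qed.

Lemma log_gap_cvg : pD lam a 0 != 0 ->
  Num.sqrt (pD lam a n.+1) * ln (2 / gap n) ^+ 2 @[n --> \oo] --> (0 : R).
Proof.
move=> hD; have [K K0 hK] := gap_ge hD; have [C C0 hC] := pD_le hl ha.
(* [t n] is the eighth root of [n + 1]. Then [ln (2 / gap n)] is [O(t)], with 24 coming from
   [(n + 1) ^ 3 = t ^ 24] and [ln t <= t], while [sqrt (pD n.+1)] is [O(t ^ -4)]; the product is
   [O(t ^ -2)]. *)
pose t n : R := Num.sqrt (Num.sqrt (Num.sqrt n.+1%:R)).
have t1 n : 1 <= t n.
  by rewrite /t -[leLHS]sqrtr1 ler_wsqrtr// -[leLHS]sqrtr1 ler_wsqrtr// -[leLHS]sqrtr1 ler_wsqrtr// ler1n.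
have t0 n : 0 < t n by apply: lt_le_trans (t1 n).
have t4 n : t n ^+ 4 = Num.sqrt n.+1%:R.
  by rewrite /t (exprM _ 2 2) !sqr_sqrtr ?sqrtr_ge0.
have t8 n : t n ^+ 8 = n.+1%:R by rewrite (exprM _ 4 2) t4 sqr_sqrtr.
pose K1 := `|ln K| + 24.
have lnb n : 0 <= ln (2 / gap n) <= K1 * t n.
  have [h1 h2] := hK n; apply/andP; split.
    by apply: ln_ge0; rewrite ler_pdivlMr// mul1r (le_trans (gap_le1 n))// ler1n.
  have p3 : 0 < n.+1%:R ^+ 3 :> R by rewrite exprn_gt0.
  have h3 : ln (2 / gap n) <= ln (K * n.+1%:R ^+ 3) by rewrite ler_ln ?posrE// ?divr_gt0// mulr_gt0.
  apply: (le_trans h3); rewrite lnM ?posrE// -t8 -exprM lnXn// -(mulr_natl (ln _)).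
  have h4 : ln (t n) <= t n by have := ln_le_sub1 (t0 n); lra.
  rewrite /K1 [leRHS]mulrDl lerD//; last by rewrite ler_pM2l.
  apply: le_trans (ler_norm _) _; rewrite -[leLHS]mulr1 ler_wpM2l//.
pose M := Num.sqrt C * K1 ^+ 2.
have bound n : Num.sqrt (pD lam a n.+1) * ln (2 / gap n) ^+ 2 <= M * (t n ^- 2).
  have /andP[l0 l1] := lnb n.
  have d1 : pD lam a n.+1 <= C / n.+1%:R.
    apply: le_trans (hC n.+1) _; rewrite ler_wpM2l// lef_pV2 ?posrE// ler_nat//.
  have d2 : Num.sqrt (pD lam a n.+1) <= Num.sqrt C / t n ^+ 4.
    by rewrite t4 -sqrtrV// -sqrtrM// ler_wsqrtr.
  have d3 : ln (2 / gap n) ^+ 2 <= K1 ^+ 2 * t n ^+ 2.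
    by rewrite -exprMn lerXn2r ?nnegrE// (le_trans l0).
  apply: le_trans (ler_pM (sqrtr_ge0 _) (sqr_ge0 _) d2 d3) _.
  rewrite le_eqVlt; apply/orP; left; apply/eqP; rewrite /M.
  by have := lt0r_neq0 (t0 n); move: (t n) => T T0; field.
have s0 : Num.sqrt (Num.sqrt (n.+1%:R^-1 : R)) @[n --> \oo] --> (0 : R).
  have h2 := @sqrt_continuous R 0; rewrite /continuous_at sqrtr0 in h2.
  exact: (cvg_comp _ _ (cvg_comp _ _ (@cvg_harmonic R) h2) h2).
have h := rcvgZ (c := M) s0; rewrite mulr0 in h.
apply: (@squeeze_cvgr _ _ _ _ (cst 0) _ _ _ _ _ h); last exact: cvg_cst.
apply: nearW => n; apply/andP; split; first by rewrite mulr_ge0 ?sqrtr_ge0 ?sqr_ge0.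
apply: le_trans (bound n) _; rewrite !sqrtrV ?sqrtr_ge0//.
by rewrite /t sqr_sqrtr ?sqrtr_ge0.
Qed.

End Tail.

(** * Integral of a majorant peaked at two symmetric turning points *)

Section ReciprocalIntegral.
Variable R : realType.
Local Notation mu := (@lebesgue_measure R).

Lemma Rintegral_cc_split (f : R -> R) (a x b : R) : a <= x <= b ->
  (forall t, a <= t <= b -> {for t, continuous f}) ->
  \int[mu]_(t in `[a, b]) f t = \int[mu]_(t in `[a, x]) f t + \int[mu]_(t in `[x, b]) f t.
Proof.
move=> /andP[ax xb] cf; have i := integrable_cc cf.
have := Rintegral_itvB i (_ : (BLeft a <= BRight x)%O) (_ : (BRight x <= BRight b)%O).
rewrite !bnd_simp => /(_ ax xb) e.
have mf : measurable_fun `]x, b[ f.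
  apply: continuous_on_measurable; [exact: measurable_itv|exact: interval_open|].
  by move=> t; rewrite /= in_itv/= => /andP[xt tb]; apply: cf; rewrite (ltW tb) (le_trans ax (ltW xt)).
by rewrite (@Rintegral_bndoo _ _ x b true false mf) -(@Rintegral_bndoo _ _ x b false false mf) -e addrC subrK.
Qed.

Variables (c e : R).
Hypotheses (c0 : 0 <= c) (c1 : c <= 1) (e0 : 0 < e) (e1 : e <= 1).
Let k (x : R) : R := (`| `|x| - c| + e)^-1.

Let ck (x : R) : {for x, continuous k}.
Proof.
apply: cvgV; first by rewrite lt0r_neq0// ltr_wpDl.
apply: cvgD; last exact: cvg_cst.
apply: cvg_norm; apply: cvgB; last exact: cvg_cst.
exact: norm_continuous.
Qed.

Let piece (a b sg d : R) : a <= b -> sg = 1 \/ sg = -1 ->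
  (forall x, a <= x <= b -> `| `|x| - c| = sg * x + d /\ `| `|x| - c| <= 1) ->
  \int[mu]_(x in `[a, b]) k x <= ln (2 / e).
Proof.
move=> ab hs hk.
pose G (x : R) : R := sg * ln (sg * x + (d + e)).
have pos x : a <= x <= b -> e <= sg * x + (d + e) <= 2.
  by move=> /hk[h1 h2]; have := normr_ge0 (`|x| - c); rewrite h1 in h2 *; move: e1; lra.
have pos0 x : a <= x <= b -> 0 < sg * x + (d + e) by move=> /pos /andP[h _]; apply: lt_le_trans h.
have dG x : a <= x <= b -> is_derive x 1 G (k x).
  move=> hx; have p := pos0 x hx; have [h1 _] := hk x hx.
  have d1 : is_derive x 1 (fun t : R => sg * t + (d + e)) sg.
    by apply: is_derive_eq; rewrite ?scale_oE; ring.
  have d2 := @is_derive1_comp R (@ln R) (fun t => sg * t + (d + e)) x _ _ (is_derive1_ln p) d1.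
  have d3 : is_derive x 1 (fun t : R => ln (sg * t + (d + e))) ((sg * x + (d + e))^-1 * sg) by [].
  rewrite /G; apply: is_derive_eq; rewrite !scale_oE /k h1 addrA.
  by case: hs => ->; rewrite ?mulr1 ?mul1r// mulrN1 mulN1r opprK.
rewrite (Rintegral_FTC ab dG) => [|x _]; last exact: ck.
have aa : a <= a <= b by rewrite lexx.
have bb : a <= b <= b by rewrite lexx andbT.
have /andP[a1 a2] := pos _ aa; have /andP[b1 b2] := pos _ bb.
have l1 : ln e <= ln (sg * a + (d + e)) by rewrite ler_ln ?posrE// pos0.
have l2 : ln e <= ln (sg * b + (d + e)) by rewrite ler_ln ?posrE// pos0.
have l3 : ln (sg * a + (d + e)) <= ln 2 by rewrite ler_ln ?posrE// pos0.
have l4 : ln (sg * b + (d + e)) <= ln 2 by rewrite ler_ln ?posrE// pos0.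
rewrite ln_div ?posrE// /G; move: l1 l2 l3 l4; move: (ln _) (ln (sg * b + _)) => X Y.
by case: hs => ->; lra.
Qed.

(** The points [- c], [0] and [c] cut the interval into four pieces on which the absolute values
    become affine of slope 1 or -1. Each piece integrates to a difference of logarithms of numbers
    in [[e, 2]]. *)
Lemma Rintegral_reciprocal : mu.-integrable `]-1, 1[ (EFin \o k) /\
  \int[mu]_(x in `]-1, 1[) k x <= 4 * ln (2 / e).
Proof.
have ckk a b : forall t : R, a <= t <= b -> {for t, continuous k} by move=> t _; exact: ck.
split.
  have h : mu.-integrable `[-1, 1] (EFin \o k) by apply: integrable_cc => x _; exact: ck.
  by apply: (integrableS _ _ _ h) => //; exact: subset_itv_oo_cc.
have mf : measurable_fun (`]-1, 1[%classic : set R) k.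
  by apply: continuous_on_measurable; [exact: measurable_itv|exact: interval_open|].
rewrite -(@Rintegral_bndoo _ _ (-1) 1 true false mf).
have m1 : -1 <= - c by rewrite lerN2.
have nc : - c <= 0 by rewrite oppr_le0.
have s1 : -1 <= (0 : R) <= 1 by rewrite lerN10 ler01.
have s2 : -1 <= - c <= 0 by rewrite m1.
have s3 : 0 <= c <= 1 by rewrite c0.
rewrite (Rintegral_cc_split s1 (@ckk _ _)) (Rintegral_cc_split s2 (@ckk _ _)) (Rintegral_cc_split s3 (@ckk _ _)).
have p1 : \int[mu]_(x in `[-1, - c]) k x <= ln (2 / e).
  apply: (@piece _ _ (-1) (- c)) => //; first by right.
  move=> x /andP[h1 h2]; have x0 : x <= 0 by lra.
  by rewrite (ler0_norm x0) ger0_norm ?subr_ge0; [split; lra|lra].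
have p2 : \int[mu]_(x in `[- c, 0]) k x <= ln (2 / e).
  apply: (@piece _ _ 1 c) => //; first by left.
  move=> x /andP[h1 h2].
  by rewrite (ler0_norm h2) ler0_norm ?subr_le0; [split; lra|lra].
have p3 : \int[mu]_(x in `[0, c]) k x <= ln (2 / e).
  apply: (@piece _ _ (-1) c) => //; first by right.
  move=> x /andP[h1 h2].
  by rewrite (ger0_norm h1) ler0_norm ?subr_le0; [split; lra|lra].
have p4 : \int[mu]_(x in `[c, 1]) k x <= ln (2 / e).
  apply: (@piece _ _ 1 (- c)) => //; first by left.
  move=> x /andP[h1 h2]; have x0 : 0 <= x by lra.
  by rewrite (ger0_norm x0) ger0_norm ?subr_ge0; [split; lra|lra].
move: p1 p2 p3 p4; move: (\int[mu]_(x in _) _) (\int[mu]_(x in _) _) (\int[mu]_(x in _) _) (\int[mu]_(x in _) _) (ln _) => *; lra.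
Qed.

End ReciprocalIntegral.

Section TailIntegral.
Variable R : realType.
Local Notation mu := (@lebesgue_measure R).
Local Notation D := (`]-1, 1[%classic : set R).

Lemma Rintegral_tail (f k : R -> R) (c M C1 E : R) : 0 <= c < 1 -> 0 <= E ->
  measurable_fun D f -> (forall x, D x -> `|f x| <= M) ->
  mu.-integrable D (EFin \o k) -> (forall x, 0 <= k x) -> 0 <= C1 ->
  (forall x, D x -> c < `|x| -> `|f x| <= C1 + E * k x) ->
  `|\int[mu]_(x in D) f x - \int[mu]_(x in `[- c, c]) f x| <=
  C1 * (2 * (1 - c)) + E * \int[mu]_(x in D) k x.
Proof.
move=> /andP[c0 c1] E0 mf fM ik k0 C10 fk.
have mD : measurable D by exact: measurable_itv.
pose I : set R := `[- c, c]%classic.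
have mI : measurable I by exact: measurable_itv.
have ID : I `<=` D.
  by move=> x; rewrite /I /= !in_itv/= => /andP[h1 h2]; apply/andP; split; lra.
have DI : D `&` I = I by apply/seteqP; split => [x []//|x hx]; split => //; exact: ID.
have ic (r : R) : mu.-integrable D (EFin \o (fun _ : R => r)).
  exact: integrable_cst_oo.
have fi : mu.-integrable D (EFin \o f) by apply: (integrable_dom mD mf fM (ic M)).
have mr (g : R -> R) : measurable_fun D g -> measurable_fun D (g \_ I).
  move=> mg; apply: measurable_funTS; apply/(measurable_restrictT _ _).1 => //.
  exact: (measurable_funS mD ID).
have ifI : mu.-integrable D (EFin \o (f \_ I)).
  apply: (integrable_dom mD (mr _ mf) _ (integrable_norm fi)) => x _.
  by rewrite /= patchE; case: ifPn => // _; rewrite normr0.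
have iCI : mu.-integrable D (EFin \o ((fun _ : R => C1) \_ I)).
  apply: (integrable_dom mD (mr _ _) _ (ic C1)) => [|x _]; first exact: measurable_cst.
  by rewrite /= patchE; case: ifPn => // _; rewrite ?normr0// ger0_norm.
have -> : \int[mu]_(x in I) f x = \int[mu]_(x in D) (f \_ I) x by rewrite -Rintegral_mkcondr DI.
rewrite -(@RintegralB _ _ R mu _ _ _ mD fi ifI).
have ib := integrable_sub mD fi ifI.
apply: le_trans (@le_normr_Rintegral _ _ R mu _ _ mD ib) _.
have iE := integrable_scale E mD ik.
have icc := integrable_sub mD (ic C1) iCI.
have ir := integrable_add mD icc iE.
apply: le_trans (@le_Rintegral _ _ R mu _ _ _ mD (integrable_norm ib) ir _) _.
  move=> x Dx; rewrite /= !patchE; case: ifPn => [_|/negP xI].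
    by rewrite !subrr normr0 add0r mulr_ge0.
  rewrite !subr0 fk// ltNge; apply/negP => h; apply: xI; apply: mem_set.
  by rewrite /I /= in_itv/= -ler_norml.
rewrite (@RintegralD _ _ R mu _ _ _ mD icc iE) (@RintegralB _ _ R mu _ _ _ mD (ic C1) iCI).
rewrite (@RintegralZl _ _ R mu _ _ _ mD ik) lerD2r -Rintegral_mkcondr DI !Rintegral_cst//.
have -> : fine (mu D) = 2.
  by rewrite [X in fine X]lebesgue_measure_itv/= lte_fin gtrN ?ltr01//= opprK.
have cc : - c <= c by lra.
by rewrite fine_measure_cc//; lra.
Qed.

End TailIntegral.

Lemma acos_itv (R : realType) (x : R) : -1 < x < 1 -> [/\ 0 < acos x < pi, cos (acos x) = x & sin (acos x) = Num.sqrt (1 - x ^+ 2)].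
Proof.
move=> /andP[x1 x2]; have h : -1 <= x <= 1 by rewrite !ltW.
split; [|by rewrite acosK ?in_itv//=|by rewrite sin_acos].
by rewrite acos_gt0 ?acos_ltpi ?x1 ?x2 ?ltW.
Qed.

(** * Density, change of variable and limit of the entropy integral *)

Section Density.
Variables (R : realType) (lam a : R).
Hypotheses (hl : 1 <= lam) (ha : 0 <= a).
Local Notation mu := (@lebesgue_measure R).
Local Notation A := (pA lam a).
Local Notation q := (tt_poly A).
Local Notation S := (pSt lam a).
Local Notation F := (pf lam a).
Local Notation D := (`]-1, 1[%classic : set R).
Let S0 theta : 0 < S theta. Proof. exact: pSt_gt0. Qed.
Let p0 : 0 < (pi : R). Proof. exact: pi_gt0. Qed.
Let p2 : 2 <= (pi : R). Proof. exact: pi_ge2. Qed.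

(** The density for which [tt_orthonormal] makes the [q n] orthonormal, hence of unit mass. *)
Definition pdens (x : R) : R := Num.sqrt (1 - x ^+ 2) / (2 * pi * S (acos x)).
Definition pg n (x : R) : R := (q n).[x] ^+ 2 * pdens x.

Lemma pg_cos n theta : 0 < theta < pi -> pg n (cos theta) = F n theta / (pi * sin theta).
Proof.
move=> ht; have s0 := sin_gt0_pi ht; have /andP[t0 tp] := ht.
have ac : acos (cos theta) = theta by rewrite cosK// in_itv/= !ltW.
rewrite /pg /pdens ac -sin2cos2 sqrtr_sqr gtr0_norm// /pf.
by have := lt0r_neq0 (S0 theta); have := lt0r_neq0 p0; move: (S theta) (pi : R) => s P P0 hs; field; rewrite P0 hs gt_eqF.
Qed.

Lemma pg_acos n x : -1 < x < 1 -> pg n x = F n (acos x) / (pi * Num.sqrt (1 - x ^+ 2)).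
Proof. by move=> /acos_itv[h1 h2 h3]; rewrite -{1}h2 pg_cos// h3. Qed.

Lemma pdens_ge0 x : 0 <= pdens x.
Proof.
have S2 : 0 < 2 * pi * S (acos x) by rewrite pmulr_rgt0// mulr_gt0.
by rewrite /pdens divr_ge0 ?sqrtr_ge0// ltW.
Qed.

Lemma pg_ge0 n x : 0 <= pg n x.
Proof. by rewrite /pg mulr_ge0 ?sqr_ge0 ?pdens_ge0. Qed.

Lemma continuous_pphi theta : 0 < theta < pi -> {for theta, continuous (pphi a)}.
Proof.
move=> /sin_gt0_pi s0; apply: cvgM; first by apply: cvgMr; exact: continuous_cos.
by apply: cvgV; [exact: lt0r_neq0|exact: continuous_sin].
Qed.

Lemma continuous_pSt theta : 0 < theta < pi -> {for theta, continuous S}.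
Proof.
move=> ht; have s0 := sin_gt0_pi ht; have cp := continuous_pphi ht.
have cl : {for theta, continuous (fun t : R => ln (2 * sin t))}.
  apply: (continuous_comp (f := fun y : R => 2 * sin y)); first by apply: cvgMr; exact: continuous_sin.
  by apply: continuous_ln; rewrite mulr_gt0.
apply: cvgM.
  apply: cvgMr; apply: cvgMr; apply: cvgV; first by rewrite lt0r_neq0// gnorm2_gt0.
  by apply: (continuous_comp (f := pphi a)); [exact: cp|exact: continuous_gnorm2].
apply: (@continuous_comp _ _ _ (fun t => 2 * ((1 - lam) * ln (2 * sin t) + pphi a t * (pi / 2 - t))) expR); last exact: continuous_expR.
apply: cvgMr; apply: cvgD; first exact: cvgMr.
by apply: cvgM; [exact: cp|apply: cvgB; [exact: cvg_cst|exact: cvg_id]].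
Qed.

Lemma continuous_pdens x : -1 < x < 1 -> {for x, continuous pdens}.
Proof.
move=> hx; have [h1 _ _] := acos_itv hx.
apply: cvgM; first exact: continuous_sqrt1B.
apply: cvgV; first by rewrite lt0r_neq0// pmulr_rgt0// mulr_gt0.
apply: cvgMr; apply: (continuous_comp (f := @acos R)); first exact: continuous_acos.
exact: continuous_pSt.
Qed.

Lemma continuous_pg n x : -1 < x < 1 -> {for x, continuous (pg n)}.
Proof.
move=> hx; apply: cvgM; last exact: continuous_pdens.
rewrite expr2; under eq_fun do rewrite expr2.
by apply: cvgM; exact: continuous_horner.
Qed.

Lemma continuous_xlnx_pg n x : -1 < x < 1 -> {for x, continuous (fun x => xlnx (pg n x))}.
Proof. by move=> hx; apply: (continuous_comp (f := pg n)); [exact: continuous_pg|exact: continuous_xlnx]. Qed.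

Lemma continuous_pf n theta : 0 < theta < pi -> {for theta, continuous (F n)}.
Proof.
move=> ht; apply: cvgM; last first.
  by apply: cvgV; [rewrite lt0r_neq0// pmulr_rgt0|apply: cvgMr; exact: continuous_pSt].
have cq : {for theta, continuous (fun t : R => (q n).[cos t])}.
  by apply: (continuous_comp (f := @cos R)); [exact: continuous_cos|exact: continuous_horner].
have cs := @continuous_sin R theta.
by rewrite !expr2; under eq_fun do rewrite !expr2; apply: cvgM; [exact: (cvgM cq cq)|exact: (cvgM cs cs)].
Qed.

Lemma measurable_xlnx_pg n : measurable_fun D (fun x => xlnx (pg n x)).
Proof.
apply: continuous_on_measurable; [exact: measurable_itv|exact: interval_open|].
by move=> x; rewrite /= in_itv/=; exact: continuous_xlnx_pg.
Qed.

Let D1 n : pD lam a n = 1 - (2 * A n) ^+ 2. Proof. by rewrite /pD; ring. Qed.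

Lemma pg_tail n x : -1 < x < 1 ->
  pg n.+1 x * (`|x ^+ 2 - 4 * A n.+1 ^+ 2| + gap lam a n) <= 2 * Num.sqrt (1 - x ^+ 2).
Proof.
move=> hx; have [h1 h2 h3] := acos_itv hx; have s0 := sin_gt0_pi h1.
have h := pf_tail hl ha n h1; rewrite h2 in h.
rewrite pg_acos// -h3; set s := sin _ in s0 h *; set B := _ + gap _ _ _ in h *.
rewrite mulrAC ler_pdivrMr ?mulr_gt0//; apply: le_trans h _.
rewrite (_ : 2 * s * (pi * s) = (2 * pi) * s ^+ 2); last by ring.
by rewrite ler_wpM2r ?sqr_ge0//; move: p2; lra.
Qed.

Lemma pg_le n x : 0 < gap lam a n -> -1 < x < 1 -> pg n.+1 x <= 2 / gap lam a n.
Proof.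
move=> g0 hx; rewrite ler_pdivlMr//; have h := pg_tail n hx.
have s1 : Num.sqrt (1 - x ^+ 2) <= 1 by rewrite -[leRHS]sqrtr1 ler_wsqrtr// gerBl sqr_ge0.
apply: le_trans (_ : pg n.+1 x * (`|x ^+ 2 - 4 * A n.+1 ^+ 2| + gap lam a n) <= _).
  by rewrite ler_wpM2l ?pg_ge0// lerDr.
by apply: (le_trans h); move: s1; lra.
Qed.

(** Where the density is at most 1, [|xlnx|] is at most 1. Where it exceeds 1, the logarithm is
    estimated crudely by [ln (2 / gap)] from [pg_le], while the factor itself keeps the sharper
    bound of [pg_tail], integrable uniformly up to a logarithm. *)
Lemma xlnx_pg_tail n x : 0 < gap lam a n -> -1 < x < 1 ->
  1 - x ^+ 2 <= 2 * pD lam a n.+1 -> 2 * pD lam a n.+1 <= 2^-1 ->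
  `|xlnx (pg n.+1 x)| <= 1 + 2 * Num.sqrt (2 * pD lam a n.+1) * ln (2 / gap lam a n) *
     (`| `|x| - 2 * A n.+1| + gap lam a n)^-1.
Proof.
move=> g0 hx hs hD; set g := pg _ _; set B := `| `|x| - _| + _.
have gg := pg_le g0 hx; rewrite -/g in gg.
have gp : 0 <= g by exact: pg_ge0.
have B0 : 0 < B by rewrite ltr_wpDl.
have l0 : 0 <= ln (2 / gap lam a n).
  by apply: ln_ge0; rewrite ler_pdivlMr// mul1r (le_trans (gap_le1 hl ha n))// ler1n.
have A1 := pA_gt0 hl ha n.+1.
have hg : g <= 2 * Num.sqrt (2 * pD lam a n.+1) / B.
  rewrite ler_pdivlMr//; apply: le_trans (_ : 2 * Num.sqrt (1 - x ^+ 2) <= _); last first.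
    by rewrite ler_pM2l// ler_wsqrtr.
  apply: le_trans (pg_tail n hx); rewrite ler_wpM2l// lerD2r.
  (* In the caps both [|x|] and [2 * A n.+1] are at least 1/2, so the factor [|x| + 2 * A n.+1] is
     at least 1 and may be dropped; what remains has the form treated by [Rintegral_reciprocal]. *)
  have -> : x ^+ 2 - 4 * A n.+1 ^+ 2 = (`|x| - 2 * A n.+1) * (`|x| + 2 * A n.+1).
    by rewrite -subr_sqr real_normK ?num_real//; ring.
  rewrite normrM ler_peMr// ger0_norm; last by rewrite addr_ge0 ?mulr_ge0// ltW.
  have x2 : 4^-1 <= `|x| ^+ 2 by rewrite real_normK ?num_real//; move: hs hD; lra.
  have a2 : 4^-1 <= (2 * A n.+1) ^+ 2 by move: hD; rewrite D1; lra.
  have A2 : 0 <= 2 * A n.+1 by rewrite mulr_ge0// ltW.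
  have half (y : R) : 0 <= y -> 4^-1 <= y ^+ 2 -> 2^-1 <= y.
    by move=> y0 y2; rewrite leNgt; apply/negP => h; nra.
  have := half _ (normr_ge0 x) x2; have := half _ A2 a2; lra.
have h2 : 0 <= 2 * Num.sqrt (2 * pD lam a n.+1) / B by rewrite divr_ge0 ?mulr_ge0 ?sqrtr_ge0// ltW.
have [g1|g1] := leP g 1.
  apply: le_trans (_ : 1 <= _).
    rewrite ler_norml xlnx_ge//= (le_trans (xlnx_le gp))// expr_le1//.
  by rewrite lerDl mulrAC mulr_ge0.
rewrite ger0_norm; last by rewrite /xlnx mulr_ge0// ln_ge0// ltW.
apply: le_trans (_ : g * ln (2 / gap lam a n) <= _).
  rewrite /xlnx ler_wpM2l// ler_ln ?posrE// ?divr_gt0//; exact: lt_trans g1.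
apply: le_trans (ler_wpM2r l0 hg) _.
by rewrite mulrAC lerDr.
Qed.


Let mD : measurable D. Proof. exact: measurable_itv. Qed.

(** The bound depends on [n]. It follows from [A 0 ^+ 2 <= S], which makes the density bounded, and
    it serves integrability as well as the case of constant coefficients. *)
Lemma xlnx_pg_bounded n : exists M, forall x, D x -> `|xlnx (pg n x)| <= M.
Proof.
have cq : {within `[-1, 1], continuous (fun x : R => (q n).[x] ^+ 2)}.
  apply: continuous_subspaceT => x; apply: (@continuous_comp _ _ _ (fun x => (q n).[x]) (fun y => y ^+ 2)).
    exact: continuous_horner.
  exact: exprn_continuous.
have n11 : -1 <= (1 : R) by lra.
have [m _ hm] := EVT_max n11 cq.
have A2 : 0 < 2 * pi * A 0 ^+ 2 by rewrite pmulr_rgt0 ?exprn_gt0 ?pA_gt0// mulr_gt0.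
pose B := (q n).[m] ^+ 2 * (1 / (2 * pi * A 0 ^+ 2)).
exists (1 + B ^+ 2) => x; rewrite /= in_itv/= => hx; have [h1 h2 h3] := acos_itv hx.
have SA : A 0 ^+ 2 <= S (acos x).
  apply: le_trans (turan_lt_pSt hl ha 0 h1); exact: (turan_ge (pA_gt0 hl ha) (pA_nd hl ha)).
have gB : pg n x <= B.
  rewrite /pg /B ler_pM ?sqr_ge0 ?pdens_ge0//.
    by apply: hm; have /andP[x1 x2] := hx; rewrite in_itv/= !ltW.
  have S2 : 0 < 2 * pi * S (acos x) by rewrite pmulr_rgt0// mulr_gt0.
  rewrite /pdens ler_pM ?sqrtr_ge0 ?invr_ge0 ?(ltW S2)//.
    by rewrite -[leRHS]sqrtr1 ler_wsqrtr// gerBl sqr_ge0.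
  by rewrite lef_pV2 ?posrE// ler_pM2l// mulr_gt0.
have g0 := pg_ge0 n x.
rewrite ler_norml; apply/andP; split.
  by apply: le_trans (xlnx_ge g0); rewrite lerN2 lerDl sqr_ge0.
apply: le_trans (xlnx_le g0) _; apply: (@le_trans _ _ (B ^+ 2)); last by rewrite lerDr.
by rewrite lerXn2r ?nnegrE// (le_trans g0).
Qed.

(** Substituting [x = cos t] produces a factor [sin t], which cancels the one in
    [pg = F / (pi * sin t)]; the logarithm of [pi * sin t] is what remains beside [xlnx F]. *)
Let middle n be : 0 < be -> be < pi / 2 ->
  \int[mu]_(x in `[- cos be, cos be]) xlnx (pg n x) =
  pi^-1 * \int[mu]_(t in `[be, pi - be]) (xlnx (F n t) - F n t * (ln pi + ln (sin t))).
Proof.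
move=> b0 bp.
have bpi : be <= pi - be by move: bp; move: (pi : R) => P; lra.
have pbp : pi - be <= pi by rewrite gerBl ltW.
have bep : be < pi by move: bp p0; move: (pi : R) => P; lra.
have cb1 : cos be < 1.
  by rewrite -cos0 ltr_cos// ?in_itv/= ?lexx ?(ltW p0)// ?(ltW b0)// ltW.
have cpb : cos (pi - be) = - cos be by rewrite cosB cospi sinpi mul0r addr0 mulN1r.
have cG : {within `[cos (pi - be), cos be], continuous (fun x => xlnx (pg n x))}.
  apply: continuous_in_subspaceT => x; rewrite inE/= in_itv/= cpb => /andP[h1 h2].
  by apply: continuous_xlnx_pg; apply/andP; split; [move: h1 cb1; lra|move: h2 cb1; lra].
rewrite -cpb (Rintegral_subst_cos (ltW b0) bpi pbp cG).
have inI t : be <= t <= pi - be -> 0 < t < pi.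
  by move=> /andP[h1 h2]; rewrite (lt_le_trans b0 h1)/= (le_lt_trans h2)// gtrBl.
have mI : measurable (`[be, pi - be]%classic : set R) by exact: measurable_itv.
have ii : mu.-integrable `[be, pi - be] (EFin \o (fun t => xlnx (F n t) - F n t * (ln pi + ln (sin t)))).
  apply: integrable_cc => t /inI ht; have cf := continuous_pf (n := n) ht.
  apply: cvgB; first by apply: (continuous_comp (f := F n)); [exact: cf|exact: continuous_xlnx].
  apply: cvgM => //; apply: cvgD; first exact: cvg_cst.
  apply: continuous_comp; first exact: continuous_sin.
  by apply: continuous_ln; exact: sin_gt0_pi.
rewrite -(@RintegralZl _ _ R mu _ _ _ mI ii); apply: eq_Rintegral => t; rewrite inE/= in_itv/= => /inI ht.
have s0 := sin_gt0_pi ht; rewrite pg_cos//.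
have f0 := pf_ge0 hl ha n t; have sn := lt0r_neq0 s0; have pn := lt0r_neq0 p0.
move: f0; rewrite le_eqVlt => /predU1P[<-|f0].
  by rewrite /xlnx !mul0r subr0 mulr0.
have ps : 0 < pi * sin t by rewrite mulr_gt0.
have e : ln (F n t / (pi * sin t)) = ln (F n t) - (ln pi + ln (sin t)).
  by rewrite ln_div ?posrE// lnM ?posrE.
rewrite /xlnx e -mulrBr invfM; set X := _ - _.
transitivity (pi^-1 * (F n t * X) * ((sin t)^-1 * sin t)); first by ring.
by rewrite mulVf// mulr1.
Qed.

(** Given [bulk_cvg], everything reduces to caps of vanishing angular width [be n] outside of which
    [F n <= 4]. The choice of [be] is left open because the two cases below make it differently. *)
Let limit_of_tails (be : nat -> R) : (forall n, 0 < be n) -> be n @[n --> \oo] --> (0 : R) ->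
  (forall n x, be n <= x <= pi - be n -> 0 <= F n x <= 4) ->
  \int[mu]_(x in D) xlnx (pg n x) - \int[mu]_(x in `[- cos (be n), cos (be n)]) xlnx (pg n x)
    @[n --> \oo] --> (0 : R) ->
  \int[mu]_(x in D) xlnx (pg n x) @[n --> \oo] --> 1 - ln (pi : R).
Proof.
move=> be0 becvg F4 tl.
have cF n x : (`]0, pi[%classic : set R) x -> {for x, continuous (F n)}.
  by rewrite /= in_itv/=; exact: continuous_pf.
have Fc x : (`]0, pi[%classic : set R) x -> F n x - 2 * sin (pPsi lam a n x) ^+ 2 @[n --> \oo] --> (0 : R).
  by rewrite /= in_itv/=; exact: pf_cvg.
have := bulk_cvg hl ha cF be0 becvg F4 Fc => /(rcvgZ (c := pi^-1)).
rewrite mulrA mulVf ?lt0r_neq0// mul1r => h.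
have ph : 0 < (pi / 2 : R) by rewrite divr_gt0.
have h2 : \int[mu]_(x in `[- cos (be n), cos (be n)]) xlnx (pg n x) @[n --> \oo] --> 1 - ln (pi : R).
  apply: cvg_trans h; apply: near_eq_cvg.
  have : \forall n \near \oo, be n < pi / 2 by apply: (cvgr_lt _ becvg).
  by apply: filterS => n hn; rewrite middle.
have := rcvgD tl h2; rewrite add0r => h3.
by apply: rcvg_ext h3 => n; rewrite subrK.
Qed.

(** This is [lam = 1], [a = 0]: all coefficients are 1/2 and [gap] vanishes, so [pf_tail]
    degenerates at the turning point. But [F n <= 4] then holds on the whole interval, and the caps
    may be taken as small as desired. *)
Let trivial_case : pD lam a 0 = 0 -> \int[mu]_(x in D) xlnx (pg n x) @[n --> \oo] --> 1 - ln (pi : R).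
Proof.
move=> hD.
have ll : 0 <= lam * (lam - 1) by rewrite mulr_ge0//; move: hl; lra.
have la : 0 <= 2 * lam * a by rewrite !mulr_ge0// (le_trans ler01).
have u0 n : 0 < pu lam a n by apply: lt_le_trans (pu_ge hl ha n).
have num0 : lam * (lam - 1) + 2 * lam * a + a ^+ 2 + a = 0.
  move: hD; rewrite (pDE hl ha) mulr0 add0r => /eqP.
  have U0 : pu lam a 0 * (pu lam a 0 + 1) != 0 by rewrite lt0r_neq0// mulr_gt0// addr_gt0.
  by rewrite mulf_eq0 invr_eq0 (negbTE U0) orbF => /eqP.
have az : a = 0 by apply/eqP; rewrite eq_le ha andbT; move: ll la (sqr_ge0 a) num0; lra.
have lz : lam = 1.
  move: num0; rewrite az mulr0 expr0n/= !addr0 => /eqP; rewrite mulf_eq0 subr_eq0 => /orP[/eqP h|/eqP//].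
  by move: hl; rewrite h; lra.
have D0 n : pD lam a n = 0.
  by rewrite (pDE hl ha) (_ : 2 * a * n%:R + _ + _ + _ + _ = 0) ?mul0r// az lz; ring.
have [M hM] := choice xlnx_pg_bounded.
have zD : D 0 by rewrite /= in_itv/= ltrN10 ltr01.
have M0 n : 0 <= M n by apply: le_trans (hM n 0 zD).
(* The caps have total length at most [2 * be n ^ 2]; with this choice their contribution
   [2 * M n * be n ^ 2] is at most [2 / (n + 1)] in spite of the growth of [M n]. *)
pose be n : R := (n.+2%:R * (M n + 1))^-1.
have be0 n : 0 < be n by rewrite /be invr_gt0 mulr_gt0// ltr_wpDl.
have beh n : be n <= n.+1%:R^-1.
  rewrite /be lef_pV2 ?posrE// ?mulr_gt0// ?ltr_wpDl//.
  by apply: le_trans (_ : n.+2%:R * 1 <= _); [rewrite mulr1 ler_nat|rewrite ler_pM2l// lerDr].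
have hc := @cvg_harmonic R.
have becvg : be n @[n --> \oo] --> (0 : R).
  apply: (@squeeze_cvgr _ _ _ _ (cst 0) _ _ _ _ _ hc); last exact: cvg_cst.
  by apply: nearW => n; rewrite beh ltW/=.
apply: (limit_of_tails be0 becvg).
  move=> n x /andP[h1 h2]; rewrite (pf_ge0 hl ha)/=.
  have hx : 0 < x < pi by rewrite (lt_le_trans (be0 n) h1)/= (le_lt_trans h2)// gtrBl.
  by apply: pf_le4 => //; rewrite D0 mulr0 sqr_ge0.
have h2c : 2 * n.+1%:R^-1 @[n --> \oo] --> (0 : R) by have := rcvgZ (c := 2) hc; rewrite mulr0.
have ph : 0 < (pi / 2 : R) by rewrite divr_gt0.
apply: norm_cvg0; apply: (@squeeze_cvgr _ _ _ _ (cst 0) _ _ _ _ _ h2c); last exact: cvg_cst.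
have nb : \forall n \near \oo, be n < pi / 2 by apply: (cvgr_lt _ becvg).
apply: filterS nb => n hn; rewrite normr_ge0/=.
have c01 : 0 <= cos (be n) < 1.
  rewrite cos_ge0_pihalf/= ?(ltW hn) ?andbT; last by rewrite (le_trans _ (ltW (be0 n)))// oppr_le0 ltW.
  rewrite -cos0 ltr_cos ?in_itv/= ?lexx ?(ltW p0) ?(ltW (be0 n))//=.
  by move: hn p0; move: (pi : R) => P; lra.
have ik : mu.-integrable D (EFin \o (fun _ : R => (0 : R))).
  exact: integrable_cst_oo.
apply: le_trans (@Rintegral_tail R _ (fun _ => 0) (cos (be n)) (M n) (M n) 0 c01 (lexx 0) (measurable_xlnx_pg n) (hM n) ik (fun _ => lexx 0) (M0 n) _) _.
  by move=> x Dx _; rewrite mulr0 addr0 hM.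
rewrite mul0r addr0 mulrCA ler_pM2l//.
have h1 := one_minus_cos_le (be n).
apply: le_trans (ler_wpM2l (M0 n) h1) _; rewrite expr2 mulrA.
rewrite -[leRHS]mul1r ler_pM ?mulr_ge0 ?(ltW (be0 n))//.
rewrite /be ler_pdivrMr ?mul1r; last by rewrite mulr_gt0// ltr_wpDl.
by rewrite -natr1; have := ler0n R n.+1; have := M0 n; move: (n.+1%:R) (M n) => N m; nra.
Qed.

Let lecos (x y : R) : 0 <= x <= pi -> 0 <= y <= pi -> (cos x <= cos y) = (y <= x).
Proof. by move=> hx hy; rewrite leNgt ltr_cos ?in_itv// -leNgt. Qed.

Lemma entropy_integral_cvg : \int[mu]_(x in D) xlnx (pg n x) @[n --> \oo] --> 1 - ln (pi : R).
Proof.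
have [hD|hD] := eqVneq (pD lam a 0) 0; first exact: trivial_case.
have [K K0 hK] := gap_ge hl ha hD.
have ph : 0 < (pi / 2 : R) by rewrite divr_gt0.
pose de n := 2 * pD lam a n.
have de_cvg : de n @[n --> \oo] --> (0 : R) by have := rcvgZ (c := 2) (pD_cvg hl ha); rewrite mulr0.
have de0 n : 0 < de n.
  rewrite /de pmulr_rgt0//; case: n => [|n]; first by rewrite lt_neqAle eq_sym hD pD_ge0.
  have [_ g0] := hK n.+1; have := pD_ge0 hl ha n.+2; move: g0; rewrite /gap /pD; lra.
pose c n := Num.sqrt (1 - de n).
(* Where [acos] applies, [sin (be n) ^ 2 = de n], the threshold of [pf_le4]. The default [pi]
   empties the segment [[be n, pi - be n]], so the bound by 4 holds vacuously for the first
   indices. *)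
pose be n := if de n <= 2^-1 then acos (c n) else pi.
have good n : de n <= 2^-1 -> [/\ 0 < be n < pi / 2, cos (be n) = c n & sin (be n) ^+ 2 = de n].
  move=> hn; have d0 := de0 n.
  have c0 : 0 < c n by rewrite sqrtr_gt0; lra.
  have c1 : c n < 1 by rewrite -[ltRHS]sqrtr1 ltr_sqrt//; lra.
  have cc : -1 < c n < 1 by rewrite c1 andbT; lra.
  have [h1 h2 h3] := acos_itv cc; rewrite /be hn; split => //.
    have /andP[-> h] := h1; rewrite /= ltNge; apply/negP => hp.
    suff : cos (acos (c n)) <= 0 by rewrite h2; lra.
    rewrite -(cos_pihalf R) lecos//; first by rewrite (ltW h) (le_trans (ltW ph)).
    by rewrite (ltW ph)/=; move: p0; move: (pi : R) => P; lra.
  by rewrite h3 /c !sqr_sqrtr; lra.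
have be0 n : 0 < be n.
  by have [hn|hn] := boolP (de n <= 2^-1); [have [/andP[]] := good n hn|rewrite /be (negbTE hn)].
have nd : \forall n \near \oo, de n < 2^-1 by apply: (cvgr_lt _ de_cvg); rewrite invr_gt0.
have sde : Num.sqrt (de n) @[n --> \oo] --> (0 : R).
  have h2 := @sqrt_continuous R 0; rewrite /continuous_at sqrtr0 in h2.
  exact: (cvg_comp _ _ de_cvg h2).
have becvg : be n @[n --> \oo] --> (0 : R).
  have h := rcvgZ (c := 2) sde; rewrite mulr0 in h.
  apply: (@squeeze_cvgr _ _ _ _ (cst 0) _ _ _ _ _ h); last exact: cvg_cst.
  apply: filterS nd => n /ltW hn; rewrite (ltW (be0 n))/=.
  have [/andP[b0 bp] _ hs] := good n hn.
  have hsin := half_le_sin (ltW b0) (ltW bp).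
  have s0 : 0 <= sin (be n) by apply: le_trans hsin; rewrite divr_ge0// ltW.
  rewrite -hs sqrtr_sqr ger0_norm//; move: hsin; lra.
apply: (limit_of_tails be0 becvg).
  move=> n x /andP[h1 h2]; rewrite (pf_ge0 hl ha)/=.
  have hx : 0 < x < pi by rewrite (lt_le_trans (be0 n) h1)/= (le_lt_trans h2)// gtrBl.
  apply: pf_le4 => //; rewrite -/(de n).
  have hn : de n <= 2^-1.
    rewrite leNgt; apply/negP => hn; move: h1; rewrite /be (lt_geF hn) => h1.
    by have /andP[_ xp] := hx; rewrite leNgt xp in h1.
  have [/andP[b0 bp] _ hs] := good n hn; rewrite -hs.
  have s1 : 0 <= sin (be n) by rewrite sin_ge0_pi// (ltW b0) (le_trans (ltW bp))//; move: p0; move: (pi : R) => P; lra.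
  have cx : cos x ^+ 2 <= cos (be n) ^+ 2.
    have cb : 0 <= cos (be n) by rewrite cos_ge0_pihalf// (ltW bp) andbT (le_trans _ (ltW b0))// oppr_le0 ltW.
    rewrite -[leLHS]real_normK ?num_real// lerXn2r ?nnegrE// ler_norml.
    have bpi : be n <= pi by move: bp p0; move: (pi : R) => P; lra.
    have /andP[x0 xp] := hx.
    rewrite -(opprK (cos x)) lerN2 andbC; apply/andP; split.
      by rewrite opprK lecos ?(ltW b0) ?(ltW x0) ?(ltW xp).
    have -> : - cos x = cos (pi - x) by rewrite cosB cospi sinpi mul0r addr0 mulN1r.
    rewrite lecos ?(ltW b0) ?subr_ge0 ?(ltW xp) ?gerBl ?(ltW x0)//.
    by move: h2; move: (pi : R) => P; lra.
  by have := cos2Dsin2 x; have := cos2Dsin2 (be n); move: cx; lra.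
pose G n := \int[mu]_(x in D) xlnx (pg n x) - \int[mu]_(x in `[- cos (be n), cos (be n)]) xlnx (pg n x).
(* The index is shifted because the tail bound for [q n.+1] involves [gap n]. *)
suff : G n.+1 @[n --> \oo] --> (0 : R) by rewrite (cvg_shiftS G (nbhs (0 : R))).
(* The first term is the constant 1 of [xlnx_pg_tail] over caps of length
   [2 (1 - c) <= 2 (1 - c ^ 2)]; the second is [2 sqrt (2 pD) ln (2 / gap)] times the integral bound
   [4 ln (2 / gap)]. *)
pose bound n := 2 * de n.+1 + 8 * Num.sqrt 2 * (Num.sqrt (pD lam a n.+1) * ln (2 / gap lam a n) ^+ 2).
have bcvg : bound n @[n --> \oo] --> (0 : R).
  have h1 := rcvgZ (c := 2) (rcvgS de_cvg).
  have h2 := rcvgZ (c := 8 * Num.sqrt 2) (log_gap_cvg hl ha hD).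
  by have := rcvgD h1 h2; rewrite !mulr0 addr0.
apply: norm_cvg0; apply: (@squeeze_cvgr _ _ _ _ (cst 0) _ _ _ _ _ bcvg); last exact: cvg_cst.
have nd1 : \forall n \near \oo, de n.+1 < 2^-1 by apply: (cvgr_lt _ (rcvgS de_cvg)); rewrite invr_gt0.
apply: filterS nd1 => n /ltW hn; rewrite normr_ge0/= /G.
have [/andP[b0 bp] cb hs] := good _ hn; have [_ g0] := hK n.
have c0 : 0 <= cos (be n.+1) by rewrite cb sqrtr_ge0.
have cc2 : cos (be n.+1) ^+ 2 = 1 - de n.+1 by rewrite -(cos2Dsin2 (be n.+1)) hs addrK.
have c1 : cos (be n.+1) < 1.
  by rewrite cb -[ltRHS]sqrtr1 ltr_sqrt//; have := de0 n.+1; lra.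
have g1 := gap_le1 hl ha n.
have A1 := pA_gt0 hl ha n.+1; have A2 := pA_half hl ha n.+1.
have l0 : 0 <= ln (2 / gap lam a n).
  by apply: ln_ge0; rewrite ler_pdivlMr// mul1r (le_trans g1)// ler1n.
pose E := 2 * Num.sqrt (de n.+1) * ln (2 / gap lam a n).
have E0 : 0 <= E by rewrite !mulr_ge0 ?sqrtr_ge0.
have A20 : 0 <= 2 * A n.+1 by rewrite mulr_ge0// ltW.
have A21 : 2 * A n.+1 <= 1 by lra.
have [ik Ik] := Rintegral_reciprocal A20 A21 g0 g1.
have c01 : 0 <= cos (be n.+1) < 1 by rewrite c0.
have [M Mb] := xlnx_pg_bounded n.+1.
have k0 (x : R) : 0 <= (`| `|x| - 2 * A n.+1| + gap lam a n)^-1 by rewrite invr_ge0 addr_ge0// ltW.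
apply: le_trans (@Rintegral_tail R _ _ (cos (be n.+1)) _ 1 E c01 E0 (measurable_xlnx_pg n.+1) Mb ik k0 ler01 _) _.
  move=> x; rewrite /= in_itv/= => hx hc; apply: xlnx_pg_tail => //.
  have : cos (be n.+1) ^+ 2 <= `|x| ^+ 2 by rewrite lerXn2r ?nnegrE// ltW.
  by rewrite cc2 real_normK ?num_real// -/(de n.+1); lra.
rewrite mul1r /bound lerD//.
  rewrite ler_pM2l//; move: c0 c1 cc2; move: (cos _) (de _) => C d *; nra.
apply: le_trans (ler_wpM2l E0 Ik) _; rewrite /E /de sqrtrM//.
rewrite le_eqVlt; apply/orP; left; apply/eqP; ring.
Qed.

End Density.

(** * The Pollaczek weight *)

Section Assembly.
Variables (R : realType) (lam a : R).
Hypotheses (hl : 1 <= lam) (ha : 0 <= a).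
Local Notation mu := (@lebesgue_measure R).
Local Notation A := (pA lam a).
Local Notation q := (tt_poly A).
Local Notation D := (`]-1, 1[%classic : set R).
Local Notation v := (pdens lam a).
Local Notation w := (pollaczek_weight lam a).
Let mD : measurable D. Proof. exact: measurable_itv. Qed.
Let p0 : 0 < (pi : R). Proof. exact: pi_gt0. Qed.
Let DE (x : R) : D x -> -1 < x < 1. Proof. by rewrite /= in_itv. Qed.

Let cv x : D x -> {for x, continuous v}. Proof. by move=> /DE; exact: continuous_pdens. Qed.

Lemma tt_poly_orthonormal j k :
  mu.-integrable D (EFin \o (fun x => (q j).[x] * (q k).[x] * v x)) /\
  \int[mu]_(x in D) ((q j).[x] * (q k).[x] * v x) = (j == k)%:R.
Proof.
have h1 (x : R) : -1 < x < 1 -> (turan A n).[x] @[n --> \oo] --> pSt lam a (acos x).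
  by move=> hx; have [h2 h3 _] := acos_itv hx; rewrite -{1}h3; exact: pSt_cvg.
have h2 (x : R) : -1 < x < 1 -> exists M, forall n, `|(q n).[x]| <= M.
  by move=> hx; have [h2 h3 _] := acos_itv hx; rewrite -h3; exact: (pq_bounded hl ha h2).
have [i e] := @tt_orthonormal R A (pA_gt0 hl ha) (pA_half hl ha) (pA_nd hl ha) (fun x => pSt lam a (acos x)) j k (pA_cvg hl ha) h1 h2.
have iD : mu.-integrable D (EFin \o (fun x => (q j).[x] * (q k).[x] * v x)).
  by apply: (integrableS _ _ _ i) => //; exact: subset_itv_oo_cc.
split => //; rewrite -[RHS]e (@Rintegral_bndoo _ _ (-1) 1 true false)//.
by have /integrableP[/measurable_EFinP] := iD.
Qed.

Let iv : mu.-integrable D (EFin \o v).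
Proof.
have [h _] := tt_poly_orthonormal 0 0.
by apply: eq_integrable h => // x _ /=; rewrite !hornerC !mul1r.
Qed.

Let ipv (P : {poly R}) : mu.-integrable D (EFin \o (fun x => P.[x] * v x)).
Proof.
have cq : {within `[-1, 1], continuous (fun x : R => `|P.[x]|)}.
  apply: continuous_subspaceT => x; apply: cvg_norm; exact: continuous_horner.
have n11 : -1 <= (1 : R) by lra.
have [m _ hm] := EVT_max n11 cq.
apply: (integrable_dom mD _ _ (integrable_scale `|P.[m]| mD iv)).
  apply: continuous_on_measurable; [exact: mD|exact: interval_open|].
  by move=> x Dx; apply: cvgM; [exact: continuous_horner|exact: cv].
move=> x /DE /andP[x1 x2]; rewrite normrM [`|v x|]ger0_norm ?pdens_ge0//.
by rewrite ler_wpM2r ?pdens_ge0//; apply: hm; rewrite in_itv/= !ltW.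
Qed.

Let ip (P : {poly R}) := \int[mu]_(x in D) (P.[x] * v x).

Let ipD P Q : ip (P + Q) = ip P + ip Q.
Proof.
rewrite /ip -(@RintegralD _ _ R mu _ _ _ mD (ipv P) (ipv Q)).
by apply: eq_Rintegral => x _; rewrite hornerD mulrDl.
Qed.

Let ipZ c P : ip (c *: P) = c * ip P.
Proof.
rewrite /ip -(@RintegralZl _ _ R mu _ _ _ mD (ipv P)).
by apply: eq_Rintegral => x _; rewrite hornerZ -mulrA.
Qed.

Let ip0 : ip 0 = 0.
Proof. by have := ipZ 0 0; rewrite scale0r mul0r. Qed.

Let ip_sum n (c : nat -> R) (b : nat -> {poly R}) Q :
  ip ((\sum_(k < n) c k *: b k) * Q) = \sum_(k < n) c k * ip (b k * Q).
Proof.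
elim: n => [|n IH]; first by rewrite !big_ord0 mul0r ip0.
by rewrite !big_ord_recr/= mulrDl ipD IH -scalerAl ipZ.
Qed.

Let ipq j k : ip (q j * q k) = (j == k)%:R.
Proof.
have [_ <-] := tt_poly_orthonormal j k; apply: eq_Rintegral => x _.
by rewrite hornerM.
Qed.

(* [complex.Re (cGamma (2 lam))] is never evaluated: the constant is determined by
   [hp], see [ratio_gt0]. *)
Definition weight_ratio : R :=
  2 `^ (2 * lam) * (lam + a) / (2 * pi * complex.Re (cGamma (Complex (2 * lam) 0)))
  * (2 * pi * pkap lam a * gam lam ^+ 2 * expR (2 * ((1 - lam) * ln 2))).

(** The reciprocal of [pSt] contains [(2 sin theta)^(2 lam - 2)], which with the factor [sin theta]
    gives the power of [1 - x ^+ 2]; [- 2 phi (pi / 2 - theta)] is the exponent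
    [(2 theta - pi) phi], and [gnorm2] is the squared modulus of Gamma. Constants are collected in
    [weight_ratio]. *)
Lemma pollaczek_weightE x : -1 < x < 1 -> w x = weight_ratio * v x.
Proof.
move=> hx; have [h1 h2 h3] := acos_itv hx; have s0 := sin_gt0_pi h1.
have hs : 0 < 1 - x ^+ 2.
  by have := cos2Dsin2 (acos x); rewrite h2; have := exprn_gt0 2 s0; lra.
have hphi : a * x / Num.sqrt (1 - x ^+ 2) = pphi a (acos x) by rewrite /pphi h2 h3.
rewrite /pollaczek_weight hphi normc_cGamma /weight_ratio.
set c := _ / (2 * pi * _); move: c => c.
set t := powR _ _; set E0 := expR _; set G0 := gnorm2 _ _; set K0 := 2 * pi * pkap _ _ * _ * _.
rewrite -[LHS]mulrA -[LHS]mulrA -[RHS]mulrA; congr (c * _); rewrite {}/t {}/E0 {}/G0 {}/K0.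
rewrite /pdens /pSt -h3; set ph := pphi a (acos x); set th := acos x in h1 h2 h3 s0 *.
have g0 := gnorm2_gt0 ph hl; have gl := gam_gt0 hl; have k0 := pkap_gt0 hl ha.
have lnS : ln (1 - x ^+ 2) = 2 * ln (sin th).
  by rewrite h3 -[in LHS](sqr_sqrtr (ltW hs)) lnXn ?sqrtr_gt0// mulr_natl.
have e1 : (1 - x ^+ 2) `^ (lam - 2^-1) = expR ((lam - 2^-1) * (2 * ln (sin th))).
  by rewrite /powR gt_eqF// lnS.
have e2 : sin th = expR (ln (sin th)) by rewrite lnK ?posrE.
have e3 : ln (2 * sin th) = ln 2 + ln (sin th) by rewrite lnM ?posrE.
rewrite e1 e3; set l := ln (sin th) in e2 *; rewrite [in RHS]e2.
set l2 := ln 2; set g := gnorm2 _ _.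
have E (y : R) : expR y != 0 by rewrite expR_eq0.
have -> : expR (2 * ((1 - lam) * (l2 + l) + ph * (pi / 2 - th))) =
  expR (2 * ((1 - lam) * l2)) * expR l / (expR ((lam - 2^-1) * (2 * l)) * expR ((2 * th - pi) * ph)).
  by rewrite -expRD -expRD -expRN -expRD; congr expR; field.
have := E (2 * ((1 - lam) * l2)); have := E l; have := E ((lam - 2^-1) * (2 * l)); have := E ((2 * th - pi) * ph).
move: (expR _) (expR _) (expR _) (expR _) => E1 E2 E3 E4 h4 h5 h6 h7.
have := lt0r_neq0 p0; move: (pi : R) => P P0; move: g0 gl k0; rewrite -/g.
move: (pkap lam a) (gam lam) g => K G g g0 G0 K0.
by field; rewrite ?P0 ?h4 ?h5 ?h6 ?h7 ?gt_eqF.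
Qed.

Section Polynomials.
Variable p : nat -> {poly R}.
Hypothesis hp : orthonormal_polys w p.

Let hip n m : weight_ratio * ip (p n * p m) = (n == m)%:R.
Proof.
have [_ _ /(_ n m) h] := hp.
have e (x : R) : D x -> (p n).[x] * (p m).[x] * w x = weight_ratio * ((p n * p m).[x] * v x).
  by move=> /DE hx; rewrite pollaczek_weightE// hornerM; ring.
have ii := integrable_scale weight_ratio mD (ipv (p n * p m)).
have mw : measurable_fun D (fun x => ((p n).[x] * (p m).[x] * w x)%:E).
  have /integrableP[mi _] := ii.
  apply: (eq_measurable_fun _ _ mi) => x; rewrite inE => Dx /=.
  by rewrite e.
move: h; rewrite integral_itv_bndoo// => h.
have h2 : (\int[mu]_(x in D) (weight_ratio * ((p n * p m).[x] * v x))%:E = ((n == m)%:R)%:E)%E.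
  by rewrite -h; apply: eq_integral => x; rewrite inE => Dx; rewrite e.
by rewrite /ip -(@RintegralZl _ _ R mu _ _ _ mD (ipv (p n * p m))) /Rintegral h2.
Qed.

(** [p 0] is a nonzero constant [c] and the density has unit mass, so the normalisation of [p 0]
    reads [weight_ratio * c ^+ 2 = 1]. *)
Let ratio_gt0 : 0 < weight_ratio.
Proof.
have [sp _ _] := hp; have /eqP := sp 0%N => /size_poly1P[c c0 pc].
have h := hip 0 0; rewrite eqxx/= in h.
have e : ip (p 0%N * p 0%N) = c ^+ 2 * ip 1.
  by rewrite pc -polyCM -[c * c]expr2 -[(c ^+ 2)%:P]mulr1 mul_polyC ipZ.
have i1 : ip 1 = 1.
  by have := ipq 0 0; rewrite tt_poly0 mulr1 => ->.
rewrite e i1 mulr1 in h.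
have c2 : 0 < c ^+ 2 by rewrite exprn_even_gt0.
by rewrite -(pmulr_lgt0 _ c2) h.
Qed.

(** [p n] is orthogonal to all [q j] of lower degree, hence proportional to [q n]; its normalisation
    determines the square of the factor as the inverse of [weight_ratio]. *)
Lemma orthonormal_sqr n x : weight_ratio * (p n).[x] ^+ 2 = (q n).[x] ^+ 2.
Proof.
have [sp lp _] := hp.
have sq k : size (q k) = k.+1 by have [] := size_lead_tt_poly (pA_gt0 hl ha) k.
have pq j : (j < n)%N -> ip (p n * q j) = 0.
  move=> jn; have [d hd] := poly_basis sp (eq_leq (sq j)).
  rewrite hd mulrC ip_sum big1// => k _.
  have kn : (k < n)%N by apply: leq_ltn_trans jn; rewrite -ltnS.
  have := hip k n; rewrite ltn_eqF// => /eqP; rewrite mulf_eq0 (gt_eqF ratio_gt0)/= => /eqP ->.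
  by rewrite mulr0.
have [c hc] := poly_basis sq (eq_leq (sp n)).
have cE j : (j <= n)%N -> ip (p n * q j) = c j.
  move=> jn; rewrite hc ip_sum.
  have jn1 : (j < n.+1)%N by rewrite ltnS.
  rewrite (bigD1 (Ordinal jn1))//= ipq eqxx mulr1 big1 ?addr0// => k kj.
  rewrite ipq (_ : (k == j :> nat) = false) ?mulr0//.
  by apply/negbTE; move: kj; rewrite -val_eqE.
have pn : p n = c n *: q n.
  rewrite hc big_ord_recr/= big1 ?add0r// => k _.
  by rewrite -cE ?pq ?scale0r// ltnW.
have e : p n * p n = c n ^+ 2 *: (q n * q n) by rewrite pn -scalerAl -scalerAr scalerA -expr2.
have := hip n n; rewrite eqxx e ipZ ipq eqxx mulr1 => h.
by rewrite pn hornerZ exprMn mulrA h mul1r.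
Qed.

Let entropyE n : entropy w (p n) = (- \int[mu]_(x in D) xlnx (pg lam a n x))%:E.
Proof.
have e (x : R) : D x -> ln ((p n).[x] ^+ 2 * w x) * ((p n).[x] ^+ 2 * w x) = xlnx (pg lam a n x).
  move=> /DE hx; have -> : (p n).[x] ^+ 2 * w x = pg lam a n x; last by rewrite /xlnx mulrC.
  by rewrite pollaczek_weightE// /pg -orthonormal_sqr; ring.
have [M hM] := xlnx_pg_bounded hl ha n.
have ic : mu.-integrable D (EFin \o (fun _ : R => M)).
  exact: integrable_cst_oo.
have mx := measurable_xlnx_pg hl ha n.
have ii := integrable_dom mD mx hM ic.
have mw : measurable_fun D (fun x => (ln ((p n).[x] ^+ 2 * w x) * ((p n).[x] ^+ 2 * w x))%:E).
  have /integrableP[mi _] := ii.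
  by apply: (eq_measurable_fun _ _ mi) => x; rewrite inE => Dx /=; rewrite e.
rewrite /entropy integral_itv_bndoo// EFinN; congr (- _)%E.
rewrite /Rintegral fineK; last by apply: integrable_fin_num.
by apply: eq_integral => x; rewrite inE => Dx; rewrite e.
Qed.

Lemma entropy_cvg : entropy w (p n) @[n --> \oo] --> (ln (pi : R) - 1)%:E.
Proof.
have -> : (fun n => entropy w (p n)) = EFin \o (fun n => - \int[mu]_(x in D) xlnx (pg lam a n x)).
  by apply/funext => n; exact: entropyE.
apply: cvg_EFin; first exact: nearW.
rewrite (_ : ln pi - 1 = - (1 - ln (pi : R))); last by rewrite opprB.
by apply: cvgN; exact: entropy_integral_cvg.
Qed.

End Polynomials.
End Assembly.

Theorem theorem1p1 (R : realType) (lambda a : R) (p : nat -> {poly R})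
    (ha : 0 <= a) (hlambda : 1 <= lambda)
    (hp : orthonormal_polys (pollaczek_weight lambda a) p) :
  entropy (pollaczek_weight lambda a) (p n) @[n --> \oo]
    --> (ln (pi : R) - 1)%:E.
Proof. exact: entropy_cvg. Qed.
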